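(* Let $M$ be an Orlicz function such that $\alpha_M=\beta_M=2$. If $h_M$ is not Hilbertian, then $h_M$ contains a non-Hilbertian $1^+$-asymptotically Hilbertian subspace.
   Context: The scalar field $\mathbb{K}$ is $\mathbb{R}$ or $\mathbb{C}$. ''Subspace'' of a Banach space means closed vector subspace. A Banach space is Hilbertian if it is isomorphic (linearly homeomorphic) to a Hilbert space. An Orlicz function is a convex function $M\colon [0,\infty)\to[0,\infty)$ with $M(0)=0$ and $\lim_{t\to+\infty}M(t)=+\infty$. For $x\colon\mathbb{N}\to\mathbb{K}$ let $\|x\|_M=\inf\{\rho>0 : \sum_{n=1}^\infty M(|x(n)|/\rho)\leq 1\}$. Let $\ell_M$ be the Banach space of all $x$ with $\|x\|_M<\infty$, normed by $\|\cdot\|_M$, and let $h_M$ be the closed linear span in $\ell_M$ of the unit vectors $e_n$, $n\in\mathbb{N}$. Define $$\alpha_M=\sup\Big\{q : \sup_{\lambda,t\in(0,1]}\frac{M(\lambda t)}{M(\lambda)t^q}<\infty\Big\},\qquad \beta_M=\inf\Big\{q : \inf_{\lambda,t\in(0,1]}\frac{M(\lambda t)}{M(\lambda)t^q}>0\Big\}$$ (with $\inf\emptyset=\infty$); the quotients make sense when $M(\lambda)>0$ for all $\lambda>0$, and this is understood whenever $\alpha_M,\beta_M$ are used. For Banach spaces $E,F$ of the same finite dimension, $d_{BM}(E,F)=\inf\{\|T\|\cdot\|T^{-1}\| : T\colon E\to F\text{ an isomorphism}\}$. For $K\geq1$, a Banach space $X$ is $K$-asymptotically Hilbertian if for every $n\in\mathbb{N}$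 there is a finite-codimensional subspace $Y\subseteq X$ such that every $n$-dimensional vector subspace $E\subseteq Y$ satisfies $d_{BM}(E,\ell_2^n)\leq K$. It is $K^+$-asymptotically Hilbertian if it is $(K+\varepsilon)$-asymptotically Hilbertian for every $\varepsilon>0$. *)

(* Defs.v *)
From HB Require Import structures.
From mathcomp Require Import all_boot all_order all_algebra sesquilinear.
From mathcomp Require Import ring lra.
From mathcomp Require Import all_classical all_reals all_analysis.
From mathcomp Require Import complex.

Set Implicit Arguments.
Unset Strict Implicit.
Unset Printing Implicit Defensive.

Import Order.TTheory GRing.Theory Num.Theory.
Import numFieldNormedType.Exports.

Local Open Scope classical_set_scope.
Local Open Scope ring_scope.

Variant scalars := RealScalars | ComplexScalars.

Definition scalar_field (R : realType) (s : scalars) : numFieldType :=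
  match s with
  | RealScalars => (R : numFieldType)
  | ComplexScalars => (R[i] : numFieldType)
  end.

Section Scalar.
Variables (R : realType) (s : scalars).
Local Notation K := (scalar_field R s).

Definition of_real : R -> K :=
  match s return R -> scalar_field R s with
  | RealScalars => fun r => r
  | ComplexScalars => fun r => real_complex R r
  end.

Definition scalar_re : K -> R :=
  match s return scalar_field R s -> R with
  | RealScalars => fun z => z
  | ComplexScalars => fun z => complex.Re z
  end.

Definition scalar_conj : K -> K :=
  match s return scalar_field R s -> scalar_field R s with
  | RealScalars => fun z => z
  | ComplexScalars => fun z => conjc z
  end.

(* MathComp norms over [K] take values in [K]; this is the real number [`|z|]. *)
Definition modulus (z : K) : R := scalar_re `|z|.

Lemma of_real_modulus z : of_real (modulus z) = `|z|.
Proof.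
by rewrite /modulus /of_real /scalar_re; case: s z.
Qed.

Lemma of_realK r : scalar_re (of_real r) = r.
Proof. by rewrite /of_real /scalar_re; case: s. Qed.

Lemma of_realD r t : of_real (r + t) = of_real r + of_real t.
Proof. by rewrite /of_real; case: s => //=; rewrite rmorphD. Qed.

Lemma of_realM r t : of_real (r * t) = of_real r * of_real t.
Proof. by rewrite /of_real; case: s => //=; rewrite rmorphM. Qed.

Lemma of_real0 : of_real 0 = 0.
Proof. by rewrite /of_real; case: s. Qed.

Lemma of_real_le r t : (of_real r <= of_real t) = (r <= t).
Proof. by rewrite /of_real; case: s => //=; rewrite lecR. Qed.

Lemma modulus_ge0 z : 0 <= modulus z.
Proof. by rewrite -of_real_le of_real0 of_real_modulus. Qed.

Lemma modulus0 : modulus 0 = 0.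
Proof. by rewrite /modulus normr0 -of_real0 of_realK. Qed.

Lemma modulus_eq0 z : modulus z = 0 -> z = 0.
Proof. by move=> z0; apply/eqP; rewrite -normr_eq0 -of_real_modulus z0 of_real0. Qed.

Lemma modulusD z w : modulus (z + w) <= modulus z + modulus w.
Proof. by rewrite -of_real_le of_realD !of_real_modulus ler_normD. Qed.

Lemma modulusM z w : modulus (z * w) = modulus z * modulus w.
Proof.
by rewrite -[RHS]of_realK of_realM !of_real_modulus -normrM.
Qed.

End Scalar.

(* Only the values on [[0, +oo[] matter. *)
Record orlicz_function (R : realType) := OrliczFunction {
  orlicz_fun :> R -> R;
  orlicz_ge0 : forall t, 0 <= t -> 0 <= orlicz_fun t;
  orlicz_convex : @convex_function R R^o [set t : R | 0 <= t] orlicz_fun;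
  orlicz0 : orlicz_fun 0 = 0;
  orlicz_cvgy : orlicz_fun t @[t --> +oo] --> +oo
}.

Definition index_quotients (R : realType) (M : R -> R) (q : R) : set (\bar R) :=
  [set (M (lt.1 * lt.2) / (M lt.1 * lt.2 `^ q))%:E
  | lt in [set lt : R * R | 0 < lt.1 <= 1 /\ 0 < lt.2 <= 1]].

Definition alpha_index (R : realType) (M : R -> R) : \bar R :=
  ereal_sup [set q%:E | q in
    [set q : R | (ereal_sup (index_quotients M q) < +oo)%E]].

Definition beta_index (R : realType) (M : R -> R) : \bar R :=
  ereal_inf [set q%:E | q in
    [set q : R | (0 < ereal_inf (index_quotients M q))%E]].

Section Luxemburg.
Variables (R : realType) (s : scalars).
Local Notation K := (scalar_field R s).

Definition lux_admissible (M : R -> R) (x : nat -> K^o) (rho : R) : Prop :=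
  0 < rho /\ (\sum_(0 <= n <oo) (M (modulus (x n) / rho))%:E <= 1)%E.

(* [lux_norm M x = +oo] when no [rho] is admissible, i.e. when [x] is not in l_M. *)
Definition lux_norm (M : R -> R) (x : nat -> K^o) : \bar R :=
  ereal_inf [set rho%:E | rho in lux_admissible M x].

Variable M : orlicz_function R.
Implicit Types (x y : nat -> K^o) (r q : R).

Lemma orlicz_conv (p a b : R) : 0 <= p <= 1 -> 0 <= a -> 0 <= b ->
  M (p * a + (1 - p) * b) <= p * M a + (1 - p) * M b.
Proof.
move=> /andP[p0 p1] a0 b0.
have := @orlicz_convex _ M (Itv01 p0 p1) a b.
rewrite !inE /= => /(_ a0 b0).
by rewrite !convRE.
Qed.

Lemma orlicz_le (a b : R) : 0 <= a -> a <= b -> M a <= M b.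
Proof.
move=> a0 ab; have [b0|b0] := eqVneq b 0.
  by rewrite b0 in ab *; have /eqP -> : a == 0 by rewrite eq_le ab.
have bp : 0 < b by rewrite lt_neqAle eq_sym b0 (le_trans a0).
have p01 : 0 <= a / b <= 1.
  by rewrite divr_ge0 ?(ltW bp)//= ler_pdivrMr// mul1r.
have := orlicz_conv p01 (ltW bp) (lexx 0).
rewrite divfK// orlicz0 !mulr0 !addr0 => /le_trans; apply.
by rewrite ler_piMl ?orlicz_ge0 ?(ltW bp)//; case/andP: p01.
Qed.

Lemma lux_term_ge0 x r n : 0 < r -> (0 <= (M (modulus (x n) / r))%:E)%E.
Proof. by move=> r0; rewrite lee_fin orlicz_ge0// divr_ge0 ?modulus_ge0 ?ltW. Qed.

Lemma lux_admissible_le x r n : lux_admissible M x r -> M (modulus (x n) / r) <= 1.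
Proof.
move=> [r0 h]; rewrite -lee_fin; apply: le_trans h.
rewrite (nneseries_split 0 n.+1)//; last by move=> *; exact: lux_term_ge0.
rewrite add0n big_nat_recr//= -addeA; set y := (X in (_ <= _ + X)%E).
have hy : ((M (modulus (x n) / r))%:E <= y)%E.
  by apply: leeDl; apply: nneseries_ge0 => *; exact: lux_term_ge0.
apply: (le_trans hy); apply: leeDr.
by apply: sume_ge0 => *; exact: lux_term_ge0.
Qed.

Lemma lux_admissibleD x y r q : lux_admissible M x r -> lux_admissible M y q ->
  lux_admissible M (x + y) (r + q).
Proof.
move=> [r0 hx] [q0 hy]; split; first exact: addr_gt0.
have rq0 : 0 < r + q by exact: addr_gt0.
pose p := r / (r + q).
have p01 : 0 <= p <= 1.
  by rewrite /p divr_ge0 ?(ltW r0) ?(ltW rq0)//= ler_pdivrMr// mul1r lerDl ltW.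
have [p0 p1] := andP p01.
have h n : M (modulus ((x + y) n) / (r + q)) <=
    p * M (modulus (x n) / r) + (1 - p) * M (modulus (y n) / q).
  apply: le_trans (orlicz_conv p01 _ _); last 2 first.
  - by rewrite divr_ge0 ?modulus_ge0 ?ltW.
  - by rewrite divr_ge0 ?modulus_ge0 ?ltW.
  apply: orlicz_le; first by rewrite divr_ge0 ?modulus_ge0 ?ltW.
  have -> : p * (modulus (x n) / r) + (1 - p) * (modulus (y n) / q) =
      (modulus (x n) + modulus (y n)) / (r + q).
    by rewrite /p; field; rewrite !gt_eqF.
  by rewrite ler_pM2r ?invr_gt0// modulusD.
apply: (@le_trans _ _ (\sum_(0 <= n <oo)
   (p%:E * (M (modulus (x n) / r))%:E + (1 - p)%:E * (M (modulus (y n) / q))%:E))%E).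
  apply: lee_nneseries => [n _ _|n _]; first by apply: lux_term_ge0.
  by rewrite -!EFinM -EFinD lee_fin.
have p1' : 0 <= 1 - p by rewrite subr_ge0.
rewrite nneseriesD; last 2 first.
- by move=> *; rewrite mule_ge0 ?lux_term_ge0// lee_fin.
- by move=> *; rewrite mule_ge0 ?lux_term_ge0// lee_fin.
rewrite !nneseriesZl; try by move=> *; exact: lux_term_ge0.
have -> : 1%E = (p%:E * 1 + (1 - p)%:E * 1)%E :> \bar R.
  by rewrite !mule1 -EFinD addrC subrK.
by apply: leeD; apply: lee_pmul => //; rewrite ?lee_fin//;
  apply: nneseries_ge0 => *; exact: lux_term_ge0.
Qed.

Lemma lux_admissible0 r : 0 < r -> lux_admissible M 0 r.
Proof.
move=> r0; split => //; rewrite eseries0// => n _ _.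
by rewrite modulus0 mul0r orlicz0.
Qed.

Lemma lux_admissibleZ (a : K) x r : a != 0 -> lux_admissible M x r ->
  lux_admissible M (a *: x) (modulus a * r).
Proof.
move=> a0 [r0 hx].
have a_gt0 : 0 < modulus a.
  by rewrite lt_neqAle modulus_ge0 andbT eq_sym; apply: contra_neq a0 => /modulus_eq0.
split; first exact: mulr_gt0.
under eq_eseriesr => n _.
  rewrite [modulus _](_ : _ = modulus a * modulus (x n)) ?modulusM// -mulf_div.
  rewrite divff ?gt_eqF// mul1r; over.
by [].
Qed.

Lemma lux_norm_ge0 x : (0 <= lux_norm M x)%E.
Proof. by apply/ereal_infP => _ [r [r0 _] <-]; rewrite lee_fin ltW. Qed.

Lemma lux_norm_ltyP x :
  (lux_norm M x < +oo)%E <-> exists r, lux_admissible M x r.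
Proof.
split=> [|[r hr]]; last first.
  by apply: le_lt_trans (ltry r); apply: ereal_inf_lbound; exists r.
by move/ereal_inf_lt => [_ [r hr _] _]; exists r.
Qed.

Lemma lux_norm_le x r : lux_admissible M x r -> fine (lux_norm M x) <= r.
Proof.
move=> hr; rewrite -lee_fin fineK.
  by apply: ereal_inf_lbound; exists r.
by rewrite ge0_fin_numE ?lux_norm_ge0//; apply/lux_norm_ltyP; exists r.
Qed.

Lemma lux_norm_lt x (e : R) : (lux_norm M x < +oo)%E -> fine (lux_norm M x) < e ->
  exists2 r, lux_admissible M x r & r < e.
Proof.
move=> xoo; rewrite -lte_fin fineK ?ge0_fin_numE ?lux_norm_ge0//.
by move/ereal_inf_lt => [_ [r hr <-]]; rewrite lte_fin; exists r.
Qed.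

Lemma fine_lux_normD x y : (lux_norm M x < +oo)%E -> (lux_norm M y < +oo)%E ->
  fine (lux_norm M (x + y)) <= fine (lux_norm M x) + fine (lux_norm M y).
Proof.
move=> xoo yoo; apply/ler_addgt0Pr => e e0.
have e20 : 0 < e / 2 by rewrite divr_gt0.
have [||r hr re] := @lux_norm_lt x (fine (lux_norm M x) + e / 2) => //.
  by rewrite ltrDl.
have [||q hq qe] := @lux_norm_lt y (fine (lux_norm M y) + e / 2) => //.
  by rewrite ltrDl.
apply: le_trans (lux_norm_le (lux_admissibleD hr hq)) _; lra.
Qed.

Lemma lux_norm0 : lux_norm M (0 : nat -> K^o) = 0%E.
Proof.
apply/eqP; rewrite eq_le lux_norm_ge0 andbT; apply/lee_addgt0Pr => e e0.
by rewrite add0e; apply: ereal_inf_lbound; exists e => //; exact: lux_admissible0.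
Qed.

Lemma fine_lux_normZ_le (a : K) x : (lux_norm M x < +oo)%E ->
  fine (lux_norm M (a *: x)) <= modulus a * fine (lux_norm M x).
Proof.
move=> xoo; have [->|a0] := eqVneq a 0.
  by rewrite scale0r lux_norm0 modulus0 mul0r.
have a_gt0 : 0 < modulus a.
  by rewrite lt_neqAle modulus_ge0 andbT eq_sym; apply: contra_neq a0 => /modulus_eq0.
rewrite mulrC -ler_pdivrMr//; apply/ler_addgt0Pr => e e0.
have [|r hr re] := @lux_norm_lt x (fine (lux_norm M x) + e) xoo; first by rewrite ltrDl.
apply/ltW/le_lt_trans/re; rewrite ler_pdivrMr// mulrC.
by apply: lux_norm_le; exact: lux_admissibleZ.
Qed.

Lemma lux_norm_ltyD x y : (lux_norm M x < +oo)%E -> (lux_norm M y < +oo)%E ->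
  (lux_norm M (x + y)%R < +oo)%E.
Proof.
move=> /lux_norm_ltyP[r hr] /lux_norm_ltyP[q hq].
by apply/lux_norm_ltyP; exists (r + q); exact: lux_admissibleD.
Qed.

Lemma lux_norm_ltyZ (a : K) x : (lux_norm M x < +oo)%E ->
  (lux_norm M (a *: x)%R < +oo)%E.
Proof.
have [->|a0] := eqVneq a 0; first by rewrite scale0r lux_norm0 ltry.
move=> /lux_norm_ltyP[r hr].
by apply/lux_norm_ltyP; exists (modulus a * r); exact: lux_admissibleZ.
Qed.

Lemma fine_lux_normZ (a : K) x : (lux_norm M x < +oo)%E ->
  fine (lux_norm M (a *: x)) = modulus a * fine (lux_norm M x).
Proof.
move=> xoo; apply/eqP; rewrite eq_le fine_lux_normZ_le//=.
have [->|a0] := eqVneq a 0; first by rewrite scale0r lux_norm0 modulus0 mul0r.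
have := fine_lux_normZ_le a^-1 (lux_norm_ltyZ a xoo).
rewrite scalerA mulVf// scale1r => h.
apply: le_trans (ler_wpM2l (modulus_ge0 a) h) _.
rewrite mulrA -modulusM divff//.
have -> : modulus (1 : K) = 1.
  by rewrite /modulus normr1 /scalar_re; case: (s).
by rewrite mul1r.
Qed.

Lemma lux_norm_eq0 x : (lux_norm M x < +oo)%E -> fine (lux_norm M x) = 0 -> x = 0.
Proof.
move=> xoo x0; apply/funext => n; apply: modulus_eq0.
have [A [_ MA]] : \forall t \near +oo, 1 < M t.
  by move/cvgryPgt: (orlicz_cvgy M); apply.
pose B := `|A| + 1.
have B0 : 0 < B by rewrite ltr_wpDl.
apply/eqP; rewrite eq_le modulus_ge0 andbT; apply/ler_addgt0Pr => e e0.
rewrite add0r.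
have [|r hr re] := @lux_norm_lt x (e / B) xoo; first by rewrite x0 divr_gt0.
have := lux_admissible_le n hr; apply: contraTle => xe; rewrite -ltNge.
apply: MA; case: hr => r0 _.
rewrite ltr_pdivlMr//.
rewrite ltr_pdivlMr// in re.
apply: le_lt_trans xe; apply: le_trans (ltW re); rewrite mulrC ler_pM2l//.
by rewrite (le_trans (ler_norm _))// lerDl.
Qed.

Definition unit_seq (n : nat) : nat -> K^o := fun k => (k == n)%:R.

Lemma lux_norm_unit_seq n : (lux_norm M (unit_seq n) < +oo)%E.
Proof.
apply/lux_norm_ltyP; pose r := M 1 + 1; exists r.
have M1 : 0 <= M 1 by rewrite orlicz_ge0.
have r0 : 0 < r by rewrite ltr_wpDl.
split => //.
rewrite (nneseries_split 0 n.+1)//; last by move=> *; exact: lux_term_ge0.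
rewrite add0n big_nat_recr//= big_nat big1; last first.
  by move=> i /andP[_ ilt]; rewrite /unit_seq ltn_eqF// modulus0 mul0r orlicz0.
rewrite eseries0; last first.
  by move=> i ilt _; rewrite /unit_seq gtn_eqF// modulus0 mul0r orlicz0.
rewrite add0e adde0 /unit_seq eqxx /= lee_fin.
have -> : modulus (1 : K) = 1 by rewrite /modulus normr1 /scalar_re; case: (s).
have r1 : 1 <= r by rewrite lerDr.
have p01 : 0 <= r^-1 <= 1 by rewrite invr_ge0 (ltW r0)/= invf_le1.
have := orlicz_conv p01 ler01 (lexx 0).
rewrite orlicz0 !mulr0 !addr0 mulr1 mul1r => /le_trans; apply.
by rewrite mulrC ler_pdivrMr// mul1r lerDl.
Qed.

End Luxemburg.

Section LOrlicz.
Variables (R : realType) (s : scalars) (M : orlicz_function R).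
Local Notation K := (scalar_field R s).

Definition lorlicz_pred : {pred (nat -> K^o)} :=
  [pred x | `[< (lux_norm M x < +oo)%E >]].

Lemma lorlicz_submod_closed : submod_closed lorlicz_pred.
Proof.
split; first by rewrite inE lux_norm0 ltry.
move=> a x y /[!inE] xoo yoo.
by apply: lux_norm_ltyD => //; exact: lux_norm_ltyZ.
Qed.

HB.instance Definition _ := GRing.isSubmodClosed.Build K (nat -> K^o)
  lorlicz_pred lorlicz_submod_closed.

Record lorlicz := LOrlicz {
  lorlicz_val :> nat -> K^o;
  lorlicz_valP : lorlicz_val \in lorlicz_pred
}.

HB.instance Definition _ := [isSub for lorlicz_val].
HB.instance Definition _ := [Choice of lorlicz by <:].
HB.instance Definition _ := [SubChoice_isSubLmodule of lorlicz by <:].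

Lemma lorlicz_lty (x : lorlicz) : (lux_norm M x < +oo)%E.
Proof. by have := lorlicz_valP x; rewrite inE. Qed.

Definition lorlicz_norm (x : lorlicz) : K := of_real s (fine (lux_norm M x)).

Lemma ler_lorlicz_normD (x y : lorlicz) :
  lorlicz_norm (x + y) <= lorlicz_norm x + lorlicz_norm y.
Proof.
rewrite -of_realD of_real_le.
exact: (@fine_lux_normD R s M (val x) (val y) (lorlicz_lty x) (lorlicz_lty y)).
Qed.

Lemma lorlicz_normZ (a : K) (x : lorlicz) :
  lorlicz_norm (a *: x) = `|a| * lorlicz_norm x.
Proof.
rewrite -of_real_modulus -of_realM; congr (of_real _ _).
exact: (@fine_lux_normZ R s M a (val x) (lorlicz_lty x)).
Qed.

Lemma lorlicz_norm0_eq0 (x : lorlicz) : lorlicz_norm x = 0 -> x = 0.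
Proof.
rewrite /lorlicz_norm -(of_real0 R s) => /(congr1 (@scalar_re R s)).
rewrite !of_realK => x0; apply: val_inj => /=.
by apply: lux_norm_eq0 x0; exact: lorlicz_lty.
Qed.

HB.instance Definition _ := Lmodule_isNormed.Build K lorlicz
  ler_lorlicz_normD lorlicz_normZ lorlicz_norm0_eq0.

Definition unit_vector (n : nat) : lorlicz :=
  @LOrlicz (unit_seq R s n) (asboolT (lux_norm_unit_seq s M n)).

End LOrlicz.

Section Euclid.
Variables (R : realType) (s : scalars) (n : nat).
Local Notation K := (scalar_field R s).

Definition euclid : Type := 'rV[K]_n.
HB.instance Definition _ := GRing.Lmodule.on euclid.

Definition euclid_norm (x : euclid) : K :=
  of_real s (Num.sqrt (\sum_i modulus ((x : 'rV[K]_n) 0 i) ^+ 2)).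

Lemma sqrt_sum_sqrD (a b : 'I_n -> R) :
  (forall i, 0 <= a i) -> (forall i, 0 <= b i) ->
  Num.sqrt (\sum_i (a i + b i) ^+ 2) <=
  Num.sqrt (\sum_i a i ^+ 2) + Num.sqrt (\sum_i b i ^+ 2).
Proof.
move=> a0 b0; set A := \sum_i a i ^+ 2; set B := \sum_i b i ^+ 2.
have A0 : 0 <= A by apply: sumr_ge0 => i _; exact: sqr_ge0.
have B0 : 0 <= B by apply: sumr_ge0 => i _; exact: sqr_ge0.
pose C := \sum_i a i * b i.
have C0 : 0 <= C by apply: sumr_ge0 => i _; exact: mulr_ge0.
have CS : C ^+ 2 <= A * B.
  have : 0 <= \sum_i (B * a i - C * b i) ^+ 2.
    by apply: sumr_ge0 => i _; exact: sqr_ge0.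
  rewrite (eq_bigr (fun i => B ^+ 2 * a i ^+ 2 +
      (C ^+ 2 * b i ^+ 2 - (2 * B * C) * (a i * b i)))); last first.
    by move=> i _; ring.
  rewrite big_split/= sumrB -!mulr_sumr -/A -/B -/C => h.
  have [Bz|Bn0] := eqVneq B 0.
    have bz i : b i = 0.
      have : b i ^+ 2 <= B.
        by rewrite /B (bigD1 i)//= lerDl sumr_ge0// => *; exact: sqr_ge0.
      rewrite Bz => bi; apply/eqP; rewrite -sqrf_eq0 eq_le bi/=.
      exact: sqr_ge0.
    by rewrite Bz mulr0 /C big1 ?expr0n// => i _; rewrite bz mulr0.
  have Bp : 0 < B by rewrite lt_neqAle eq_sym Bn0.
  rewrite -subr_ge0 -(pmulr_rge0 _ Bp).
  by apply: le_trans h _; rewrite le_eqVlt; apply/orP; left; apply/eqP; ring.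
rewrite -ler_sqr ?nnegrE ?addr_ge0 ?sqrtr_ge0//.
rewrite sqr_sqrtr; last by apply: sumr_ge0 => i _; exact: sqr_ge0.
rewrite sqrrD !sqr_sqrtr//.
under eq_bigr => i _ do rewrite sqrrD.
rewrite !big_split/= -/A -/B lerD2r lerD2l -mulr2n lerMn2r/=.
rewrite -sqrtrM// -/C -[C]ger0_norm// -sqrtr_sqr.
by rewrite ler_sqrt// (le_trans _ CS)// sqr_ge0.
Qed.

Lemma ler_euclid_normD (x y : euclid) :
  euclid_norm (x + y) <= euclid_norm x + euclid_norm y.
Proof.
rewrite -of_realD of_real_le; apply: (le_trans _ (sqrt_sum_sqrD _ _)).
- rewrite ler_sqrt; last by apply: sumr_ge0 => i _; exact: sqr_ge0.
  apply: ler_sum => i _; rewrite ler_sqr ?nnegrE ?addr_ge0 ?modulus_ge0//.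
  by rewrite mxE modulusD.
- by move=> i; exact: modulus_ge0.
- by move=> i; exact: modulus_ge0.
Qed.

Lemma euclid_normZ (a : K) (x : euclid) :
  euclid_norm (a *: x) = `|a| * euclid_norm x.
Proof.
rewrite -of_real_modulus -of_realM; congr (of_real _ _).
under eq_bigr => i _ do rewrite mxE modulusM exprMn.
rewrite -mulr_sumr sqrtrM ?sqr_ge0// sqrtr_sqr ger0_norm//.
exact: modulus_ge0.
Qed.

Lemma euclid_norm0_eq0 (x : euclid) : euclid_norm x = 0 -> x = 0.
Proof.
rewrite /euclid_norm -(of_real0 R s) => /(congr1 (@scalar_re R s)).
rewrite !of_realK => /eqP; rewrite sqrtr_eq0 => x0.
apply/rowP => i; rewrite [RHS]mxE; apply: modulus_eq0; apply/eqP.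
rewrite -sqrf_eq0 eq_le sqr_ge0 andbT (le_trans _ x0)//.
by rewrite (bigD1 i)//= lerDl sumr_ge0// => *; exact: sqr_ge0.
Qed.

HB.instance Definition _ := Lmodule_isNormed.Build K euclid
  ler_euclid_normD euclid_normZ euclid_norm0_eq0.

End Euclid.

Section Spaces.
Variables (R : realType) (s : scalars).
Local Notation K := (scalar_field R s).

Definition rnorm (V : normedModType K) (x : V) : R := scalar_re `|x|.

Lemma rnorm_lorlicz (M : orlicz_function R) (x : lorlicz s M) :
  rnorm x = fine (lux_norm M x).
Proof. exact: of_realK. Qed.

Lemma rnorm_euclid (n : nat) (x : euclid R s n) :
  rnorm x = Num.sqrt (\sum_i modulus ((x : 'rV[K]_n) 0 i) ^+ 2).
Proof. exact: of_realK. Qed.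

Definition linear_span (V : lmodType K) (A : set V) : set V :=
  [set v | exists (n : nat) (c : 'I_n -> K) (a : 'I_n -> V),
    (forall i, A (a i)) /\ v = \sum_i c i *: a i].

Definition linear_subspace (V : lmodType K) (X : set V) : Prop :=
  X 0 /\ forall (a : K) (x y : V), X x -> X y -> X (a *: x + y).

Definition closed_subspace (V : normedModType K) (X : set V) : Prop :=
  linear_subspace X /\ closed X.

Definition has_dim (V : lmodType K) (E : set V) (n : nat) : Prop :=
  exists b : 'I_n -> V, E = linear_span (range b) /\
    forall c : 'I_n -> K, \sum_i c i *: b i = 0 -> forall i, c i = 0.

(* [Y] has finite codimension in [X]: finitely many vectors of [X] span the
   quotient [X / Y]. *)
Definition finite_codim (V : lmodType K) (Y X : set V) : Prop :=
  exists (m : nat) (v : 'I_m -> V), (forall i, X (v i)) /\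
    forall x, X x -> exists c : 'I_m -> K, Y (x - \sum_i c i *: v i).

Definition linear_on (V W : lmodType K) (E : set V) (T : V -> W) : Prop :=
  forall (a : K) (x y : V), E x -> E y -> T (a *: x + y) = a *: T x + T y.

(* [T] and [S] represent mutually inverse linear homeomorphisms between the
   subspaces [E] and [F]; their values outside [E] and [F] are irrelevant. *)
Record isomorphism (V W : normedModType K) (E : set V) (F : set W)
    (T : V -> W) (S : W -> V) : Prop := Isomorphism {
  iso_lin : linear_on E T;
  iso_fun : set_fun E F T;
  iso_inv_fun : set_fun F E S;
  iso_cancel : {in E, cancel T S};
  iso_inv_cancel : {in F, cancel S T};
  iso_continuous : {within E, continuous T};
  iso_inv_continuous : {within F, continuous S}
}.

Definition opnorm (V W : normedModType K) (E : set V) (T : V -> W) : \bar R :=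
  ereal_sup [set (rnorm (T x))%:E | x in [set x | E x /\ rnorm x <= 1]].

Definition bm_distance (V W : normedModType K) (E : set V) (F : set W) : \bar R :=
  ereal_inf [set (opnorm E TS.1 * opnorm F TS.2)%E
            | TS in [set TS | isomorphism E F TS.1 TS.2]].

Definition is_hilbert (H : completeNormedModType K) : Prop :=
  exists dot : {dot H for @scalar_conj R s}, forall x : H, `|x| ^+ 2 = dot x x.

Definition hilbertian (V : normedModType K) (X : set V) : Prop :=
  exists H : completeNormedModType K, is_hilbert H /\
    exists (T : V -> H) (S : H -> V), isomorphism X [set: H] T S.

Definition asymptotically_hilbertian (C : R) (V : normedModType K) (X : set V) : Prop :=
  forall n : nat, exists Y : set V,
    [/\ closed_subspace Y, Y `<=` X, finite_codim Y X &
      forall E : set V, linear_subspace E -> E `<=` Y -> has_dim E n ->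
        (bm_distance E [set: euclid R s n] <= C%:E)%E].

(* [C^+]-asymptotically Hilbertian *)
Definition asymptotically_hilbertian_plus (C : R) (V : normedModType K) (X : set V) : Prop :=
  forall e : R, 0 < e -> asymptotically_hilbertian (C + e) X.

Definition horlicz (M : orlicz_function R) : set (lorlicz s M) :=
  closure (linear_span (range (@unit_vector R s M))).

End Spaces.

Arguments horlicz {R} s M.

(* Main.v *)
(* Let N_L(t) = sum_{c in L} M(c t) be the modular of a block of unit vectors with
   coefficients in the finite list L.  Taking for L the powers r^-k, k <= 2a, with
   multiplicities about r^(2k) q^-|k-a|, the indices alpha = beta = 2 make the two ends
   of the sum negligible against its middle, so N_L(l t) = l^2 N_L(t) up to e N_L(t) for
   all l, t in [0,1], for any prescribed e, although N_L is still equivalent to M.  Since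
   h_M is not Hilbertian, M is not equivalent to t^2, so for each such L some number of
   disjoint copies of the block is far from a Hilbert space (sums with signs and the
   parallelogram identity).  X is spanned by these groups of copies, with e tending to 0
   along the groups.
   For an n-dimensional E in a tail of X, a basis of nearly maximal determinant gives a
   majorant S of the coordinates on the ball of E whose modular is bounded in terms of n;
   on this ball the modular of x is within O(e) of sum_i N_i(S_i) / S_i^2 |x_i|^2, so the
   norm of E is nearly Euclidean. *)
Require Import Defs.
From HB Require Import structures.
From mathcomp Require Import all_boot all_order all_algebra sesquilinear.
From mathcomp Require Import zify ring lra.
From mathcomp Require Import all_classical all_reals all_analysis.
From mathcomp Require Import complex perm.

Set Implicit Arguments.
Unset Strict Implicit.
Unset Printing Implicit Defensive.

Import Order.TTheory GRing.Theory Num.Theory.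
Import numFieldNormedType.Exports.
Local Open Scope classical_set_scope.
Local Open Scope ring_scope.

(** * Index bounds and nearly quadratic blocks *)

Section Growth.
Variable R : realType.
Implicit Types (M : orlicz_function R) (r p q t x y l c C Q A : R) (L : seq R).

(** The index hypotheses only say that r^(2k) M(l / r^k) equals M(l) up to a factor C p^k. Here p
    may be taken as close to 1 as desired, but C depends on p and cannot be brought near 1.
    Averaging over scales removes C: with q = p^2 the weights decay faster than the terms can grow,
    so C survives only in the boundary terms, divided by p^a, and a is chosen after C. This controls
    finitely many scales. For smaller l convexity makes both N(l t) and l^2 N(t) small against N(t),
    which is why the error is measured by N(t). Such errors are harmless: they add up to e times the
    sum of the N_i(S_i). Large multiplicities have a further purpose: N_L(e) >= 1 keeps the
    coordinates of the unit ball below e, so the majorants built from n of them stay in [0,1], where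
    N_L is nearly quadratic. The constants comparing N_L with M depend on L, so the number of copies
    is chosen after the block. *)

Lemma expr_unbounded r (B : R) : 1 < r -> exists n, B <= r ^+ n.
Proof.
move=> r1; have r0 : 0 < r by rewrite (lt_trans ltr01).
have bern n : 1 + n%:R * (r - 1) <= r ^+ n.
  elim: n => [|n IHn]; first by rewrite mul0r addr0 expr0.
  rewrite exprSr; apply: le_trans (ler_wpM2r (ltW r0) IHn).
  have : 0 <= n%:R * (r - 1) ^+ 2 by rewrite mulr_ge0 ?ler0n ?sqr_ge0.
  rewrite -natr1; lra.
exists (Num.truncn (B / (r - 1))).+1; apply: le_trans (bern _).
have : B / (r - 1) < (Num.truncn (B / (r - 1))).+1%:R by rewrite truncnS_gt.
by rewrite ltr_pdivrMr ?subr_gt0// => /ltW /le_trans; apply; rewrite lerDr.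
Qed.

Lemma expr_near1 (n : nat) (e : R) : 0 < e ->
  exists2 x : R, 0 < x <= 1 & (1 + x) ^+ n <= 1 + e.
Proof.
move=> e0; have up x : 0 <= x <= 1 -> (1 + x) ^+ n <= 1 + 4 ^+ n * x.
  move=> /andP[x0 x1]; elim: n => [|n IHn]; first by rewrite !expr0 mul1r lerDl.
  rewrite exprSr; apply: le_trans (ler_wpM2r _ IHn) _; first by rewrite addr_ge0.
  have p1 : 1 <= (4 : R) ^+ n by apply: exprn_ege1; lra.
  have a : 4 ^+ n * x * x <= 4 ^+ n * x by rewrite ler_piMr// mulr_ge0// (le_trans ler01).
  have b : x <= 4 ^+ n * x by rewrite ler_peMl.
  rewrite exprS; nra.
have p0 : 0 < (4 : R) ^+ n by rewrite exprn_gt0.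
have p1 : 1 <= (4 : R) ^+ n by apply: exprn_ege1; lra.
have d0 : 0 < 4 ^+ n * (1 + e) by rewrite mulr_gt0 ?addr_gt0.
have x1 : e / (4 ^+ n * (1 + e)) <= 1.
  by rewrite ler_pdivrMr// mul1r; nra.
(* By [up] any x <= 1 with 4^n x <= e works; the factor 1 + e in the denominator keeps x at most
   1. *)
exists (e / (4 ^+ n * (1 + e))); first by rewrite divr_gt0.
apply: (le_trans (up _ _)); first by rewrite x1 divr_ge0 ?ltW.
rewrite lerD2l mulrA ler_pdivrMr//.
by rewrite [leRHS]mulrCA ler_pM2l// ler_peMr ?lerDl ?ltW.
Qed.

(** Some admissible exponent [q'] exceeds [q], and t^q' <= t^q on (0,1]. The maximum with 1 makes
    the constant positive. *)
Lemma alpha_index_upper M q : alpha_index M = 2%:E ->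
  (forall t, 0 < t -> 0 < M t) -> q < 2 ->
  exists2 C : R, 0 < C & forall l t, 0 < l <= 1 -> 0 < t <= 1 ->
    M (l * t) <= C * M l * t `^ q.
Proof.
move=> aM M0 q2; have : (q%:E < alpha_index M)%E by rewrite aM lte_fin.
move=> /ereal_sup_gt[_ [q' /= q'oo <-]]; rewrite lte_fin => qq'.
set S := ereal_sup _ in q'oo.
exists (Num.max 1 (fine S)); first by rewrite lt_max ltr01.
move=> l t l01 t01; have [l0 l1] := andP l01; have [t0 t1] := andP t01.
have h : ((M (l * t) / (M l * t `^ q'))%:E <= S)%E.
  by apply: ereal_sup_ubound; exists (l, t).
have d0 : 0 < M l * t `^ q' by rewrite mulr_gt0 ?M0 ?powR_gt0.
have Sfin : S \is a fin_num.
  rewrite fin_numE (lt_eqF q'oo) andbT gt_eqF//.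
  by apply: lt_le_trans h; rewrite ltNyr.
rewrite -(fineK Sfin) lee_fin ler_pdivrMr// in h.
apply: (le_trans h).
apply: (@le_trans _ _ (Num.max 1 (fine S) * (M l * t `^ q'))).
  by rewrite ler_pM2r// le_max lexx orbT.
rewrite -mulrA ler_wpM2l ?le_max ?ler01//.
by rewrite ler_pM2l ?M0// ger_powR ?t01// ltW.
Qed.

Lemma beta_index_lower M q : beta_index M = 2%:E ->
  (forall t, 0 < t -> 0 < M t) -> 2 < q ->
  exists2 c : R, 0 < c & forall l t, 0 < l <= 1 -> 0 < t <= 1 ->
    c * M l * t `^ q <= M (l * t).
Proof.
move=> bM M0 q2; have : (beta_index M < q%:E)%E by rewrite bM lte_fin.
move=> /ereal_inf_lt[_ [q' /= q'0 <-]]; rewrite lte_fin => qq'.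
set S := ereal_inf _ in q'0.
have hS l t : 0 < l <= 1 -> 0 < t <= 1 -> (S <= (M (l * t) / (M l * t `^ q'))%:E)%E.
  by move=> l01 t01; apply: ereal_inf_lbound; exists (l, t).
have Sfin : S \is a fin_num.
  rewrite fin_numE gt_eqF/= ?(lt_trans _ q'0)// lt_eqF//.
  by apply: le_lt_trans (ltry _); apply: (hS 1 1); rewrite ltr01 lexx.
exists (fine S); first by rewrite -lte_fin fineK.
move=> l t l01 t01; have [l0 l1] := andP l01; have [t0 t1] := andP t01.
have := hS l t l01 t01; rewrite -{1}(fineK Sfin) lee_fin.
rewrite ler_pdivlMr ?mulr_gt0 ?M0 ?powR_gt0//; apply: le_trans.
have S0 : 0 < fine S by rewrite -lte_fin fineK.
by rewrite -mulrA ler_pM2l// ler_pM2l ?M0// ger_powR ?t01// ltW.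
Qed.

(** At t = r^-k the exponents 2 - e and 2 + e turn the deviation from the square into the factors
    p^k and p^-k, where e is chosen with r^e = p. *)
Lemma geometric_index_bound M r p : alpha_index M = 2%:E -> beta_index M = 2%:E ->
  (forall t, 0 < t -> 0 < M t) -> 1 < r -> 1 < p ->
  exists2 C : R, 1 <= C & forall l k, 0 < l <= 1 ->
    r ^+ (2 * k) * M (l / r ^+ k) <= C * p ^+ k * M l /\
    M l <= C * p ^+ k * (r ^+ (2 * k) * M (l / r ^+ k)).
Proof.
move=> aM bM M0 r1 p1.
have r0 : 0 < r by exact: lt_trans r1.
have p0 : 0 < p by exact: lt_trans p1.
pose e := ln p / ln r.
have e0 : 0 < e by rewrite divr_gt0// ln_gt0.
have re : r `^ e = p.
  rewrite /powR gt_eqF// /e divfK; first by rewrite lnK ?posrE.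
  by rewrite gt_eqF// ln_gt0.
have invr_powR x y : 0 < x -> (x^-1) `^ y = (x `^ y)^-1.
  by move=> x0; rewrite -powR_inv1 ?(ltW x0)// -powRrM mulN1r powRN.
have exprn_powR x k y : 0 <= x -> (x ^+ k) `^ y = (x `^ y) ^+ k.
  by move=> x0; rewrite -powR_mulrn// -powRrM mulrC powRrM powR_mulrn ?powR_ge0.
have r2 : r `^ 2 = r ^+ 2 by rewrite powR_mulrn// ltW.
have rD x y : r `^ (x + y) = r `^ x * r `^ y.
  by apply: powRD; rewrite (gt_eqF r0) implybT.
have up k : ((r ^+ k)^-1) `^ (2 - e) = p ^+ k / r ^+ (2 * k).
  rewrite invr_powR ?exprn_gt0// exprn_powR ?(ltW r0)//.
  by rewrite rD powRN re r2 exprMn exprVn invfM invrK mulrC -exprM.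
have lo k : ((r ^+ k)^-1) `^ (2 + e) = (p ^+ k)^-1 / r ^+ (2 * k).
  rewrite invr_powR ?exprn_gt0// exprn_powR ?(ltW r0)//.
  by rewrite rD re r2 exprMn invfM mulrC -exprM.
have [|C C0 hC] := @alpha_index_upper M (2 - e) aM M0; first lra.
have [|c c0 hc] := @beta_index_lower M (2 + e) bM M0; first lra.
exists (Num.max 1 (Num.max C c^-1)); first by rewrite le_max lexx.
set D := Num.max _ _.
have D0 : 0 < D by rewrite lt_max ltr01.
have CD : C <= D by rewrite !le_max lexx orbT.
have cD : c^-1 <= D by rewrite !le_max lexx !orbT.
move=> l k l01; have [l0 l1] := andP l01.
have rk : 0 < r ^+ (2 * k) by rewrite exprn_gt0.
have pk : 0 < p ^+ k by rewrite exprn_gt0.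
have t01 : 0 < (r ^+ k)^-1 <= 1.
  by rewrite invr_gt0 exprn_gt0// invf_le1 ?exprn_gt0// exprn_ege1// ltW.
have Ml := M0 l l0.
split.
  rewrite mulrC -ler_pdivlMr//; apply: (le_trans (hC _ _ l01 t01)).
  rewrite up (_ : C * M l * _ = C * (p ^+ k * M l / r ^+ (2 * k))); last by ring.
  rewrite [leRHS](_ : _ = D * (p ^+ k * M l / r ^+ (2 * k))); last by ring.
  by rewrite ler_wpM2r// !mulr_ge0 ?invr_ge0 ?(ltW pk) ?(ltW rk) ?(ltW Ml).
have := hc _ _ l01 t01; rewrite lo => h.
have {}h : M l <= c^-1 * p ^+ k * (r ^+ (2 * k) * M (l / r ^+ k)).
  rewrite [leRHS](_ : _ = M (l / r ^+ k) / (c * (p ^+ k)^-1 * (r ^+ (2 * k))^-1)).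
    by rewrite ler_pdivlMr ?mulr_gt0 ?invr_gt0//; apply: le_trans h; rewrite le_eqVlt; apply/orP; left; apply/eqP; ring.
  by field; rewrite !gt_eqF.
apply: (le_trans h); rewrite ler_wpM2r ?ler_wpM2r//; last exact: ltW.
by rewrite mulr_ge0 ?(ltW rk)// orlicz_ge0// divr_ge0 ?exprn_ge0 ?ltW.
Qed.


Definition block_fun (M : R -> R) (L : seq R) t := \sum_(c <- L) M (c * t).

Lemma block_fun_ge0 M L t : (forall c, c \in L -> 0 <= c) -> 0 <= t ->
  0 <= block_fun M L t.
Proof.
move=> L0 t0; rewrite /block_fun big_seq sumr_ge0// => c cL.
by rewrite orlicz_ge0// mulr_ge0// L0.
Qed.

Lemma block_fun0 M L : block_fun M L 0 = 0.
Proof. by rewrite /block_fun big1// => c _; rewrite mulr0 orlicz0. Qed.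

Lemma block_fun_le M L x y : (forall c, c \in L -> 0 <= c) -> 0 <= x -> x <= y ->
  block_fun M L x <= block_fun M L y.
Proof.
move=> L0 x0 xy; rewrite /block_fun !big_seq ler_sum// => c cL.
by apply: orlicz_le; rewrite ?mulr_ge0 ?ler_wpM2l ?(L0 _ cL).
Qed.

Lemma orlicz_scale M p t : 0 <= p <= 1 -> 0 <= t -> M (p * t) <= p * M t.
Proof.
move=> p01 t0; have := orlicz_conv M p01 t0 (lexx 0).
by rewrite orlicz0 !mulr0 !addr0.
Qed.

Lemma block_fun_scale M L p t : (forall c, c \in L -> 0 <= c) ->
  0 <= p <= 1 -> 0 <= t -> block_fun M L (p * t) <= p * block_fun M L t.
Proof.
move=> L0 p01 t0; rewrite /block_fun mulr_sumr !big_seq ler_sum// => c cL.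
by rewrite mulrCA; apply: orlicz_scale; rewrite // mulr_ge0 ?(L0 _ cL).
Qed.

(** Subtraction of natural numbers is truncated, so the exponent is |k - a|. *)
Definition tent q (a k : nat) : R := q ^- ((k - a) + (a - k)).

Lemma tent_step q a k : 1 <= q ->
  tent q a k <= q * tent q a k.+1 /\ tent q a k.+1 <= q * tent q a k.
Proof.
move=> q1; have q0 : 0 < q by exact: lt_le_trans q1.
have le_inv m n : (n <= m.+1)%N -> q ^- m <= q * q ^- n :> R.
  move=> nm; rewrite -lef_pV2 ?posrE ?mulr_gt0 ?invr_gt0 ?exprn_gt0//.
  rewrite invfM !invrK mulrC ler_pdivrMr// -exprSr.
  exact: ler_weXn2l.
by split; apply: le_inv; lia.
Qed.

(* The tent-weighted sum changes by a factor close to 1 under a shift, because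
   the two boundary terms are negligible against the middle one. *)
Lemma tent_sum_shift (f : nat -> R) C p q (a : nat) : (forall k, 0 <= f k) -> 1 < p ->
  q = p ^+ 2 -> 0 <= C ->
  (forall k, f k <= C * p ^+ ((k - a) + (a - k)) * f a) ->
  let S0 := \sum_(k < (2 * a).+1) tent q a k * f k in
  let S1 := \sum_(k < (2 * a).+1) tent q a k * f k.+1 in
  S1 <= (q + C * p / p ^+ a) * S0 /\ S0 <= q * S1 + C * p / p ^+ a * S0.
Proof.
move=> f0 p1 qE C0 fa S0 S1.
have p0 : 0 < p by exact: lt_trans p1.
have q1 : 1 <= q by rewrite qE exprn_ege1// ltW.
have q0 : 0 < q by exact: lt_le_trans q1.
have t0 k : 0 < tent q a k by rewrite invr_gt0 exprn_gt0.
have faS : f a <= S0.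
  have a2 : (a < (2 * a).+1)%N by lia.
  rewrite /S0 (bigD1 (Ordinal a2))//= {1}/tent subnn expr0 invr1 mul1r lerDl.
  by rewrite sumr_ge0// => i _; rewrite mulr_ge0 ?(ltW (t0 _)).
have pa0 : 0 < p ^+ a by rewrite exprn_gt0.
have qa : q ^+ a = p ^+ a * p ^+ a by rewrite qE -exprM mulnC exprM expr2.
(* At both ends the weight is q^-a = p^(-2a), while the values there are at most C p^a and C p^(a+1)
   times f(a), which enters [S0] with weight 1. A factor p^a is gained. *)
have end0 : tent q a 0 * f 0 <= C * p / p ^+ a * S0.
  apply: (@le_trans _ _ (C * p / p ^+ a * f a)); last first.
    by rewrite ler_wpM2l// !mulr_ge0 ?invr_ge0 ?(ltW p0) ?(ltW pa0).
  rewrite /tent sub0n add0n subn0 qa.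
  have := fa 0; rewrite sub0n subn0 add0n => h.
  apply: (le_trans (ler_wpM2l _ h)); first by rewrite invr_ge0 mulr_ge0 ?ltW.
  rewrite [leLHS](_ : _ = C * f a / p ^+ a); last by field; rewrite gt_eqF.
  rewrite [leRHS](_ : _ = C * f a / p ^+ a * p); last by ring.
  by rewrite ler_peMr ?(ltW p1)// !mulr_ge0 ?invr_ge0// ltW.
have endN : tent q a (2 * a) * f (2 * a).+1 <= C * p / p ^+ a * S0.
  apply: (@le_trans _ _ (C * p / p ^+ a * f a)); last first.
    by rewrite ler_wpM2l// !mulr_ge0 ?invr_ge0 ?(ltW p0) ?(ltW pa0).
  rewrite /tent (_ : 2 * a - a + (a - 2 * a) = a)%N ?qa; last lia.
  have := fa (2 * a).+1; rewrite (_ : _ + _ = a.+1)%N; last lia.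
  move=> h; apply: (le_trans (ler_wpM2l _ h)).
    by rewrite invr_ge0 mulr_ge0 ?ltW.
  by rewrite exprS le_eqVlt; apply/orP; left; apply/eqP; field; rewrite gt_eqF.
have S0E : S0 = tent q a 0 * f 0 + \sum_(k < 2 * a) tent q a k.+1 * f k.+1.
  by rewrite /S0 big_ord_recl.
have S1E : S1 = \sum_(k < 2 * a) tent q a k * f k.+1 + tent q a (2 * a) * f (2 * a).+1.
  by rewrite /S1 big_ord_recr.
split.
  rewrite S1E mulrDl lerD//.
  apply: (@le_trans _ _ (q * \sum_(k < 2 * a) tent q a k.+1 * f k.+1)).
    rewrite mulr_sumr ler_sum// => k _; rewrite mulrA ler_wpM2r//.
    by have [] := tent_step a k q1.
  by rewrite ler_pM2l// S0E lerDr mulr_ge0 ?(ltW (t0 _)).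
rewrite {1}S0E addrC lerD//.
apply: (@le_trans _ _ (q * \sum_(k < 2 * a) tent q a k * f k.+1)).
  rewrite mulr_sumr ler_sum// => k _; rewrite mulrA ler_wpM2r//.
  by have [] := tent_step a k q1.
by rewrite ler_pM2l// S1E lerDl mulr_ge0 ?(ltW (t0 _)).
Qed.

(** Replacing t by t / r and multiplying by r^2 shifts the index of f k = r^(2k) M(t / r^k) by one.
    A single shift costs a factor [Q] in either direction, and i shifts cost Q^i. *)
Lemma tent_average M r p C Q (a : nat) : (forall t, 0 < t -> 0 < M t) ->
  1 < r -> 1 < p -> 0 <= C ->
  (forall l k, 0 < l <= 1 ->
    r ^+ (2 * k) * M (l / r ^+ k) <= C * p ^+ k * M l /\
    M l <= C * p ^+ k * (r ^+ (2 * k) * M (l / r ^+ k))) ->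
  p ^+ 2 + C * p / p ^+ a <= Q -> p ^+ 2 <= Q * (1 - C * p / p ^+ a) ->
  C * p / p ^+ a < 1 ->
  let W t := \sum_(k < (2 * a).+1) tent (p ^+ 2) a k * (r ^+ (2 * k) * M (t / r ^+ k)) in
  forall t i, 0 < t <= 1 ->
    r ^+ (2 * i) * W (t / r ^+ i) <= Q ^+ i * W t /\
    W t <= Q ^+ i * (r ^+ (2 * i) * W (t / r ^+ i)).
Proof.
move=> M0 r1 p1 C0 hC Q1 Q2 k1 W t i t01; have [t0 t1] := andP t01.
have r0 : 0 < r by exact: lt_trans r1.
have p0 : 0 < p by exact: lt_trans p1.
have kap0 : 0 <= C * p / p ^+ a by rewrite !mulr_ge0 ?invr_ge0 ?exprn_ge0// ltW.
have Q0 : 0 < Q by apply: lt_le_trans Q1; rewrite ltr_wpDr// exprn_gt0.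
have W0 s : 0 < s -> 0 <= W s.
  move=> s0; rewrite /W sumr_ge0// => k _.
  rewrite !mulr_ge0 ?invr_ge0 ?exprn_ge0 ?ltW// M0// divr_gt0// exprn_gt0//.
have step s : 0 < s <= 1 -> r ^+ 2 * W (s / r) <= Q * W s /\ W s <= Q * (r ^+ 2 * W (s / r)).
  move=> /andP[s0 s1].
  pose f k := r ^+ (2 * k) * M (s / r ^+ k).
  have f0 k : 0 <= f k.
    by rewrite mulr_ge0 ?exprn_ge0 ?(ltW r0)// ltW// M0// divr_gt0// exprn_gt0.
  have l01 k : 0 < s / r ^+ k <= 1.
    rewrite divr_gt0 ?exprn_gt0//= ler_pdivrMr ?exprn_gt0// mul1r.
    by rewrite (le_trans s1)// exprn_ege1// ltW.
  (* The index bound is applied from the larger of the two arguments s / r^a and s / r^k down to the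
     smaller; both lie in (0,1]. *)
  have fa k : f k <= C * p ^+ ((k - a) + (a - k)) * f a.
    have [ak|ka] := leqP a k.
      rewrite (eqP (ak : a - k == 0)%N) addn0.
      have [+ _] := hC (s / r ^+ a) (k - a)%N (l01 a).
      rewrite -(ler_pM2l (exprn_gt0 (2 * a) r0)) mulrA -exprD -mulnDr subnKC//.
      rewrite (_ : s / r ^+ a / r ^+ (k - a) = s / r ^+ k); last first.
        by rewrite -mulrA -invfM -exprD subnKC.
      move=> /le_trans; apply.
      by rewrite /f mulrCA.
    have ka' := ltnW ka; rewrite (eqP (ka' : k - a == 0)%N) add0n.
    have [_ +] := hC (s / r ^+ k) (a - k)%N (l01 k).
    rewrite -(ler_pM2l (exprn_gt0 (2 * k) r0)).
    rewrite (_ : s / r ^+ k / r ^+ (a - k) = s / r ^+ a); last first.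
      by rewrite -mulrA -invfM -exprD subnKC.
    move=> /le_trans; apply.
    by rewrite mulrCA /f (mulrA (r ^+ _)) -exprD -mulnDr subnKC.
  have [] := tent_sum_shift f0 p1 erefl C0 fa.
  set S1 := \sum_(k < _) _ * f _.+1.
  have -> : S1 = r ^+ 2 * W (s / r).
    rewrite /W mulr_sumr; apply: eq_bigr => k _.
    rewrite /f (_ : s / r / r ^+ k = s / r ^+ k.+1); last by rewrite -mulrA -invfM -exprS.
    by rewrite mulnS exprD; ring.
  rewrite -/(W s) => h1 h2; split.
    by apply: (le_trans h1); rewrite ler_wpM2r// W0.
  have h3 : (1 - C * p / p ^+ a) * W s <= p ^+ 2 * (r ^+ 2 * W (s / r)).
    by rewrite mulrBl mul1r lerBlDr.
  have k1' : 0 < 1 - C * p / p ^+ a by rewrite subr_gt0.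
  rewrite -(ler_pM2l k1'); apply: (le_trans h3); rewrite [leRHS]mulrA ler_wpM2r//.
    by rewrite mulr_ge0 ?exprn_ge0 ?(ltW r0)// W0// divr_gt0.
  by rewrite mulrC.
elim: i => [|i [IH1 IH2]]; first by rewrite muln0 !expr0 !mul1r divr1.
have l01 : 0 < t / r ^+ i <= 1.
  rewrite divr_gt0 ?exprn_gt0//= ler_pdivrMr ?exprn_gt0// mul1r.
  by rewrite (le_trans t1)// exprn_ege1// ltW.
have [s1 s2] := step _ l01.
have E : t / r ^+ i.+1 = t / r ^+ i / r by rewrite exprSr invfM mulrA.
rewrite E mulnS exprD; split.
  rewrite -mulrA mulrCA; apply: (le_trans (ler_wpM2l _ s1)).
    by rewrite exprn_ge0 ?ltW.
  by rewrite mulrCA [in leRHS]exprS -mulrA ler_pM2l.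
apply: (le_trans IH2); rewrite exprSr -[leRHS]mulrA ler_pM2l ?exprn_gt0//.
rewrite -(ler_pM2l (exprn_gt0 (2 * i) r0)) in s2; apply: (le_trans s2).
by rewrite le_eqVlt; apply/orP; left; apply/eqP; ring.
Qed.


(* The error is relative to the value at the larger argument [t], not at [l * t]. *)
Definition near_quadratic (e : R) (N : R -> R) := forall l t,
  0 <= l <= 1 -> 0 <= t <= 1 -> `|N (l * t) - l ^+ 2 * N t| <= e * N t.

(** The order of choices matters: x from the number n of shifts, p = 1 + d from x, the constant C
    from p, and only then the half-width a, which makes the boundary error C p / p^a at most d. *)
Lemma exists_tent_average M (e : R) (n : nat) r :
  alpha_index M = 2%:E -> beta_index M = 2%:E -> (forall t, 0 < t -> 0 < M t) ->
  1 < r -> 0 < e -> exists q (a : nat), [/\ 1 <= q &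
  let W t := \sum_(k < (2 * a).+1) tent q a k * (r ^+ (2 * k) * M (t / r ^+ k)) in
  forall t i, (i <= n)%N -> 0 < t <= 1 ->
    r ^+ (2 * i) * W (t / r ^+ i) <= (1 + e) * W t /\
    W t <= (1 + e) * (r ^+ (2 * i) * W (t / r ^+ i))].
Proof.
move=> aM bM M0 r1 e0.
have [x /andP[x0 x1] hx] := expr_near1 n e0.
(* With x = 5d and d <= 1/5 there is room for (1 + d)^2 + d <= 1 + x and for (1 + d)^2 <= (1 + x)(1
   - d). *)
pose d := x / 5; have d0 : 0 < d by rewrite divr_gt0.
have d5 : d <= 1 / 5 by rewrite /d; lra.
have p1 : 1 < 1 + d by rewrite ltrDl.
have [C C1 hC] := geometric_index_bound aM bM M0 r1 p1.
have [a ha] := expr_unbounded (C * (1 + d) / d) p1.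
have pa : 0 < (1 + d) ^+ a by rewrite exprn_gt0// addr_gt0.
have kd : C * (1 + d) / (1 + d) ^+ a <= d.
  by rewrite ler_pdivrMr// -ler_pdivrMl// mulrC.
have Q1 : (1 + d) ^+ 2 + C * (1 + d) / (1 + d) ^+ a <= 1 + x.
  have -> : x = 5 * d by rewrite /d; field.
  rewrite expr2; nra.
have Q2 : (1 + d) ^+ 2 <= (1 + x) * (1 - C * (1 + d) / (1 + d) ^+ a).
  apply: (@le_trans _ _ ((1 + x) * (1 - d))); last first.
    by rewrite ler_pM2l ?addr_gt0// lerD2l lerN2.
  have -> : x = 5 * d by rewrite /d; field.
  rewrite expr2; nra.
have k1 : C * (1 + d) / (1 + d) ^+ a < 1 by apply: le_lt_trans kd _; lra.
exists ((1 + d) ^+ 2), a; split; first by rewrite exprn_ege1// lerDl ltW.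
move=> W t i ni t01.
have C0 : 0 <= C by rewrite (le_trans ler01).
have [h1 h2] := tent_average M0 r1 p1 C0 hC Q1 Q2 k1 i t01.
have Qn : (1 + x) ^+ i <= 1 + e.
  by apply: le_trans hx; apply: ler_weXn2l => //; rewrite lerDl ltW.
have r0 : 0 < r by exact: lt_trans r1.
have W0 s : 0 < s -> 0 <= W s.
  move=> s0; rewrite /W sumr_ge0// => k _.
  rewrite !mulr_ge0 ?invr_ge0 ?exprn_ge0 ?addr_ge0 ?(ltW d0) ?(ltW r0)// ltW// M0//.
  by rewrite divr_gt0// exprn_gt0.
have [t0 _] := andP t01.
split; [apply: (le_trans h1)|apply: (le_trans h2)]; rewrite ler_wpM2r ?W0//.
by rewrite mulr_ge0 ?exprn_ge0 ?(ltW r0)// W0// divr_gt0// exprn_gt0.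
Qed.

(** An l in [e, 1) lies between powers r^-(j+1) and r^-j with j < n, and monotonicity transfers the
    hypothesis to it. Bracketing costs r^2 <= (1 + th)^2 on top of the factor (1 + th)^2 of the
    hypothesis, hence the fourth power. *)
Lemma near_quadratic_of_geometric M L r (e th : R) (n : nat) :
  (forall c, c \in L -> 0 <= c) -> 1 < r -> r <= 1 + th -> 0 < th -> 0 < e -> e <= 1 ->
  (1 + th) ^+ 4 <= 1 + e -> e^-1 <= r ^+ n ->
  (forall t i, (i <= n)%N -> 0 < t <= 1 ->
    r ^+ (2 * i) * block_fun M L (t / r ^+ i) <= (1 + th) ^+ 2 * block_fun M L t /\
    block_fun M L t <= (1 + th) ^+ 2 * (r ^+ (2 * i) * block_fun M L (t / r ^+ i))) ->
  near_quadratic e (block_fun M L).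
Proof.
move=> L0 r1 rth th0 e0 e1 the ern hN l t /andP[l0 l1] /andP[t0 t1].
have r0 : 0 < r by exact: lt_trans r1.
have Nt0 : 0 <= block_fun M L t by exact: block_fun_ge0.
have Nlt0 : 0 <= block_fun M L (l * t) by rewrite block_fun_ge0// mulr_ge0.
have [tz|tn0] := eqVneq t 0.
  by rewrite tz mulr0 block_fun0 !mulr0 subrr normr0.
have tp : 0 < t by rewrite lt_def tn0.
(* For l < e both N(l t) and l^2 N(t) are at most l N(t), the first by convexity. *)
have [le|el] := ltP l e.
  have Nl : block_fun M L (l * t) <= e * block_fun M L t.
    apply: (@le_trans _ _ (l * block_fun M L t)).
      by apply: block_fun_scale; rewrite ?l0.
    by rewrite ler_wpM2r// ltW.
  have l2 : l ^+ 2 * block_fun M L t <= e * block_fun M L t.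
    rewrite ler_wpM2r//; apply: (@le_trans _ _ l); last exact: ltW.
    by rewrite expr2 ler_piMl.
  have l20 : 0 <= l ^+ 2 * block_fun M L t by rewrite mulr_ge0// sqr_ge0.
  by rewrite ler_norml; lra.
have lp : 0 < l by exact: lt_le_trans el.
have hj : exists j, l^-1 <= r ^+ j.
  by exists n; apply: le_trans ern; rewrite lef_pV2 ?posrE.
have [j lj minj] := ex_minnP hj.
have jn : (j <= n)%N by apply: minj; apply: le_trans ern; rewrite lef_pV2 ?posrE.
case: j => [|j] in lj minj jn *.
  have -> : l = 1.
    by apply/eqP; rewrite eq_le l1/= -[leRHS]invrK -[leLHS]invr1 lef_pV2 ?posrE ?invr_gt0// -(expr0 r).
  by rewrite mul1r expr1n mul1r subrr normr0 mulr_ge0// ltW.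
have jl : r ^+ j < l^-1 by rewrite ltNge; apply/negP => /minj; rewrite ltnn.
have rj0 : 0 < r ^+ j by rewrite exprn_gt0.
have rj1 : 0 < r ^+ j.+1 by rewrite exprn_gt0.
have ljp : l <= (r ^+ j)^-1 by rewrite -[l]invrK lef_pV2 ?posrE ?invr_gt0// ltW.
have lj1 : (r ^+ j.+1)^-1 <= l by rewrite -[l]invrK lef_pV2 ?posrE ?invr_gt0.
have t01 : 0 < t <= 1 by rewrite tp.
have [h1 _] := hN t j (ltnW jn) t01.
have [_ h2] := hN t j.+1 jn t01.
have m1 : block_fun M L (l * t) <= block_fun M L (t / r ^+ j).
  by apply: block_fun_le => //; rewrite ?mulr_ge0// mulrC ler_wpM2l.
have m2 : block_fun M L (t / r ^+ j.+1) <= block_fun M L (l * t).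
  by apply: block_fun_le => //; rewrite ?divr_ge0 ?(ltW rj1)// mulrC ler_wpM2r.
have sq2 : r ^+ 2 <= (1 + th) ^+ 2.
  by rewrite ler_sqr ?nnegrE ?(ltW r0)// addr_ge0// ltW.
have up : block_fun M L (l * t) <= (1 + e) * (l ^+ 2 * block_fun M L t).
  apply: (@le_trans _ _ ((1 + th) ^+ 4 * (l ^+ 2 * block_fun M L t))); last first.
    by rewrite ler_wpM2r// mulr_ge0 ?sqr_ge0.
  apply: (le_trans m1); rewrite -(ler_pM2l (exprn_gt0 (2 * j) r0)).
  apply: (le_trans h1).
  rewrite [leRHS](_ : _ = (1 + th) ^+ 2 * (((1 + th) ^+ 2 * (r ^+ j * l) ^+ 2) * block_fun M L t)); last first.
    by rewrite mulnC exprM; ring.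
  rewrite ler_pM2l ?exprn_gt0 ?addr_gt0// ler_peMl//.
  apply: (@le_trans _ _ (r ^+ 2 * (r ^+ j * l) ^+ 2)); last by rewrite ler_wpM2r// sqr_ge0.
  by rewrite -exprMn mulrA -exprS exprn_ege1// mulrC -ler_pdivrMr// mul1r.
have lo : l ^+ 2 * block_fun M L t <= (1 + e) * block_fun M L (l * t).
  apply: (@le_trans _ _ ((1 + th) ^+ 4 * block_fun M L (l * t))); last first.
    by rewrite ler_wpM2r.
  apply: (le_trans (ler_wpM2l (sqr_ge0 l) h2)).
  rewrite [leLHS](_ : _ = (1 + th) ^+ 2 * (r ^+ 2 * (r ^+ j * l) ^+ 2 * block_fun M L (t / r ^+ j.+1))); last first.
    by rewrite (_ : r ^+ (2 * j.+1) = r ^+ 2 * (r ^+ j) ^+ 2); [ring|rewrite mulnS exprD mulnC exprM].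
  rewrite (exprD _ 2 2) -[leRHS]mulrA ler_pM2l ?exprn_gt0 ?addr_gt0//.
  rewrite ler_pM ?block_fun_ge0 ?divr_ge0 ?(ltW rj1)//.
    by rewrite mulr_ge0// sqr_ge0.
  apply: le_trans sq2; rewrite ler_piMr ?sqr_ge0//.
  by rewrite exprn_ile1 ?mulr_ge0 ?(ltW rj0)// mulrC -ler_pdivlMr// mul1r.
have mm : block_fun M L (l * t) <= block_fun M L t.
  by apply: block_fun_le; rewrite ?mulr_ge0// ler_piMl.
have l2 : l ^+ 2 * block_fun M L t <= block_fun M L t.
  by rewrite ler_piMl// exprn_ile1.
rewrite ler_norml; nra.
Qed.

(** The tent weights times r^(2k) become integer multiplicities by rounding up. Rounding and
    averaging each cost a factor 1 + th, which together is the square allowed by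
    [near_quadratic_of_geometric]. *)
Lemma exists_near_quadratic_block M (e : R) :
  alpha_index M = 2%:E -> beta_index M = 2%:E -> (forall t, 0 < t -> 0 < M t) ->
  0 < e <= 1 -> exists L, [/\ head 0 L = 1, forall c, c \in L -> 0 <= c <= 1,
    near_quadratic e (block_fun M L) & 1 <= block_fun M L e].
Proof.
move=> aM bM M0 /andP[e0 e1].
have [th /andP[th0 th1] hth] := expr_near1 4 e0.
pose r := 1 + th; have r1 : 1 < r by rewrite ltrDl.
have r0 : 0 < r by exact: lt_trans r1.
have [n hn] := expr_unbounded e^-1 r1.
have [q [a [q1 hW]]] := exists_tent_average n aM bM M0 r1 th0.
set W := fun t : R => _ in hW.
have q0 : 0 < q by exact: lt_le_trans q1.
have Me := M0 _ e0.
(* The scale [A] makes every unrounded multiplicity at least 1/th + 1/M(e), as q^a offsets the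
   smallest tent weight. The first summand makes rounding cheap; by the second, the coefficients
   equal to 1 alone contribute at least 1 to N(e). *)
pose A := q ^+ a * (th^-1 + (M e)^-1).
have A0 : 0 < A by rewrite mulr_gt0 ?addr_gt0 ?invr_gt0 ?exprn_gt0.
pose x k := A * (tent q a k * r ^+ (2 * k)).
pose m k := (Num.truncn (x k)).+1.
pose K := (2 * a).+1.
pose L := flatten [seq nseq (m k) ((r ^+ k)^-1) | k <- iota 0 K].
have tent_gt0 k : 0 < tent q a k by rewrite invr_gt0 exprn_gt0.
have x0 k : 0 < x k by rewrite /x mulr_gt0// mulr_gt0 ?exprn_gt0.
have NE t : block_fun M L t = \sum_(k < K) (m k)%:R * M (t / r ^+ k).
  rewrite /block_fun /L big_flatten big_map.
  rewrite -[iota 0 K]/(index_iota 0 K) big_mkord; apply: eq_bigr => k _.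
  by rewrite big_nseq iter_addr_0 mulr_natl mulrC.
have xm k : x k <= (m k)%:R by rewrite ltW// truncnS_gt.
have tent_lb k : (k < K)%N -> q ^- a <= tent q a k.
  move=> kK; rewrite /tent lef_pV2 ?posrE ?exprn_gt0//; apply: ler_weXn2l => //.
  by move: kK; rewrite /K; clear; lia.
have x_lb k : (k < K)%N -> th^-1 + (M e)^-1 <= x k.
  move=> kK; rewrite /x /A -mulrA mulrCA ler_peMr ?addr_ge0 ?invr_ge0 ?(ltW th0) ?(ltW Me)//.
  rewrite mulrA; apply: (@le_trans _ _ (q ^+ a * tent q a k)).
    by rewrite mulrC -ler_pdivrMr ?exprn_gt0// mul1r tent_lb.
  rewrite ler_peMr ?mulr_ge0 ?exprn_ge0 ?(ltW q0) ?(ltW (tent_gt0 k))//.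
  by rewrite exprn_ege1// ltW.
have mx k : (k < K)%N -> (m k)%:R <= (1 + th) * x k.
  move=> kK; rewrite /m -natr1.
  have h1 : (Num.truncn (x k))%:R <= x k by rewrite truncn_le// ltW.
  have h2 : 1 <= th * x k.
    rewrite mulrC -ler_pdivrMr// mul1r; apply: le_trans (x_lb _ kK).
    by rewrite lerDl invr_ge0 ltW.
  by rewrite mulrDl mul1r lerD.
have Mk t k : 0 < t -> 0 <= M (t / r ^+ k).
  by move=> t0; rewrite ltW// M0// divr_gt0// exprn_gt0.
have NW t : 0 < t -> A * W t <= block_fun M L t <= (1 + th) * (A * W t).
  move=> t0; rewrite NE /W !mulr_sumr; apply/andP; split; apply: ler_sum => k _.
    rewrite [leLHS](_ : _ = x k * M (t / r ^+ k)); last by rewrite /x; ring.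
    by rewrite ler_wpM2r ?Mk.
  rewrite [leRHS](_ : _ = (1 + th) * x k * M (t / r ^+ k)); last by rewrite /x; ring.
  by rewrite ler_wpM2r ?Mk// mx.
have W0 t : 0 < t -> 0 <= W t.
  move=> t0; apply: sumr_ge0 => k _.
  by rewrite !mulr_ge0 ?Mk ?exprn_ge0 ?(ltW r0) ?(ltW (tent_gt0 _)).
have L01 c : c \in L -> 0 <= c <= 1.
  move=> /flattenP[s /mapP[k _ ->]] /nseqP[-> _].
  by rewrite invr_ge0 exprn_ge0 ?(ltW r0)//= invf_le1 ?exprn_gt0// exprn_ege1// ltW.
have L0 c : c \in L -> 0 <= c by move=> /L01 /andP[].
exists L; split => //.
- by rewrite /= expr0 invr1.
- apply: (near_quadratic_of_geometric (r := r) (th := th) (n := n)) => // t i ni t01.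
  have [t0 t1] := andP t01.
  have ri : 0 < r ^+ i by rewrite exprn_gt0.
  have r2i : 0 < r ^+ (2 * i) by rewrite exprn_gt0.
  have [h1 h2] := hW t i ni t01.
  have /andP[a1 a2] := NW t t0.
  have /andP[b1 b2] := NW (t / r ^+ i) (divr_gt0 t0 ri).
  have th' : 0 < 1 + th by rewrite addr_gt0.
  rewrite expr2; split.
    apply: (le_trans (ler_wpM2l (ltW r2i) b2)).
    rewrite mulrCA (mulrCA _ A) -mulrA ler_pM2l//.
    apply: (@le_trans _ _ ((1 + th) * (A * W t))); last by rewrite ler_pM2l.
    by rewrite (mulrCA _ A) ler_pM2l.
  apply: (le_trans a2); rewrite -mulrA ler_pM2l//.
  apply: (le_trans (ler_wpM2l (ltW A0) h2)).
  by rewrite mulrCA ler_pM2l// mulrCA ler_pM2l.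
- rewrite NE (bigD1 (@Ordinal K 0 isT))//= expr0 divr1.
  apply: (@le_trans _ _ ((m 0)%:R * M e)); last first.
    by rewrite lerDl sumr_ge0// => k _; rewrite mulr_ge0// Mk.
  rewrite -ler_pdivrMr// mul1r; apply: le_trans (xm 0); apply: le_trans (x_lb 0 isT).
  by rewrite lerDr invr_ge0 ltW.
Qed.

End Growth.

(** * Scalars and norms *)

Section ScalarTheory.
Variables (R : realType) (s : scalars).
Local Notation K := (scalar_field R s).
Implicit Types z w : K.

Lemma of_real_inj : injective (@of_real R s).
Proof. exact: can_inj (@of_realK R s). Qed.

Lemma of_real1 : of_real s 1 = 1 :> K.
Proof. by rewrite /of_real; case: s. Qed.

Lemma of_real_lt (x y : R) : (of_real s x < of_real s y) = (x < y).
Proof. by rewrite !lt_def of_real_le (inj_eq of_real_inj). Qed.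

Lemma of_real_sum I (r : seq I) (P : pred I) (F : I -> R) :
  of_real s (\sum_(i <- r | P i) F i) = \sum_(i <- r | P i) of_real s (F i).
Proof. by apply: big_morph; [exact: of_realD|exact: of_real0]. Qed.

Lemma modulus_of_real (x : R) : modulus (of_real s x) = `|x|.
Proof.
rewrite /modulus /scalar_re /of_real; case: s => //=.
by rewrite expr0n/= addr0 sqrtr_sqr.
Qed.

Lemma of_real_norm_gt0 (e : K) : 0 < e -> of_real s (modulus e) = e /\ 0 < modulus e.
Proof.
move=> e0; have h : of_real s (modulus e) = e by rewrite of_real_modulus gtr0_norm.
by split => //; rewrite -of_real_lt h of_real0.
Qed.

Lemma modulus1 : modulus (1 : K) = 1.
Proof. by rewrite -of_real1 modulus_of_real normr1. Qed.

Lemma modulusN z : modulus (- z) = modulus z.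
Proof. by rewrite /modulus normrN. Qed.

Lemma modulusBC z w : modulus (z - w) = modulus (w - z).
Proof. by rewrite -modulusN opprB. Qed.

Lemma modulus_sum I (r : seq I) (P : pred I) (F : I -> K) :
  modulus (\sum_(i <- r | P i) F i) <= \sum_(i <- r | P i) modulus (F i).
Proof.
by elim/big_ind2 : _ => [|x a y b h1 h2|//]; rewrite ?modulus0// (le_trans (modulusD _ _))// lerD.
Qed.

Lemma modulus_gt0 z : (0 < modulus z) = (z != 0).
Proof.
rewrite lt_def modulus_ge0 andbT; apply: congr1; apply/eqP/eqP => [/modulus_eq0//|->].
exact: modulus0.
Qed.

Lemma scalar_conjK : involutive (@scalar_conj R s).
Proof. by rewrite /scalar_conj; case: s => // -[a b] /=; rewrite opprK. Qed.

Lemma scalar_conjD z w : scalar_conj (z + w) = scalar_conj z + scalar_conj w.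
Proof. by move: z w; rewrite /scalar_conj; case: s => // z w; exact: (rmorphD conjc). Qed.

Lemma scalar_conjM z w : scalar_conj (z * w) = scalar_conj z * scalar_conj w.
Proof. by move: z w; rewrite /scalar_conj; case: s => // z w; exact: (rmorphM conjc). Qed.

Lemma scalar_conj_of_real (x : R) : scalar_conj (of_real s x) = of_real s x.
Proof. by rewrite /scalar_conj /of_real; case: s => //=; rewrite oppr0. Qed.

Lemma scalar_conj0 : scalar_conj (0 : K) = 0.
Proof. by rewrite -of_real0 scalar_conj_of_real. Qed.

Lemma scalar_conjN z : scalar_conj (- z) = - scalar_conj z.
Proof. by apply/eqP; rewrite -addr_eq0 -scalar_conjD addNr scalar_conj0. Qed.

Lemma mul_scalar_conj z : z * scalar_conj z = of_real s (modulus z ^+ 2).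
Proof.
rewrite expr2 of_realM of_real_modulus -expr2.
move: z; rewrite /scalar_conj; case: s => z; first by rewrite -expr2 real_normK ?num_real.
by rewrite sqr_normc.
Qed.

Lemma modulus_conj z : modulus (scalar_conj z) = modulus z.
Proof.
apply/eqP; rewrite -(eqrXn2 (n := 2))// ?modulus_ge0//; apply/eqP/of_real_inj.
by rewrite -!mul_scalar_conj scalar_conjK mulrC.
Qed.

(** Stated through the real-valued modulus, so that both fields are treated alike. *)
Definition scalar_cvg (u : nat -> K) (l : K) :=
  modulus (u n - l) @[n --> \oo] --> (0 : R).

Lemma scalar_cvgP (u : nat -> K) l : scalar_cvg u l <->
  forall e : R, 0 < e -> exists N, forall n, (N <= n)%N -> modulus (u n - l) <= e.
Proof.
split.
  move/cvgrPdist_le => h e e0; have [N _ hN] := h e e0.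
  by exists N => n /hN /=; rewrite sub0r normrN ger0_norm ?modulus_ge0.
move=> h; apply/cvgrPdist_le => e /h[N hN]; exists N => // n /= /hN.
by rewrite sub0r normrN ger0_norm ?modulus_ge0.
Qed.

Lemma scalar_cvg_unique (u : nat -> K) l l' : scalar_cvg u l -> scalar_cvg u l' -> l = l'.
Proof.
move=> /scalar_cvgP h /scalar_cvgP h'; apply/eqP; rewrite -subr_eq0; apply/eqP/modulus_eq0.
apply/eqP; rewrite eq_le modulus_ge0 andbT; apply/ler_addgt0Pr => e e0.
have e2 : 0 < e / 2 by rewrite divr_gt0.
have [N hN] := h _ e2; have [N' hN'] := h' _ e2.
have := hN (maxn N N') (leq_maxl _ _); have := hN' (maxn N N') (leq_maxr _ _).
set v := u _; have -> : l - l' = (v - l') - (v - l) by rewrite opprB [RHS]addrC [RHS]addrA subrK.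
have := modulusD (v - l') (- (v - l)); rewrite modulusN; lra.
Qed.

Lemma scalar_cvg_cst l : scalar_cvg (fun=> l) l.
Proof. by apply/scalar_cvgP => e e0; exists 0 => n _; rewrite subrr modulus0 ltW. Qed.

Lemma scalar_cvgD u v l m : scalar_cvg u l -> scalar_cvg v m ->
  scalar_cvg (fun n => u n + v n) (l + m).
Proof.
move=> /scalar_cvgP h /scalar_cvgP h'; apply/scalar_cvgP => e e0.
have e2 : 0 < e / 2 by rewrite divr_gt0.
have [N hN] := h _ e2; have [N' hN'] := h' _ e2; exists (maxn N N') => n.
rewrite geq_max => /andP[/hN a /hN' b]; rewrite opprD addrACA.
have := modulusD (u n - l) (v n - m); lra.
Qed.

Lemma scalar_cvgM a u l : scalar_cvg u l -> scalar_cvg (fun n => a * u n) (a * l).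
Proof.
move=> /scalar_cvgP h; apply/scalar_cvgP => e e0.
have a1 : 0 < modulus a + 1 by rewrite ltr_wpDl ?modulus_ge0.
have [N hN] := h _ (divr_gt0 e0 a1); exists N => n /hN.
rewrite -mulrBr modulusM ler_pdivlMr//; apply: le_trans.
by rewrite mulrC ler_wpM2l ?modulus_ge0// lerDl.
Qed.

Lemma scalar_cvg_conj u l : scalar_cvg u l ->
  scalar_cvg (fun n => scalar_conj (u n)) (scalar_conj l).
Proof.
rewrite /scalar_cvg; under [X in _ -> X]eq_cvg => n.
  rewrite -scalar_conjN -scalar_conjD modulus_conj; over.
by [].
Qed.

Lemma scalar_cvg_of_real (x : nat -> R) (a : R) : x @ \oo --> a ->
  scalar_cvg (fun n => of_real s (x n)) (of_real s a).
Proof.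
move/cvgrPdist_le => h; apply/scalar_cvgP => e /h[N _ hN]; exists N => n /hN /=.
have <- : of_real s (x n - a) = of_real s (x n) - of_real s a.
  by apply/eqP; rewrite eq_sym subr_eq -of_realD subrK.
by rewrite modulus_of_real distrC.
Qed.

Lemma cauchy_seq_cvg (u : nat -> R) :
  (forall e : R, 0 < e -> exists N, forall m n, (N <= m)%N -> (N <= n)%N ->
    `|u m - u n| <= e) -> cvgn u.
Proof.
move=> h; apply/cauchy_cvgP/cauchyP => e e0.
have [N hN] := h (e / 2) (divr_gt0 e0 (ltr0n _ 2)).
exists (u N); exists N => // n /= Nn.
by apply: le_lt_trans (hN N n (leqnn _) Nn) _; rewrite ltr_pdivrMr// ltr_pMr// ltr1n.
Qed.

Lemma scalar_cauchy_cvg (u : nat -> K) :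
  (forall e : R, 0 < e -> exists N, forall m n, (N <= m)%N -> (N <= n)%N ->
    modulus (u m - u n) <= e) -> exists l, scalar_cvg u l.
Proof.
move: u; rewrite /scalar_cvg /modulus /scalar_re; case: s => /= u h.
  exists (limn u); have /cvgrPdist_le c : cvgn u by exact: cauchy_seq_cvg.
  apply/cvgrPdist_le => e /c[N _ hN]; exists N => // n /hN /=.
  by rewrite sub0r normrN normr_id distrC.
have hRe (z : R[i]) : `|complex.Re z| <= complex.Re `|z|.
  by rewrite -lecR; apply: le_trans (normc_ge_Re _) _; rewrite RRe_real// normr_real.
have hIm (z : R[i]) : `|complex.Im z| <= complex.Re `|z|.
  rewrite normc_def /= -sqrtr_sqr ler_sqrt ?lerDr ?sqr_ge0//.
  by rewrite addr_ge0// sqr_ge0.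
have hsum (z : R[i]) : complex.Re `|z| <= `|complex.Re z| + `|complex.Im z|.
  rewrite normc_def /= -ler_sqr ?nnegrE ?sqrtr_ge0 ?addr_ge0//.
  rewrite sqr_sqrtr ?addr_ge0 ?sqr_ge0// sqrrD !real_normK ?num_real//.
  by rewrite lerD2r lerDl mulrn_wge0// mulr_ge0.
have ReB (z w : R[i]) : complex.Re (z - w) = complex.Re z - complex.Re w by case: z; case: w.
have ImB (z w : R[i]) : complex.Im (z - w) = complex.Im z - complex.Im w by case: z; case: w.
have cRe : cvgn (fun n => complex.Re (u n)).
  apply: cauchy_seq_cvg => e /h[N hN]; exists N => m n /hN /[apply].
  by apply: le_trans; rewrite -ReB.
have cIm : cvgn (fun n => complex.Im (u n)).
  apply: cauchy_seq_cvg => e /h[N hN]; exists N => m n /hN /[apply].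
  by apply: le_trans; rewrite -ImB.
exists (Complex (limn (fun n => complex.Re (u n))) (limn (fun n => complex.Im (u n)))).
apply/cvgrPdist_le => e e0; have e2 : 0 < e / 2 by rewrite divr_gt0.
have [N _ hN] := (cvgrPdist_le _ _).1 cRe _ e2.
have [N' _ hN'] := (cvgrPdist_le _ _).1 cIm _ e2.
exists (maxn N N') => // n /=; rewrite geq_max => /andP[/hN a /hN' b].
rewrite sub0r normrN ger0_norm; last by apply: le_trans (hRe _).
apply: (le_trans (hsum _)); rewrite ReB ImB /= (distrC (complex.Re _)) (distrC (complex.Im _)).
by rewrite [e]splitr lerD.
Qed.

End ScalarTheory.

Section RealNorm.
Variables (R : realType) (s : scalars).
Local Notation K := (scalar_field R s).
Implicit Types (V W : normedModType K).

Lemma of_real_rnorm V (x : V) : of_real s (rnorm x) = `|x|.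
Proof.
rewrite /rnorm; suff h (k : K) : 0 <= k -> of_real s (scalar_re k) = k by rewrite h.
by move=> k0; have := of_real_modulus k; rewrite /modulus ger0_norm.
Qed.

Lemma rnorm_ge0 V (x : V) : 0 <= rnorm x.
Proof. by rewrite -(of_real_le s) of_real_rnorm of_real0. Qed.

Lemma rnormD V (x y : V) : rnorm (x + y) <= rnorm x + rnorm y.
Proof. by rewrite -(of_real_le s) of_realD !of_real_rnorm ler_normD. Qed.

Lemma rnormZ V (a : K) (x : V) : rnorm (a *: x) = modulus a * rnorm x.
Proof. by apply: (@of_real_inj R s); rewrite of_realM of_real_modulus !of_real_rnorm normrZ. Qed.

Lemma rnormN V (x : V) : rnorm (- x) = rnorm x.
Proof. by rewrite /rnorm normrN. Qed.

Lemma rnorm0 V : rnorm (0 : V) = 0.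
Proof. by apply: (@of_real_inj R s); rewrite of_real_rnorm normr0 of_real0. Qed.

Lemma rnorm_eq0 V (x : V) : rnorm x = 0 -> x = 0.
Proof. by move=> x0; apply/eqP; rewrite -normr_eq0 -of_real_rnorm x0 of_real0. Qed.

Lemma rnorm_gt0 V (x : V) : (0 < rnorm x) = (x != 0).
Proof.
rewrite lt_def rnorm_ge0 andbT; apply: congr1; apply/eqP/eqP => [/rnorm_eq0//|->].
exact: rnorm0.
Qed.

Lemma rnormBC V (x y : V) : rnorm (x - y) = rnorm (y - x).
Proof. by rewrite -rnormN opprB. Qed.

Lemma norm_lt_rnorm V (x : V) (e : R) : (`|x| < of_real s e) = (rnorm x < e).
Proof. by rewrite -of_real_rnorm of_real_lt. Qed.

Lemma bounded_within_continuous V W (E : set V) (T : V -> W) (C : R) :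
  linear_subspace E -> linear_on E T -> (forall x, E x -> rnorm (T x) <= C * rnorm x) ->
  {within E, continuous T}.
Proof.
move=> [E0 EL] TL TC; apply/subspace_continuousP => x Ex.
apply/cvgrPdist_lt => e e0; rewrite near_withinE; apply/nbhs_normP.
have [eE me0] := of_real_norm_gt0 e0.
have D0 : 0 < `|C| + 1 by rewrite ltr_wpDl.
exists (of_real s (modulus e / (`|C| + 1))).
  by rewrite /= -(of_real0 R s) of_real_lt divr_gt0.
move=> y /=; rewrite norm_lt_rnorm => xy Ey.
have Exy : E (x - y) by rewrite addrC -scaleN1r; exact: EL.
have -> : T x - T y = T (x - y).
  by rewrite addrC -scaleN1r -TL// scaleN1r addrC.
rewrite -eE norm_lt_rnorm; apply: le_lt_trans (TC _ Exy) _.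
rewrite ltr_pdivlMr// in xy; apply: le_lt_trans xy.
rewrite mulrC ler_wpM2l ?rnorm_ge0//.
by rewrite (le_trans (ler_norm _))// lerDl.
Qed.

Lemma linear_onZ V W (E : set V) (T : V -> W) a x : linear_subspace E ->
  linear_on E T -> E x -> T (a *: x) = a *: T x.
Proof.
move=> [E0 EL] TL Ex.
have T0 : T 0 = 0.
  have := TL 1 0 0 E0 E0; rewrite !scale1r addr0 => h.
  by apply: (addIr (T 0)); rewrite add0r -h.
by have := TL a x 0 Ex E0; rewrite T0 !addr0.
Qed.

Lemma continuous_on_bounded V W (E : set V) (T : V -> W) :
  linear_subspace E -> linear_on E T -> {within E, continuous T} ->
  exists2 C : R, 0 < C & forall x, E x -> rnorm (T x) <= C * rnorm x.
Proof.
move=> [E0 EL] TL /subspace_continuousP/(_ 0 E0)/cvgrPdist_lt/(_ _ ltr01).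
rewrite near_withinE => /nbhs_normP[/= d d0 h].
have [dE md0] := of_real_norm_gt0 d0.
have T0 : T 0 = 0 by rewrite -(scale0r 0) (linear_onZ _ _ TL)// scale0r.
set D := modulus d in md0 dE; exists (2 / D); first by rewrite divr_gt0.
move=> x Ex; have [->|x0] := eqVneq x 0; first by rewrite T0 !rnorm0 mulr0.
have nx : 0 < rnorm x by rewrite rnorm_gt0.
pose a := of_real s (D / 2 / rnorm x).
have a0 : 0 < D / 2 / rnorm x by rewrite !divr_gt0.
have ma : modulus a = D / 2 / rnorm x by rewrite modulus_of_real gtr0_norm.
have Eax : E (a *: x) by rewrite -[a *: x]addr0; exact: EL.
have := h (a *: x); rewrite /= /from_subspace sub0r normrN T0 sub0r normrN -dE norm_lt_rnorm.
rewrite -(of_real1 R s) norm_lt_rnorm (linear_onZ _ _ TL)// !rnormZ ma divfK ?gt_eqF//.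
move=> /(_ _ Eax) hh; have {}hh : D / 2 / rnorm x * rnorm (T x) < 1.
  by apply: hh; rewrite ltr_pdivrMr// ltr_pMr// ltr1n.
rewrite -(ler_pM2l a0); apply: (le_trans (ltW hh)).
by rewrite le_eqVlt; apply/orP; left; apply/eqP; field; rewrite !gt_eqF.
Qed.

(** A Cauchy filter contains a ball of radius 1/(m+1) for every m. Any two of these balls meet,
    which gives the centres the stated rate, and the limit of the centres is the limit of the
    filter. *)
Lemma seq_complete_cvg V :
  (forall u : nat -> V, (forall m n, rnorm (u m - u n) <= m.+1%:R^-1 + n.+1%:R^-1) ->
    exists x, forall m, rnorm (u m - x) <= m.+1%:R^-1) ->
  forall F : set_system V, ProperFilter F -> cauchy F -> cvg F.
Proof.
move=> h F PF /cauchyP Fc.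
have inv0 m : 0 < of_real s (m.+1%:R^-1 : R) by rewrite -(of_real0 R s) of_real_lt invr_gt0.
have /choice[u hu] : forall m, exists x, F (ball x (of_real s (m.+1%:R^-1))).
  by move=> m; exact: Fc.
have hu' m : F [set y | rnorm (u m - y) < m.+1%:R^-1].
  have -> : [set y | rnorm (u m - y) < m.+1%:R^-1] = ball (u m) (of_real s (m.+1%:R^-1)).
    by apply/seteqP; split=> y; rewrite /= -ball_normE /= norm_lt_rnorm.
  exact: hu.
have [|x hx] := h u.
  move=> m n; have FI := @filterI _ F (@filter_filter _ _ PF) _ _ (hu' m) (hu' n).
  have [y [/= hm hn]] := filter_ex FI.
  have -> : u m - u n = (u m - y) + (y - u n) by rewrite addrA subrK.
  by apply: (le_trans (rnormD _ _)); rewrite lerD ?(ltW hm)// rnormBC ltW.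
suff : F --> x by move=> ?; apply/cvg_ex; exists x.
apply/cvgrPdist_lt => e e0; have [eE me0] := of_real_norm_gt0 e0.
pose m := Num.truncn (2 / modulus e).
have hm : m.+1%:R^-1 < modulus e / 2 :> R.
  by rewrite -[ltRHS]invrK invf_div ltf_pV2 ?posrE ?divr_gt0// truncnS_gt.
apply: filterS (hu' m) => y /= hy; rewrite -eE norm_lt_rnorm.
have -> : x - y = (x - u m) + (u m - y) by rewrite addrA subrK.
apply: le_lt_trans (rnormD _ _) _; rewrite rnormBC.
rewrite [modulus e]splitr ler_ltD//; first by rewrite (le_trans (hx m))// ltW.
exact: lt_trans hy _.
Qed.

End RealNorm.

(** * The Hilbert space of square-summable sequences *)

Lemma nneseries_leP (R : realType) (a : nat -> R) (B : R) : (forall n, 0 <= a n) ->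
  (\sum_(0 <= n <oo) (a n)%:E <= B%:E)%E <-> forall N, \sum_(k < N) a k <= B.
Proof.
move=> a0; have a0' n : true -> (0 <= (a n)%:E)%E by rewrite lee_fin a0.
have cv := @is_cvg_nneseries R (fun n => (a n)%:E) xpredT 0 (fun n _ => a0' n).
split=> [h N|h].
  rewrite -lee_fin; apply: le_trans h; rewrite -sumEFin -(big_mkord xpredT (fun k => (a k)%:E)).
  by apply: nneseries_lim_ge => n _ _; rewrite lee_fin.
apply: lime_le => //; apply: nearW => N.
by rewrite big_mkord sumEFin lee_fin.
Qed.

Lemma cvg_sum_ord (R : realType) (f : nat -> nat -> R) (a : nat -> R) N :
  (forall k, f k n @[n --> \oo] --> a k) ->
  \sum_(k < N) f k n @[n --> \oo] --> \sum_(k < N) a k.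
Proof.
move=> h; elim: N => [|N IH].
  by under eq_cvg do rewrite big_ord0; rewrite big_ord0; exact: cvg_cst.
by under eq_cvg do rewrite big_ord_recr; rewrite big_ord_recr; exact: cvgD.
Qed.

Section SquareSummable.
Variable R : realType.

Lemma sqr_convex : @convex_function R R^o [set t : R | 0 <= t] (fun t : R => t ^+ 2).
Proof.
move=> p x y _ _; rewrite !convRE (_ : conv p x y = p%:num * x + (1 - p%:num) * y :> R); last exact: convRE.
have p0 : 0 <= p%:num by [].
have p1 : p%:num <= 1 by [].
rewrite -subr_ge0; set q := p%:num in p0 p1 *.
have -> : q * x ^+ 2 + (1 - q) * y ^+ 2 - (q * x + (1 - q) * y) ^+ 2 =
  q * (1 - q) * (x - y) ^+ 2 by rewrite /unstable.onem; ring.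
have h (u v : R) : 0 <= q * (1 - q) * (u - v) ^+ 2.
  by rewrite mulr_ge0 ?sqr_ge0// mulr_ge0// subr_ge0.
exact: h.
Qed.

Definition sqr_orlicz : orlicz_function R :=
  OrliczFunction (fun t _ => sqr_ge0 t) sqr_convex (expr0n R 2) (@cvgr_expr2 R).

Variable s : scalars.
Local Notation K := (scalar_field R s).

(** l_2 is taken as the Orlicz space of t^2, which provides its vector space and norm; completeness
    and the inner product are added below. It is the model Hilbert space. *)
Definition sqr_summable := lorlicz s sqr_orlicz.
HB.instance Definition _ := NormedModule.on sqr_summable.

Lemma lux_admissibleP (M : orlicz_function R) (x : nat -> K^o) (r : R) : 0 < r ->
  lux_admissible M x r <-> forall N, \sum_(k < N) M (modulus (x k) / r) <= 1.
Proof.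
move=> r0; have a0 n : 0 <= M (modulus (x n) / r).
  by rewrite orlicz_ge0// divr_ge0 ?modulus_ge0 ?ltW.
split=> [[_ /(nneseries_leP _ a0)]//|h]; split => //.
exact/(nneseries_leP _ a0).
Qed.

Lemma sqr_admissibleP (x : nat -> K^o) (r : R) : 0 < r ->
  lux_admissible sqr_orlicz x r <-> forall N, \sum_(k < N) modulus (x k) ^+ 2 <= r ^+ 2.
Proof.
move=> r0; have E N : (\sum_(k < N) sqr_orlicz (modulus (x k) / r) <= 1) =
    (\sum_(k < N) modulus (x k) ^+ 2 <= r ^+ 2).
  rewrite /=; under eq_bigr => k _ do rewrite exprMn exprVn.
  by rewrite -mulr_suml ler_pdivrMr ?exprn_gt0// mul1r.
split=> [/(lux_admissibleP _ _ r0) h N|h]; first by rewrite -E.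
by apply/(lux_admissibleP _ _ r0) => N; rewrite E.
Qed.

(** Together with [rnorm_le_of_sqr_sum] this identifies the Luxemburg norm of t^2 with the l_2 norm,
    using partial sums only. *)
Lemma sqr_sum_le_rnorm (x : sqr_summable) N :
  \sum_(k < N) modulus (x k) ^+ 2 <= rnorm x ^+ 2.
Proof.
rewrite leNgt; apply/negP => h.
set S := \sum_(k < N) _ in h.
have S0 : 0 <= S by apply: sumr_ge0 => *; exact: sqr_ge0.
have xS : fine (lux_norm sqr_orlicz x) < Num.sqrt S.
  rewrite -rnorm_lorlicz -ltr_sqr ?nnegrE ?rnorm_ge0 ?sqrtr_ge0//.
  by rewrite sqr_sqrtr.
have [r [r0 hr] rS] := lux_norm_lt (lorlicz_lty x) xS.
have /(sqr_admissibleP _ r0)/(_ N) : lux_admissible sqr_orlicz x r by [].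
rewrite -/S leNgt => /negP; apply.
by rewrite -[ltRHS]sqr_sqrtr// ltr_sqr ?nnegrE ?sqrtr_ge0 ?(ltW r0).
Qed.

Lemma rnorm_le_of_sqr_sum (x : sqr_summable) (B : R) : 0 <= B ->
  (forall N, \sum_(k < N) modulus (x k) ^+ 2 <= B ^+ 2) -> rnorm x <= B.
Proof.
move=> B0 h; apply/ler_addgt0Pr => e e0; rewrite rnorm_lorlicz.
have Be : 0 < B + e by rewrite ltr_wpDl.
apply: lux_norm_le; apply/(sqr_admissibleP _ Be) => N; apply: (le_trans (h N)).
by rewrite ler_sqr ?nnegrE// ?(ltW Be)// lerDl ltW.
Qed.

Lemma sqr_summableP (x : nat -> K^o) (B : R) : 0 <= B ->
  (forall N, \sum_(k < N) modulus (x k) ^+ 2 <= B ^+ 2) -> x \in @lorlicz_pred R s sqr_orlicz.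
Proof.
move=> B0 h; rewrite inE; apply/lux_norm_ltyP; exists (B + 1).
have B1 : 0 < B + 1 by rewrite ltr_wpDl.
apply/(sqr_admissibleP _ B1) => N; apply: (le_trans (h N)).
by rewrite ler_sqr ?nnegrE// ?(ltW B1)// lerDl.
Qed.

Lemma scalar_cvg_modulus (u : nat -> K) l : scalar_cvg u l ->
  modulus (u n) @[n --> \oo] --> modulus l.
Proof.
move=> /scalar_cvgP h; apply/cvgrPdist_le => e /h[N hN]; exists N => // n /= /hN.
apply: le_trans; rewrite ler_norml.
have h1 := modulusD (u n - l) l; rewrite subrK in h1.
have h2 := modulusD (l - u n) (u n); rewrite subrK modulusBC in h2.
by apply/andP; split; lra.
Qed.

Lemma sqr_summable_complete (F : set_system sqr_summable) :
  ProperFilter F -> cauchy F -> cvg F.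
Proof.
apply: (@seq_complete_cvg R s) => u hu.
have coord m n k : modulus (u m k - u n k) <= rnorm (u m - u n).
  rewrite -ler_sqr ?nnegrE ?modulus_ge0 ?rnorm_ge0//.
  apply: le_trans (sqr_sum_le_rnorm (u m - u n) k.+1).
  by rewrite big_ord_recr/= lerDr sumr_ge0// => *; exact: sqr_ge0.
have /choice[l hl] : forall k, exists l, scalar_cvg (fun n => u n k) l.
  move=> k; apply: scalar_cauchy_cvg => e e0.
  exists (Num.truncn (2 / e)) => m n Nm Nn; apply: (le_trans (coord _ _ _)).
  apply: (le_trans (hu _ _)).
  have h p : (Num.truncn (2 / e) <= p)%N -> p.+1%:R^-1 <= e / 2.
    move=> Np; rewrite -[leRHS]invrK invf_div lef_pV2 ?posrE ?divr_gt0//.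
    by apply/ltW/(lt_le_trans (truncnS_gt _)); rewrite ler_nat.
  by rewrite [e]splitr lerD ?h.
(* For a fixed number N of coordinates, the bound for u m - u n passes to the limit in n. *)
have tail m N : \sum_(k < N) modulus (u m k - l k) ^+ 2 <= (m.+1%:R^-1) ^+ 2.
  have c1 : \sum_(k < N) modulus (u m k - u n k) ^+ 2 @[n --> \oo] -->
      \sum_(k < N) modulus (u m k - l k) ^+ 2.
    apply: (cvg_sum_ord (f := fun k n => modulus (u m k - u n k) ^+ 2)
      (a := fun k => modulus (u m k - l k) ^+ 2)) => k; under eq_cvg do rewrite expr2.
    have c : modulus (u m k - u n k) @[n --> \oo] --> modulus (u m k - l k).
      apply: scalar_cvg_modulus; apply: scalar_cvgD; first exact: scalar_cvg_cst.
      have := scalar_cvgM (-1) (hl k); rewrite mulN1r.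
      by under [X in scalar_cvg X]funext do rewrite mulN1r.
    by rewrite expr2; exact: cvgM.
  have c2 : (m.+1%:R^-1 + n.+1%:R^-1) ^+ 2 @[n --> \oo] --> (m.+1%:R^-1 + 0 : R) ^+ 2.
    under eq_cvg do rewrite expr2.
    have c : m.+1%:R^-1 + n.+1%:R^-1 @[n --> \oo] --> (m.+1%:R^-1 + 0 : R).
      by apply: cvgD; [exact: cvg_cst|exact: cvg_harmonic].
    by rewrite expr2; exact: cvgM.
  rewrite -[X in _ <= X ^+ 2]addr0; apply: (ler_cvg_to c1 c2); apply: nearW => n.
  apply: (le_trans (sqr_sum_le_rnorm (u m - u n) N)).
  by rewrite ler_sqr ?nnegrE ?rnorm_ge0 ?addr_ge0.
have inv0 m : 0 <= m.+1%:R^-1 :> R by rewrite invr_ge0.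
(* The difference between [u 0] and the coordinatewise limit is square-summable by [tail 0], so the
   limit itself is represented by [u 0 - v]. *)
pose v : sqr_summable := @LOrlicz _ _ _ (fun k => u 0 k - l k) (sqr_summableP (inv0 0) (tail 0)).
exists (u 0 - v) => m; apply: rnorm_le_of_sqr_sum => // N.
apply: le_trans (tail m N); rewrite le_eqVlt; apply/orP; left; apply/eqP.
apply: eq_bigr => k _; congr (modulus _ ^+ 2).
have -> : (u m - (u 0 - v)) k = u m k - (u 0 k - (u 0 k - l k)) by [].
by congr (_ - _); exact: subKr.
Qed.

HB.instance Definition _ := Uniform_isComplete.Build sqr_summable sqr_summable_complete.

Definition dot_partial (x y : sqr_summable) n : K := \sum_(k < n) x k * scalar_conj (y k).

Lemma sqr_sum_cvg (x : sqr_summable) : cvgn (fun n => \sum_(k < n) modulus (x k) ^+ 2).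
Proof.
apply: nondecreasing_is_cvgn; last first.
  by exists (rnorm x ^+ 2) => _ [n _ <-]; exact: sqr_sum_le_rnorm.
by apply/nondecreasing_seqP => n; rewrite big_ord_recr/= lerDl sqr_ge0.
Qed.

(** The terms are dominated by |x k|^2 + |y k|^2, whose partial sums converge, so the partial inner
    products are Cauchy. *)
Lemma dot_partial_cvg x y : exists l, scalar_cvg (dot_partial x y) l.
Proof.
apply: scalar_cauchy_cvg => e e0.
pose A n := \sum_(k < n) (modulus (x k) ^+ 2 + modulus (y k) ^+ 2).
have /cvgrPdist_le h : cvgn A.
  rewrite (_ : A = (fun n => \sum_(k < n) modulus (x k) ^+ 2) +
    (fun n => \sum_(k < n) modulus (y k) ^+ 2)).
    by apply: is_cvgD; exact: sqr_sum_cvg.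
  by apply/funext => n; rewrite /A big_split.
have [N _ hN] := h _ (divr_gt0 e0 (ltr0n _ 2)).
exists N.
have key m n : (N <= m)%N -> (m <= n)%N -> modulus (dot_partial x y m - dot_partial x y n) <= e.
  move=> Nm mn; have Nn := leq_trans Nm mn.
  rewrite modulusBC /dot_partial -!(big_mkord xpredT (fun k => x k * scalar_conj (y k))).
  rewrite (big_cat_nat (leq0n m) mn)/= addrAC subrr add0r.
  apply: (le_trans (modulus_sum _ _ _)).
  apply: (@le_trans _ _ (\sum_(m <= k < n) (modulus (x k) ^+ 2 + modulus (y k) ^+ 2))).
    apply: ler_sum => k _; rewrite modulusM modulus_conj.
    have := modulus_ge0 (x k); have := modulus_ge0 (y k); nra.
  have := hN _ Nm; have := hN _ Nn; rewrite /= /A.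
  set L := limn _; rewrite -!(big_mkord xpredT (fun k => modulus (x k) ^+ 2 + modulus (y k) ^+ 2)).
  rewrite (big_cat_nat (leq0n m) mn)/= !ler_norml; lra.
move=> m n Nm Nn; have [mn|/ltnW nm] := leqP m n; first exact: key.
by rewrite modulusBC; exact: key.
Qed.

Definition sqr_dot (x y : sqr_summable) : K := projT1 (cid (dot_partial_cvg x y)).

Lemma sqr_dot_cvg x y : scalar_cvg (dot_partial x y) (sqr_dot x y).
Proof. exact: projT2 (cid (dot_partial_cvg x y)). Qed.

Lemma sqr_dotE x y l : scalar_cvg (dot_partial x y) l -> sqr_dot x y = l.
Proof. exact: scalar_cvg_unique (sqr_dot_cvg x y). Qed.

Lemma sqr_dotPl (z : sqr_summable) a (x y : sqr_summable) : sqr_dot (a *: x + y) z = a * sqr_dot x z + sqr_dot y z.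
Proof.
apply: sqr_dotE; have := scalar_cvgD (scalar_cvgM a (sqr_dot_cvg x z)) (sqr_dot_cvg y z).
congr (scalar_cvg _ _); apply/funext => n; rewrite /dot_partial mulr_sumr -big_split/=.
apply: eq_bigr => k _; transitivity ((a * x k + y k) * scalar_conj (z k)); last by [].
by rewrite mulrDl mulrA.
Qed.

Lemma sqr_dotC x y : sqr_dot x y = (-1) ^+ false * scalar_conj (sqr_dot y x).
Proof.
rewrite mul1r; apply: sqr_dotE; have := scalar_cvg_conj (sqr_dot_cvg y x).
congr (scalar_cvg _ _); apply/funext => n; rewrite /dot_partial.
rewrite (big_morph _ (@scalar_conjD R s) (@scalar_conj0 R s)).
by apply: eq_bigr => k _; rewrite scalar_conjM scalar_conjK mulrC.
Qed.

Lemma sqr_dot_rnorm x : sqr_dot x x = of_real s (rnorm x ^+ 2).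
Proof.
pose A n := \sum_(k < n) modulus (x k) ^+ 2.
have cA : cvgn A := @sqr_sum_cvg x.
have -> : sqr_dot x x = of_real s (limn A).
  apply: sqr_dotE; have := scalar_cvg_of_real s cA.
  congr (scalar_cvg _ _); apply/funext => n; rewrite of_real_sum.
  by apply: eq_bigr => k _; rewrite mul_scalar_conj.
congr (of_real s _); apply/eqP; rewrite eq_le; apply/andP; split.
  by apply: limr_le => //; apply: nearW => n; exact: sqr_sum_le_rnorm.
have AL n : A n <= limn A.
  apply: nondecreasing_cvgn_le => //.
  by apply/nondecreasing_seqP => m; rewrite /A big_ord_recr/= lerDl sqr_ge0.
have L0 : 0 <= limn A by apply: le_trans (AL 0); rewrite /A big_ord0.
rewrite -[leRHS]sqr_sqrtr// ler_sqr ?nnegrE ?rnorm_ge0 ?sqrtr_ge0//.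
by apply: rnorm_le_of_sqr_sum; rewrite ?sqrtr_ge0// => n; rewrite sqr_sqrtr//; exact: AL.
Qed.

Lemma sqr_dotPr (z : sqr_summable) a (x y : sqr_summable) :
  sqr_dot z (a *: x + y) = scalar_conj a * sqr_dot z x + sqr_dot z y.
Proof.
rewrite sqr_dotC sqr_dotPl mul1r scalar_conjD scalar_conjM.
by rewrite (sqr_dotC z x) (sqr_dotC z y) !mul1r.
Qed.

Lemma sqr_dot_zmodl z : zmod_morphism (sqr_dot^~ z).
Proof. by move=> x y; rewrite addrC -scaleN1r sqr_dotPl mulN1r addrC. Qed.

Lemma sqr_dot_zmodr z : zmod_morphism (sqr_dot z).
Proof.
move=> x y; rewrite addrC -scaleN1r sqr_dotPr scalar_conjN.
by rewrite -(of_real1 R s) scalar_conj_of_real of_real1 mulN1r addrC.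
Qed.

Lemma sqr_dot0 z : sqr_dot 0 z = 0.
Proof. by have := sqr_dot_zmodl z 0 0; rewrite /= subr0 subrr. Qed.

Lemma sqr_dot_scalel z : scalable_for *%R (sqr_dot^~ z).
Proof. by move=> a x; rewrite -[a *: x]addr0 sqr_dotPl sqr_dot0 addr0. Qed.

Lemma sqr_dot_scaler z : scalable_for (@scalar_conj R s \; *%R) (sqr_dot z).
Proof.
by move=> a x; rewrite -[a *: x]addr0 sqr_dotPr (sqr_dotC z 0) sqr_dot0 scalar_conj0 mulr0 addr0.
Qed.

HB.instance Definition _ := isBilinear.Build K sqr_summable sqr_summable K
  *%R (@scalar_conj R s \; *%R) sqr_dot
  sqr_dot_zmodl sqr_dot_zmodr sqr_dot_scalel sqr_dot_scaler.

HB.instance Definition _ := isHermitianSesquilinear.Build K sqr_summable false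
  (@scalar_conj R s) sqr_dot sqr_dotC.

Lemma sqr_dot_gt0 x : x != 0 -> 0 < sqr_dot x x.
Proof. by move=> x0; rewrite sqr_dot_rnorm -(of_real0 R s) of_real_lt exprn_gt0// rnorm_gt0. Qed.

HB.instance Definition _ := isDotProduct.Build K sqr_summable sqr_dot sqr_dot_gt0.

Lemma sqr_summable_hilbert : is_hilbert sqr_summable.
Proof.
exists sqr_dot => x; rewrite -of_real_rnorm /= sqr_dot_rnorm.
by rewrite !expr2 of_realM.
Qed.

End SquareSummable.

Section Subspaces.
Variables (R : realType) (s : scalars).
Local Notation K := (scalar_field R s).

Lemma closure_rnormP (V : normedModType K) (X : set V) (x : V) :
  closure X x <-> forall e : R, 0 < e -> exists2 y, X y & rnorm (x - y) < e.
Proof.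
split=> [cX e e0|h B /nbhs_normP[/= e e0 eB]].
  have [|y [Xy /=]] := cX [set y | rnorm (x - y) < e]; last by exists y.
  apply/nbhs_normP; exists (of_real s e); first by rewrite /= -(of_real0 R s) of_real_lt.
  by move=> y /=; rewrite norm_lt_rnorm.
have [eE me0] := of_real_norm_gt0 e0; have [y Xy xy] := h _ me0.
by exists y; split => //; apply: eB; rewrite /= -eE norm_lt_rnorm.
Qed.

Lemma linear_span_subspace (V : lmodType K) (A : set V) : linear_subspace (linear_span A).
Proof.
split; first by exists 0, (fun=> 0), (fun=> 0); split; [case|rewrite big_ord0].
move=> a _ _ [m [c [u [Au ->]]]] [n [d [v [Av ->]]]].
exists (m + n)%N, (fun i => match fintype.split i with inl j => a * c j | inr j => d j end),
  (fun i => match fintype.split i with inl j => u j | inr j => v j end); split.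
  by move=> i; case: fintype.split.
rewrite big_split_ord/= scaler_sumr; congr (_ + _); apply: eq_bigr => i _.
  by rewrite (unsplitK (inl i)) scalerA.
by rewrite (unsplitK (inr i)).
Qed.

Lemma closure_subspace (V : normedModType K) (X : set V) :
  linear_subspace X -> linear_subspace (closure X).
Proof.
move=> [X0 XL]; split; first exact: subset_closure.
move=> a x y /closure_rnormP hx /closure_rnormP hy; apply/closure_rnormP => e e0.
have a1 : 0 < modulus a + 1 by rewrite ltr_wpDl ?modulus_ge0.
have [x' Xx' hx'] := hx (e / 2 / (modulus a + 1)) (divr_gt0 (divr_gt0 e0 (ltr0n _ 2)) a1).
have [y' Xy' hy'] := hy (e / 2) (divr_gt0 e0 (ltr0n _ 2)).
exists (a *: x' + y'); first exact: XL.
rewrite opprD addrACA -scalerBr; apply: le_lt_trans (rnormD _ _) _.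
rewrite rnormZ [e]splitr ler_ltD//; apply: (@le_trans _ _ ((modulus a + 1) * rnorm (x - x'))).
  by rewrite ler_wpM2r ?rnorm_ge0// lerDl.
by rewrite mulrC -ler_pdivlMr// ltW.
Qed.

Lemma horlicz_subspace (M : orlicz_function R) : closed_subspace (horlicz s M).
Proof.
split; last exact: closed_closure.
by apply: closure_subspace; exact: linear_span_subspace.
Qed.

Lemma lorlicz_sumE (M : orlicz_function R) I (r : seq I) (P : pred I)
    (F : I -> lorlicz s M) k :
  (\sum_(i <- r | P i) F i) k = \sum_(i <- r | P i) (F i k : K).
Proof. by apply: (big_morph (fun x : lorlicz s M => x k : K)). Qed.

Lemma sum_unit_vectorE (M : orlicz_function R) (y : nat -> K) N k :
  (\sum_(i < N) y i *: unit_vector s M i) k = (if (k < N)%N then y k else 0) :> K.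
Proof.
rewrite lorlicz_sumE (eq_bigr (fun i : 'I_N => y i * (k == i)%:R))//.
case: ifP => kN; last first.
  by rewrite big1// => i _; rewrite gtn_eqF ?mulr0// (leq_trans (ltn_ord i))// leqNgt kN.
rewrite (bigD1 (Ordinal kN))//= eqxx mulr1 big1 ?addr0// => i ik.
by rewrite (_ : (k == i) = false) ?mulr0//; apply/negbTE; apply: contraNneq ik => ki; apply/eqP/val_inj.
Qed.

Lemma sum_unit_vector_horlicz (M : orlicz_function R) (y : nat -> K) N :
  horlicz s M (\sum_(i < N) y i *: unit_vector s M i).
Proof.
apply: subset_closure; exists N, (fun i => y i), (fun i => unit_vector s M i).
by split => // i; exists (nat_of_ord i).
Qed.

End Subspaces.

(** * Orlicz functions equivalent to the square near zero *)

Section EquivalentToSquare.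
Variables (R : realType) (s : scalars) (M : orlicz_function R) (c C : R).
Local Notation K := (scalar_field R s).
Hypothesis c0 : 0 < c.
Hypothesis cM : forall t, 0 <= t <= 1 -> c * t ^+ 2 <= M t.
Hypothesis MC : forall t, 0 <= t <= 1 -> M t <= C * t ^+ 2.

(** The terms of an admissible sum satisfy M t <= 1 but may have t > 1. Since M tends to infinity
    they are bounded by some B, and on [1, B] monotonicity gives the constant M(1) / B^2. *)
Lemma sqr_le_orlicz : exists2 c' : R, 0 < c' &
  forall t, 0 <= t -> M t <= 1 -> c' * t ^+ 2 <= M t.
Proof.
have M1 : 0 < M 1 by have := @cM 1; rewrite ler01 lexx expr1n mulr1 => /(_ isT); exact: lt_le_trans.
have [A [_ MA]] : \forall t \near +oo, 1 < M t.
  by move/cvgryPgt: (orlicz_cvgy M); apply.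
pose B := `|A| + 1; have B0 : 0 < B by rewrite ltr_wpDl.
exists (Num.min c (M 1 / B ^+ 2)); first by rewrite lt_min c0 divr_gt0// exprn_gt0.
move=> t t0 Mt; have [t1|t1] := leP t 1.
  apply: (le_trans _ (cM _)); last by rewrite t0.
  by rewrite ler_wpM2r ?sqr_ge0// ge_min lexx.
have tB : t <= B.
  rewrite leNgt; apply/negP => Bt; have : 1 < M t.
    by apply: MA; apply: lt_trans Bt; rewrite (le_lt_trans (ler_norm A))// ltrDl.
  by rewrite ltNge Mt.
apply: (@le_trans _ _ (M 1)); last by apply: orlicz_le => //; exact: ltW.
apply: (@le_trans _ _ (M 1 / B ^+ 2 * t ^+ 2)).
  by rewrite ler_wpM2r ?sqr_ge0// ge_min lexx orbT.
rewrite mulrAC ler_pdivrMr ?exprn_gt0// ler_pM2l// ler_sqr ?nnegrE//; exact: ltW.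
Qed.

Lemma sqr_sum_le_orlicz_rnorm : exists2 A : R, 0 < A & forall (x : lorlicz s M) N,
  \sum_(k < N) modulus (x k) ^+ 2 <= (A * rnorm x) ^+ 2.
Proof.
have [c' c'0 hc'] := sqr_le_orlicz.
(* Any [A] with c' A^2 >= 1 would do; this one avoids a square root. *)
pose A := 1 + c'^-1; have ci : 0 < c'^-1 by rewrite invr_gt0.
have A0 : 0 < A by rewrite addr_gt0.
exists A => // x N; set S := \sum_(k < N) _.
have S0 : 0 <= S by apply: sumr_ge0 => *; exact: sqr_ge0.
rewrite leNgt; apply/negP => h.
have : fine (lux_norm M x) < Num.sqrt S / A.
  rewrite -rnorm_lorlicz ltr_pdivlMr// mulrC.
  by rewrite -ltr_sqr ?nnegrE ?mulr_ge0 ?rnorm_ge0 ?sqrtr_ge0 ?(ltW A0)// sqr_sqrtr.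
move=> /(lux_norm_lt (lorlicz_lty x))[r rad rS].
have [r0 _] := rad.
have := (lux_admissibleP _ _ r0).1 rad N.
apply/negP; rewrite -ltNge; rewrite ltr_pdivlMr// in rS.
have hS : (r * A) ^+ 2 < S.
  by rewrite -[ltRHS]sqr_sqrtr// ltr_sqr ?nnegrE ?sqrtr_ge0// mulr_ge0// ltW.
apply: (@lt_le_trans _ _ (c' / r ^+ 2 * S)).
  rewrite mulrAC ltr_pdivlMr ?exprn_gt0// mul1r mulrC -ltr_pdivrMr//.
  apply: le_lt_trans hS; rewrite exprMn ler_pM2l ?exprn_gt0//.
  rewrite /A; nra.
rewrite mulr_sumr ler_sum// => k _.
apply: le_trans (hc' _ _ (lux_admissible_le k rad)); last first.
  by rewrite divr_ge0 ?modulus_ge0// ltW.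
by rewrite le_eqVlt; apply/orP; left; apply/eqP; rewrite exprMn exprVn; ring.
Qed.

(** The factor 1 + |C| puts all quotients into [0,1], where M t <= C t^2, and its square absorbs
    |C|; [e] keeps the radius positive when B = 0. *)
Lemma orlicz_admissible_of_sqr (x : nat -> K^o) (B e : R) : 0 <= B -> 0 < e ->
  (forall N, \sum_(k < N) modulus (x k) ^+ 2 <= B ^+ 2) ->
  lux_admissible M x ((1 + `|C|) * (B + e)).
Proof.
move=> B0 e0 h; set r := _ * _.
have Be : 0 < B + e by rewrite ltr_wpDl.
have C1 : 0 < 1 + `|C| by rewrite ltr_pwDl.
have r0 : 0 < r by rewrite mulr_gt0.
apply/(lux_admissibleP _ _ r0) => N.
have xB k : modulus (x k) <= B.
  rewrite -ler_sqr ?nnegrE ?modulus_ge0//; apply: le_trans (h k.+1).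
  by rewrite big_ord_recr/= lerDr sumr_ge0// => *; exact: sqr_ge0.
have Br : B <= r.
  rewrite /r mulrDl mul1r; have : 0 <= `|C| * (B + e) by rewrite mulr_ge0// ltW.
  lra.
apply: (@le_trans _ _ (\sum_(k < N) `|C| / r ^+ 2 * modulus (x k) ^+ 2)).
  apply: ler_sum => k _; apply: le_trans (MC _) _.
    rewrite divr_ge0 ?modulus_ge0 ?(ltW r0)//= ler_pdivrMr// mul1r.
    exact: le_trans (xB k) Br.
  rewrite [leRHS](_ : _ = `|C| * (modulus (x k) / r) ^+ 2).
    by rewrite ler_wpM2r ?sqr_ge0// ler_norm.
  by rewrite [in RHS]exprMn [in RHS]exprVn; ring.
rewrite -mulr_sumr; apply: (le_trans (ler_wpM2l _ (h N))).
  by rewrite divr_ge0 ?sqr_ge0.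
rewrite mulrAC ler_pdivrMr ?exprn_gt0// mul1r /r exprMn.
apply: ler_pM => //; rewrite ?sqr_ge0//.
  have := normr_ge0 C; nra.
by rewrite ler_sqr ?nnegrE// ?lerDl ltW.
Qed.

(** Both maps are the identity on sequences, since the two bounds make the norms of h_M and l_2
    equivalent. The contrapositive is what matters: if h_M is not Hilbertian, M deviates from t^2 by
    arbitrarily large factors on (0,1]. *)
Lemma hilbertian_of_equivalent_to_square : hilbertian (horlicz s M).
Proof.
have [A A0 hA] := sqr_sum_le_orlicz_rnorm.
have C1 : 0 < 1 + `|C| by rewrite ltr_pwDl.
have AN x : 0 <= A * rnorm (x : lorlicz s M) by rewrite mulr_ge0 ?rnorm_ge0// ltW.
pose T (x : lorlicz s M) : sqr_summable R s := LOrlicz (sqr_summableP (AN x) (hA x)).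
have inS (y : sqr_summable R s) : (y : nat -> K^o) \in @lorlicz_pred R s M.
  rewrite inE; apply/lux_norm_ltyP; eexists.
  exact: (orlicz_admissible_of_sqr (rnorm_ge0 y) ltr01 (sqr_sum_le_rnorm y)).
pose S (y : sqr_summable R s) : lorlicz s M := LOrlicz (inS y).
have SB (y : sqr_summable R s) (B : R) : 0 <= B ->
    (forall N, \sum_(k < N) modulus (y k) ^+ 2 <= B ^+ 2) -> rnorm (S y) <= (1 + `|C|) * B.
  move=> B0 h; rewrite -ler_pdivrMl//; apply/ler_addgt0Pr => e e0; rewrite ler_pdivrMl//.
  by rewrite rnorm_lorlicz; apply: lux_norm_le; exact: orlicz_admissible_of_sqr.
have [hsub _] := horlicz_subspace s M.
exists (sqr_summable R s); split; first exact: sqr_summable_hilbert.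
exists T, S; split.
- by move=> a x y _ _; apply: val_inj.
- by [].
(* A square-summable sequence is the l_2 limit of its truncations, and [SB] carries this over to the
   norm of l_M; hence it lies in h_M. *)
- move=> y _; apply/closure_rnormP => e e0.
  have /cvgrPdist_le h := @sqr_sum_cvg R s y.
  pose d := e / 2 / (1 + `|C|).
  have d0 : 0 < d by rewrite !divr_gt0.
  have [|N _ hN] := h (d ^+ 2 / 2); first by rewrite divr_gt0// exprn_gt0.
  pose z := \sum_(i < N) y i *: unit_vector s (sqr_orlicz R) i.
  exists (\sum_(i < N) y i *: unit_vector s M i).
    by exists N, (fun i => y i), (fun i => unit_vector s M i); split => // i; exists (nat_of_ord i).
  have -> : S y - \sum_(i < N) y i *: unit_vector s M i = S (y - z).
    apply: val_inj; apply/funext => k.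
    have -> : val (S y - \sum_(i < N) y i *: unit_vector s M i) k =
      y k - (\sum_(i < N) y i *: unit_vector s M i) k by [].
    have -> : val (S (y - z)) k = y k - z k by [].
    by rewrite /z !sum_unit_vectorE.
  apply: (@le_lt_trans _ _ ((1 + `|C|) * d)); last first.
    by rewrite /d mulrC divfK ?gt_eqF// ltr_pdivrMr// ltr_pMr// ltr1n.
  apply: SB => [|n]; first exact: ltW.
  apply: (@le_trans _ _ (\sum_(k < N + n) modulus (((y - z) : sqr_summable R s) k) ^+ 2)).
    by rewrite addnC big_split_ord/= lerDl sumr_ge0// => *; exact: sqr_ge0.
  rewrite big_split_ord/= big1 ?add0r; last first.
    move=> k _; transitivity (modulus (y k - z k) ^+ 2); first by [].
    by rewrite /z sum_unit_vectorE ltn_ord subrr modulus0 expr0n.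
  rewrite (eq_bigr (fun i : 'I_n => modulus (y (N + i)%N) ^+ 2)); last first.
    move=> k _; transitivity (modulus (y (N + k)%N - z (N + k)%N) ^+ 2); first by [].
    by rewrite /z sum_unit_vectorE ltnNge leq_addr/= subr0.
  have := hN _ (leqnn N); have := hN _ (leq_addr n N) => /=.
  rewrite big_split_ord/= !ler_norml; set L := limn _; lra.
- by move=> x _; apply: val_inj.
- by move=> x _; apply: val_inj.
- apply: (bounded_within_continuous (C := A)) => //.
    by move=> a x y _ _; apply: val_inj.
  by move=> x _; apply: rnorm_le_of_sqr_sum => // N; exact: hA.
- apply: (bounded_within_continuous (C := 1 + `|C|)) => //.
    by move=> a x y _ _; apply: val_inj.
  by move=> y _; apply: SB => [|N]; [exact: rnorm_ge0|exact: sqr_sum_le_rnorm].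
Qed.

End EquivalentToSquare.

(** * Finite-dimensional linear algebra *)

Section Orthonormalization.
Variables (R : realType) (s : scalars).
Local Notation K := (scalar_field R s).

Definition adjmx m n (A : 'M[K]_(m, n)) : 'M[K]_(n, m) := map_mx (@scalar_conj R s) A^T.

Lemma adjmxM m n p (A : 'M[K]_(m, n)) (B : 'M[K]_(n, p)) :
  adjmx (A *m B) = adjmx B *m adjmx A.
Proof.
apply/matrixP => i j; rewrite !mxE (big_morph _ (@scalar_conjD R s) (@scalar_conj0 R s)).
by apply: eq_bigr => k _; rewrite !mxE scalar_conjM mulrC.
Qed.

Lemma adjmxK m n (A : 'M[K]_(m, n)) : adjmx (adjmx A) = A.
Proof. by apply/matrixP => i j; rewrite !mxE scalar_conjK. Qed.

Lemma adjmx0 m n : adjmx (0 : 'M[K]_(m, n)) = 0.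
Proof. by apply/matrixP => i j; rewrite !mxE scalar_conj0. Qed.

Lemma adjmxZ m n (t : R) (A : 'M[K]_(m, n)) : adjmx (of_real s t *: A) = of_real s t *: adjmx A.
Proof. by apply/matrixP => i j; rewrite !mxE scalar_conjM scalar_conj_of_real. Qed.

Lemma adjmx_col m1 m2 n (A : 'M[K]_(m1, n)) (B : 'M[K]_(m2, n)) :
  adjmx (col_mx A B) = row_mx (adjmx A) (adjmx B).
Proof. by rewrite /adjmx tr_col_mx map_row_mx. Qed.

Definition row_sqr n (v : 'rV[K]_n) : R := \sum_i modulus (v 0 i) ^+ 2.

Lemma mul_adjmx n (v : 'rV[K]_n) : v *m adjmx v = (of_real s (row_sqr v))%:M.
Proof.
apply/matrixP => i j; rewrite !ord1 !mxE eqxx mulr1n of_real_sum.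
by apply: eq_bigr => k _; rewrite !mxE mul_scalar_conj.
Qed.

Lemma row_sqr_ge0 n (v : 'rV[K]_n) : 0 <= row_sqr v.
Proof. by apply: sumr_ge0 => *; exact: sqr_ge0. Qed.

Lemma row_sqr_eq0 n (v : 'rV[K]_n) : row_sqr v = 0 -> v = 0.
Proof.
move=> v0; apply/rowP => i; rewrite mxE; apply: modulus_eq0; apply/eqP.
rewrite -sqrf_eq0 eq_le sqr_ge0 andbT -v0 /row_sqr (bigD1 i)//= lerDl.
by rewrite sumr_ge0// => *; exact: sqr_ge0.
Qed.

(** Induction on the rows: once the lower rows are orthonormalised to E', the projection of the top
    row onto their span is subtracted. The difference a' is nonzero by independence. *)
Lemma gram_schmidt n p (A : 'M[K]_(n, p)) : (forall x : 'rV_n, x *m A = 0 -> x = 0) ->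
  exists U : 'M[K]_n, (U *m A) *m adjmx (U *m A) = 1%:M.
Proof.
elim: n => [|n IHn] in A *; first by exists 0; apply/matrixP => -[].
move: A; rewrite -[n.+1]/(1 + n)%N => A A0.
pose a := usubmx A; pose A' := dsubmx A.
have AE : A = col_mx a A' by rewrite vsubmxK.
have [|U' hU'] := IHn A'.
  move=> x xA'; have := A0 (row_mx 0 x).
  rewrite AE mul_row_col mul0mx add0r => /(_ xA')/(congr1 rsubmx).
  by rewrite row_mxKr => ->; apply/rowP => i; rewrite !mxE.
set E' := U' *m A' in hU'.
pose a' := a - a *m adjmx E' *m E'.
have a'E : a' *m adjmx E' = 0.
  by rewrite mulmxBl -[X in _ - X]mulmxA hU' mulmx1 subrr.
have a'0 : a' != 0.
  apply/eqP => a'0; have := A0 (row_mx 1%:M (- (a *m adjmx E' *m U'))).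
  have h0 : row_mx 1%:M (- (a *m adjmx E' *m U')) *m A = 0.
    by rewrite AE mul_row_col mul1mx mulNmx -[X in _ - X]mulmxA.
  move=> /(_ h0)/(congr1 lsubmx).
  rewrite row_mxKl => /matrixP/(_ 0 0)/eqP; rewrite !mxE eqxx oner_eq0//.
pose nu := row_sqr a'.
have nu0 : 0 < nu.
  by rewrite lt_def row_sqr_ge0 andbT; apply: contra_neq a'0 => /row_sqr_eq0.
pose t := (Num.sqrt nu)^-1.
exists (block_mx (of_real s t)%:M (- (of_real s t *: (a *m adjmx E' *m U'))) 0 U').
have a'D : a - a *m adjmx E' *m U' *m A' = a' by rewrite -[X in _ - X]mulmxA.
rewrite AE mul_block_col mul0mx add0r -/E' mul_scalar_mx mulNmx -scalemxAl.
rewrite -scalerBr a'D adjmx_col mul_col_row hU' adjmxZ.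
have E'a : E' *m adjmx a' = 0 by rewrite -(adjmxK E') -adjmxM a'E adjmx0.
rewrite -!scalemxAl -!scalemxAr a'E E'a !scaler0 mul_adjmx -/nu scalerA -of_realM.
rewrite scale_scalar_mx -of_realM -invfM -expr2 sqr_sqrtr ?ltW// mulVf ?gt_eqF//.
by rewrite of_real1 -scalar_mx_block.
Qed.

(** As x A = (x U^-1)(U A) and U A has orthonormal rows, the form given by the p columns of A is the
    squared Euclidean norm in the n coordinates x U^-1. *)
Lemma orthonormal_coordinates n p (A : 'M[K]_(n, p)) :
  (forall x : 'rV_n, x *m A = 0 -> x = 0) ->
  exists2 U : 'M[K]_n, U \in unitmx &
    forall x : 'rV_n, row_sqr (x *m A) = row_sqr (x *m invmx U).
Proof.
move=> /gram_schmidt[U hU]; have [Uu _] := mulmx1_unit (etrans (mulmxA _ _ _) hU).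
exists U => // x; apply: (@of_real_inj R s).
have h (v : 'rV[K]_n) : (v *m adjmx v) 0 0 = of_real s (row_sqr v).
  by rewrite mul_adjmx mxE eqxx.
have h' (v : 'rV[K]_p) : (v *m adjmx v) 0 0 = of_real s (row_sqr v).
  by rewrite mul_adjmx mxE eqxx.
rewrite -h -h'; have -> : x *m A = x *m invmx U *m (U *m A) by rewrite mulmxA mulmxKV.
by rewrite [in LHS]adjmxM -mulmxA (mulmxA (U *m A)) hU mul1mx.
Qed.

Lemma modulus_prod I (r : seq I) (P : pred I) (F : I -> K) :
  modulus (\prod_(i <- r | P i) F i) = \prod_(i <- r | P i) modulus (F i).
Proof. by apply: big_morph; [exact: modulusM|exact: modulus1]. Qed.

Lemma modulus_det_le n (A : 'M[K]_n) (C : R) :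
  (forall i j, modulus (A i j) <= C) -> modulus (\det A) <= n`!%:R * C ^+ n.
Proof.
move=> AC; apply: (le_trans (modulus_sum _ _ _)).
apply: (@le_trans _ _ (\sum_(u : 'S_n) C ^+ n)); last first.
  by rewrite sumr_const card_Sn mulr_natl.
apply: ler_sum => u _; rewrite modulusM.
have -> : modulus ((-1) ^+ u : K) = 1.
  by case: (odd_perm u); rewrite ?expr1 ?expr0 ?modulusN modulus1.
rewrite mul1r modulus_prod -[X in C ^+ X]card_ord -prodr_const.
by apply: ler_prod => i _; rewrite modulus_ge0 AC.
Qed.

(** Cramer's rule: expansion along row l leaves the cofactors of A. *)
Lemma det_replace_row n (A : 'M[K]_n) (a : 'rV[K]_n) (l : 'I_n) : A \in unitmx ->
  \det (\matrix_(i, j) (if i == l then a 0 j else A i j)) = (a *m invmx A) 0 l * \det A.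
Proof.
move=> Au; rewrite (expand_det_row _ l).
have dA : \det A != 0 by move: Au; rewrite unitmxE unitfE.
rewrite /invmx Au -scalemxAr mxE mulrC mulVKf// mxE.
apply: eq_bigr => j _; rewrite !mxE eqxx /cofactor; congr (_ * (_ * \det _)).
by apply/matrixP => i k; rewrite !mxE eq_sym (negbTE (neq_lift l i)).
Qed.

(* Choosing the rows in the "ball" [P] with nearly maximal determinant, every
   element of [P] has coordinates at most 2. *)
Lemma near_auerbach n (P : 'rV[K]_n -> Prop) (C d : R) : 0 < d ->
  (forall a l, P a -> modulus (a 0 l) <= C) ->
  (forall l, P (of_real s d *: delta_mx 0 l)) ->
  exists A : 'M[K]_n, [/\ A \in unitmx, forall l, P (row l A) &
    forall a l, P a -> modulus ((a *m invmx A) 0 l) <= 2].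
Proof.
move=> d0 PC Pd.
pose S := [set modulus (\det A) | A in [set A : 'M[K]_n | forall l, P (row l A)]].
have PD : forall l, P (row l (of_real s d)%:M).
  move=> l; have -> : row l (of_real s d)%:M = of_real s d *: delta_mx 0 l.
    by rewrite -scalemx1 linearZ/= row1.
  exact: Pd.
(* The scaled identity shows that the supremum is positive. *)
have Sd : S (d ^+ n).
  exists (of_real s d)%:M => //.
  rewrite det_scalar -[n in X in X = _]card_ord -prodr_const modulus_prod.
  by rewrite prodr_const card_ord modulus_of_real gtr0_norm.
have Sb : has_sup S.
  split; first by exists (d ^+ n).
  exists (n`!%:R * C ^+ n) => _ [A PA <-]; apply: modulus_det_le => i j.
  by have := PC (row i A) j (PA i); rewrite mxE.
have dS : d ^+ n <= sup S by apply: ub_le_sup => //; case: Sb.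
have S0 : 0 < sup S by apply: lt_le_trans dS; rewrite exprn_gt0.
(* A determinant above half the supremum makes every quotient in Cramer's rule at most 2. *)
have [_ [A PA <-] hA] := sup_adherent (divr_gt0 S0 (ltr0n _ 2)) Sb.
have dA : 0 < modulus (\det A).
  by apply: lt_trans hA; rewrite subr_gt0 ltr_pdivrMr// ltr_pMr// ltr1n.
have Au : A \in unitmx by rewrite unitmxE unitfE -modulus_gt0.
exists A; split => // a l Pa.
pose B := \matrix_(i, j) (if i == l then a 0 j else A i j).
have : modulus (\det B) <= sup S.
  apply: ub_le_sup; first by case: Sb.
  exists B => // i; have [->|il] := eqVneq i l.
    by have -> : row l B = a by apply/rowP => j; rewrite !mxE eqxx.
  by have -> : row i B = row i A by apply/rowP => j; rewrite !mxE (negbTE il).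
rewrite det_replace_row// modulusM => h.
rewrite -(ler_pM2r dA); apply: (le_trans h); lra.
Qed.

End Orthonormalization.

(** * Coordinates and the Banach-Mazur distance to Euclidean space *)

Section Coordinates.
Variables (R : realType) (s : scalars).
Local Notation K := (scalar_field R s).

Definition comb (V : lmodType K) n (b : 'I_n -> V) (a : 'rV[K]_n) : V :=
  \sum_i a 0 i *: b i.

Lemma combP (V : lmodType K) n (b : 'I_n -> V) t (a a' : 'rV[K]_n) :
  comb b (t *: a + a') = t *: comb b a + comb b a'.
Proof.
rewrite /comb scaler_sumr -big_split; apply: eq_bigr => i _.
by rewrite !mxE scalerDl scalerA.
Qed.

Lemma comb_delta (V : lmodType K) n (b : 'I_n -> V) i : comb b (delta_mx 0 i) = b i.
Proof.
rewrite /comb (bigD1 i)//= mxE !eqxx scale1r big1 ?addr0// => j ji.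
by rewrite mxE (negbTE ji) andbF scale0r.
Qed.

Lemma comb_span (V : lmodType K) n (b : 'I_n -> V) x :
  linear_span (range b) x <-> exists a, x = comb b a.
Proof.
split=> [[m [c [v [hv ->]]]]|[a ->]]; last first.
  by exists n, (fun i => a 0 i), b; split => // i; exists i.
have /choice[j hj] : forall i, exists k, b k = v i by move=> i; have [k _ <-] := hv i; exists k.
exists (\sum_i c i *: delta_mx 0 (j i)).
have comb0 : comb b 0 = 0.
  by rewrite /comb big1// => i _; rewrite mxE scale0r.
have combD a a' : comb b (a + a') = comb b a + comb b a'.
  by have := combP b 1 a a'; rewrite !scale1r.
rewrite (big_morph _ combD comb0); apply: eq_bigr => i _.
by rewrite -hj -[c i *: delta_mx 0 _]addr0 combP comb0 addr0 comb_delta.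
Qed.

(** [orthonormal_coordinates] turns the quadratic form into a Euclidean norm; the coordinate map and
    its inverse then have norms at most sqrt(1 + k) and 1 / sqrt(1 - k). *)
Lemma bm_distance_le (V : normedModType K) n p (b : 'I_n -> V) (A : 'M[K]_(n, p)) (k D : R) :
  (forall a, comb b a = 0 -> a = 0) -> 0 < k < 1 -> 0 <= D -> (1 + k) / (1 - k) <= D ^+ 2 ->
  (forall a, (1 - k) * rnorm (comb b a) ^+ 2 <= row_sqr (a *m A) <=
    (1 + k) * rnorm (comb b a) ^+ 2) ->
  (bm_distance (linear_span (range b)) [set: euclid R s n] <= D%:E)%E.
Proof.
move=> b0 /andP[k0 k1] D0 kD hA; set E := linear_span _.
have [Esub EE] : linear_subspace E /\ forall a, E (comb b a).
  split; last by move=> a; apply/comb_span; exists a.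
  have cb : forall a, E (comb b a) by move=> a; apply/comb_span; exists a.
  split; first by exists 0, (fun=> 0), (fun=> 0); split; [case|rewrite big_ord0].
  by move=> t x y /comb_span[a ->] /comb_span[a' ->]; rewrite -combP.
have k1' : 0 < 1 - k by rewrite subr_gt0.
have kp : 0 < 1 + k by rewrite addr_gt0.
have [|U Uu hU] := @orthonormal_coordinates R s n p A.
  move=> x xA; apply: b0; apply: rnorm_eq0; apply/eqP; rewrite -sqrf_eq0 eq_le sqr_ge0 andbT.
  have := hA x; rewrite xA; case/andP => + _.
  rewrite (_ : row_sqr 0 = 0); first by rewrite pmulr_rle0.
  by rewrite /row_sqr big1// => i _; rewrite mxE modulus0 expr0n.
have combI a a' : comb b a = comb b a' -> a = a'.
  move=> h; apply/eqP; rewrite -subr_eq0; apply/eqP/b0.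
  by rewrite addrC -scaleN1r combP h scaleN1r addNr.
have /choice[coef hcoef] : forall x, exists a, E x -> x = comb b a.
  move=> x; have [[a ->]|nx] := pselect (exists a, x = comb b a); first by exists a.
  by exists 0 => /comb_span.
have coefK a : coef (comb b a) = a by apply/esym/combI/hcoef.
pose T (x : V) : euclid R s n := coef x *m invmx U.
pose S (v : euclid R s n) : V := comb b ((v : 'rV[K]_n) *m U).
have TL : linear_on E T.
  move=> t x y /comb_span[a ->] /comb_span[a' ->].
  by rewrite /T -combP !coefK mulmxDl scalemxAl.
have SL : linear_on [set: euclid R s n] S.
  by move=> t x y _ _; rewrite /S -combP mulmxDl scalemxAl.
have ST x : E x -> S (T x) = x.
  by move=> /comb_span[a ->]; rewrite /S /T coefK mulmxKV.
have TS x : T (S x) = x by rewrite /S /T coefK mulmxK.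
have rT x : E x -> rnorm (T x) ^+ 2 = row_sqr (coef x *m A).
  by move=> _; rewrite rnorm_euclid hU sqr_sqrtr// row_sqr_ge0.
have TB x : E x -> rnorm (T x) <= Num.sqrt (1 + k) * rnorm x.
  move=> Ex; rewrite -ler_sqr ?nnegrE ?mulr_ge0 ?rnorm_ge0 ?sqrtr_ge0//.
  rewrite rT// exprMn sqr_sqrtr ?(ltW kp)// {2}(hcoef x Ex).
  by case/andP: (hA (coef x)).
have SB v : rnorm (S v) <= (Num.sqrt (1 - k))^-1 * rnorm v.
  have ES : E (S v) by exact: EE.
  rewrite -{2}(TS v) -ler_pdivrMl ?invr_gt0 ?sqrtr_gt0// invrK.
  rewrite -ler_sqr ?nnegrE ?mulr_ge0 ?rnorm_ge0 ?sqrtr_ge0//.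
  rewrite rT// exprMn sqr_sqrtr ?(ltW k1')// {1}(hcoef _ ES).
  by case/andP: (hA (coef (S v))).
have TSiso : isomorphism E [set: euclid R s n] T S.
  split => //.
  - by move=> v _; exact: EE.
  - by move=> x; rewrite inE => Ex; exact: ST.
  - exact: (bounded_within_continuous (C := Num.sqrt (1 + k))).
  - exact: (bounded_within_continuous (C := (Num.sqrt (1 - k))^-1)).
have opT : (opnorm E T <= (Num.sqrt (1 + k))%:E)%E.
  apply/ereal_supP => _ [x [Ex x1] <-]; rewrite lee_fin; apply: (le_trans (TB x Ex)).
  by rewrite ler_piMr// sqrtr_ge0.
have opS : (opnorm [set: euclid R s n] S <= ((Num.sqrt (1 - k))^-1)%:E)%E.
  apply/ereal_supP => _ [x [_ x1] <-]; rewrite lee_fin; apply: (le_trans (SB x)).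
  by rewrite ler_piMr// invr_ge0 sqrtr_ge0.
apply: (@le_trans _ _ (opnorm E T * opnorm [set: euclid R s n] S)%E).
  by apply: ereal_inf_lbound; exists (T, S).
apply: (@le_trans _ _ ((Num.sqrt (1 + k))%:E * ((Num.sqrt (1 - k))^-1)%:E)%E).
  apply: lee_pmul => //; apply: ereal_sup_ubound; exists 0; rewrite ?rnorm0//.
  - by split; [case: Esub|rewrite rnorm0].
  - by rewrite -(scale0r 0) (linear_onZ _ Esub TL) ?scale0r ?rnorm0//; case: Esub.
  - by split => //; rewrite rnorm0.
  - by rewrite (_ : S 0 = 0) ?rnorm0// /S mul0mx /comb big1// => i _; rewrite mxE scale0r.
rewrite -EFinM lee_fin -ler_sqr ?nnegrE ?mulr_ge0 ?invr_ge0 ?sqrtr_ge0//.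
by rewrite exprMn exprVn !sqr_sqrtr// ltW.
Qed.

End Coordinates.

(** * Subspaces spanned by blocks *)

Lemma nat_pairing : exists (f : nat * nat -> nat) (g : nat -> nat * nat),
  cancel f g /\ cancel g f.
Proof.
have [f [_ fi fs]] := elimT card_set_bijP card_nat2.
have /choice[g hg] : forall n, exists x, f x = n.
  by move=> n; have [x _ <-] := fs n I; exists x.
exists f, g; split => // x; apply: fi; rewrite ?inE//; exact: hg.
Qed.

Section PairSeries.
Variables (R : realType) (f : nat * nat -> nat) (g : nat -> nat * nat).
Hypotheses (fK : cancel f g) (gK : cancel g f).
Local Open Scope ereal_scope.

Lemma nneseries_pairing (a : nat -> \bar R) : (forall n, 0 <= a n) ->
  \sum_(0 <= n <oo) a n = \sum_(0 <= i <oo) \sum_(0 <= k <oo) a (f (i, k)).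
Proof.
move=> a0; rewrite nneseries_esumT//.
rewrite (@reindex_esum _ _ _ [set: nat * nat] _ f); last first.
  split => //; first by move=> x y _ _ /(congr1 g); rewrite !fK.
  by move=> n _; exists (g n).
rewrite nneseries_esumT; last by move=> i; exact: nneseries_ge0.
under [RHS]eq_esum do rewrite nneseries_esumT//.
rewrite esum_esum//; have -> : setT `*`` (fun=> setT) = [set: nat * nat].
  by apply/seteqP; split.
by apply: eq_esum => -[i k] _.
Qed.

Lemma nneseries_finite (a : nat -> \bar R) (N : nat) : (forall n, 0 <= a n) ->
  (forall n, (N <= n)%N -> a n = 0) -> \sum_(0 <= n <oo) a n = \sum_(0 <= n < N) a n.
Proof.
move=> a0 aN; rewrite (nneseries_split 0 N)//.
by rewrite add0n eseries0 ?adde0// => i Ni _; exact: aN.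
Qed.

End PairSeries.

Section BlockSubspace.
Variables (R : realType) (s : scalars) (M : orlicz_function R).
Variables (f : nat * nat -> nat) (g : nat -> nat * nat).
Hypotheses (fK : cancel f g) (gK : cancel g f).
Variable L : nat -> seq R.
Hypothesis L01 : forall i c, c \in L i -> 0 <= c <= 1.
Hypothesis L1 : forall i, L i = [::] \/ head 0 (L i) = 1.
Local Notation K := (scalar_field R s).
Implicit Types x : lorlicz s M.

Lemma block_coef_ge0 i k : 0 <= nth 0 (L i) k.
Proof.
have [ki|ki] := ltnP k (size (L i)); last by rewrite nth_default.
by case/andP: (L01 (mem_nth 0 ki)).
Qed.

Lemma block_ge0 i c : c \in L i -> 0 <= c.
Proof. by move=> /L01/andP[]. Qed.

(** A nonempty [L i] begins with 1, so for vectors of the subspace below the value at place 0 is the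
    factor multiplying the whole block. *)
Definition block_coord x (i : nat) : K := x (f (i, 0)).

(* Coordinate [f (i, k)] is the [k]-th place of the [i]-th block; the
   subspace consists of the vectors proportional to [L i] on every block. *)
Definition block_subspace : set (lorlicz s M) :=
  [set x | horlicz s M x /\
    forall i k, x (f (i, k)) = of_real s (nth 0 (L i) k) * block_coord x i].

(** Every term of an admissible sum is at most 1 and M tends to infinity, so the coordinate
    functionals are uniformly bounded. Hence subspaces cut out by coordinate conditions are
    closed. *)
Lemma orlicz_coord_bound : exists2 B : R, 0 < B & forall x p, modulus (x p) <= B * rnorm x.
Proof.
have [A [_ MA]] : \forall t \near +oo, 1 < M t.
  by move/cvgryPgt: (orlicz_cvgy M); apply.
pose B := `|A| + 1; have B0 : 0 < B by rewrite ltr_wpDl.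
exists B => // x p; apply/ler_addgt0Pr => e e0.
have [|r rad rlt] := @lux_norm_lt _ _ M x (rnorm x + e / B) (lorlicz_lty x).
  by rewrite -rnorm_lorlicz ltrDl divr_gt0.
have [r0 _] := rad; have h := lux_admissible_le p rad.
have {}h : modulus (x p) / r <= B.
  rewrite leNgt; apply/negP => Bx; move: h; rewrite leNgt => /negP; apply.
  by apply: MA; apply: lt_trans Bx; rewrite (le_lt_trans (ler_norm A))// ltrDl.
rewrite ler_pdivrMr// in h; apply: (le_trans h).
apply: (@le_trans _ _ (B * (rnorm x + e / B))); first by rewrite ler_pM2l// ltW.
by rewrite mulrDr mulrCA divff ?gt_eqF// mulr1.
Qed.

Lemma block_subspace_closed : closed_subspace block_subspace.
Proof.
have [[h0 hL] hc] := horlicz_subspace s M; split.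
  split; first by split => // i k; rewrite /= mulr0.
  move=> a x y [hx hx'] [hy hy']; split; first exact: hL.
  move=> i k; have E n : (a *: x + y) n = a * x n + y n by [].
  by rewrite !E hx' hy' mulrDr mulrCA.
move=> x /closure_rnormP cx; split.
  by apply: hc; apply/closure_rnormP => e /cx[y [hy _] xy]; exists y.
move=> i k; have [B B0 hB] := orlicz_coord_bound.
set c := nth 0 (L i) k; have c0 : 0 <= c := block_coef_ge0 i k.
apply/eqP; rewrite -subr_eq0; apply/eqP/modulus_eq0/eqP.
rewrite eq_le modulus_ge0 andbT; apply/ler_addgt0Pr => e e0; rewrite add0r.
have Bc : 0 < B * (1 + c) by rewrite mulr_gt0// ltr_pwDl.
have [y [_ hy] xy] := cx (e / (B * (1 + c))) (divr_gt0 e0 Bc).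
have h1 := hB (x - y) (f (i, k)); have h2 : modulus (block_coord (x - y) i) <= B * rnorm (x - y) by exact: hB.
have -> : x (f (i, k)) - of_real s c * block_coord x i =
    (x - y) (f (i, k)) - of_real s c * block_coord (x - y) i.
  have E n : (x - y) n = x n - y n by [].
  by rewrite /block_coord !E hy mulrBr opprB addrA subrK.
apply: (le_trans (modulusD _ _)); rewrite modulusN modulusM modulus_of_real ger0_norm//.
apply: (@le_trans _ _ (B * (1 + c) * rnorm (x - y))).
  rewrite mulrDr mulr1 mulrDl lerD// mulrAC [leRHS]mulrC ler_wpM2l//.
by rewrite mulrC -ler_pdivlMr// ltW.
Qed.

Lemma block_lux_series x (r : R) : block_subspace x -> 0 < r ->
  (\sum_(0 <= n <oo) (M (modulus (x n) / r))%:E =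
   \sum_(0 <= i <oo) (block_fun M (L i) (modulus (block_coord x i) / r))%:E)%E.
Proof.
move=> [_ hx] r0.
have a0 y : (0 <= (M (modulus (y : K) / r))%:E)%E.
  by rewrite lee_fin orlicz_ge0// divr_ge0 ?modulus_ge0 ?ltW.
rewrite (nneseries_pairing fK gK) => [|n]; last exact: a0.
apply: eq_eseriesr => i _.
rewrite (@nneseries_finite _ _ (size (L i))).
- rewrite sumEFin /block_fun [in RHS](big_nth 0); congr (_%:E).
  apply: eq_bigr => k _; rewrite hx modulusM modulus_of_real.
  by rewrite ger0_norm ?block_coef_ge0// mulrA.
- by move=> n; exact: a0.
- by move=> k Lk; rewrite hx nth_default// of_real0 mul0r modulus0 mul0r orlicz0.
Qed.

(** The series is regrouped by blocks. Through this criterion the norm on the subspace depends only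
    on the block coordinates and the functions [block_fun M (L i)]. *)
Lemma block_admissibleP x (r : R) : block_subspace x -> 0 < r ->
  lux_admissible M x r <->
  forall I, \sum_(i < I) block_fun M (L i) (modulus (block_coord x i) / r) <= 1.
Proof.
move=> Xx r0; have a0 i : 0 <= block_fun M (L i) (modulus (block_coord x i) / r).
  apply: block_fun_ge0; first exact: block_ge0.
  by rewrite divr_ge0 ?modulus_ge0 ?ltW.
rewrite /lux_admissible block_lux_series//; split=> [[_ /(nneseries_leP _ a0)]//|h].
by split => //; apply/(nneseries_leP _ a0).
Qed.

Lemma block_vector (y : nat -> K) (I : nat) : (forall i, (I <= i)%N -> y i = 0) ->
  exists2 x, block_subspace x &
    forall i k, x (f (i, k)) = of_real s (nth 0 (L i) k) * y i.
Proof.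
move=> yI; pose z n : K := of_real s (nth 0 (L (g n).1) (g n).2) * y (g n).1.
(* All positions f(i, k) with i < I and k below the length of [L i] lie below [N], so the vector is
   finitely supported. *)
pose N := (\max_(i < I) \max_(k < size (L i)) f (i : nat, k : nat)).+1.
have zN n : (N <= n)%N -> z n = 0.
  move=> Nn; rewrite /z; case E : (g n) => [i k] /=.
  have [Ii|iI] := leqP I i; first by rewrite yI// mulr0.
  have [kL|Lk] := ltnP k (size (L i)); last by rewrite nth_default// of_real0 mul0r.
  suff : (n < N)%N by rewrite ltnNge Nn.
  rewrite ltnS -(gK n) E.
  apply: leq_trans (leq_bigmax (Ordinal iI)) => /=.
  exact: (leq_bigmax (Ordinal kL)).
exists (\sum_(n < N) z n *: unit_vector s M n); last first.
  move=> i k; rewrite sum_unit_vectorE; case: ltnP => [_|/zN zf].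
    by rewrite /z fK.
  by rewrite -zf /z fK.
have zE n : (\sum_(n < N) z n *: unit_vector s M n) n = z n :> K.
  by rewrite sum_unit_vectorE; case: ltnP => // /zN.
split; first exact: sum_unit_vector_horlicz.
move=> i k; rewrite /block_coord !zE /z !fK /=.
have [->|h1] := L1 i; first by rewrite !nth_nil of_real0 !mul0r.
by rewrite nth0 h1 of_real1 mul1r.
Qed.

Lemma block_coordP a x y i :
  block_coord (a *: x + y) i = a * block_coord x i + block_coord y i.
Proof. by []. Qed.

Lemma block_coord_sum I (r : seq I) (P : pred I) (c : I -> K) (F : I -> lorlicz s M) i :
  block_coord (\sum_(j <- r | P j) c j *: F j) i =
  \sum_(j <- r | P j) c j * block_coord (F j) i.
Proof. exact: lorlicz_sumE. Qed.

Lemma block_coord_nil x i : block_subspace x -> L i = [::] -> block_coord x i = 0.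
Proof. by move=> [_ /(_ i 0)]; rewrite /block_coord => -> ->; rewrite of_real0 mul0r. Qed.

Lemma admissible_of_rnorm_lt x (r : R) : rnorm x < r -> lux_admissible M x r.
Proof.
rewrite rnorm_lorlicz => xr; have r0 : 0 < r by rewrite (le_lt_trans _ xr)// -rnorm_lorlicz rnorm_ge0.
have [r' rad rr'] := lux_norm_lt (lorlicz_lty x) xr.
have [r'0 _] := rad; apply/(lux_admissibleP _ _ r0) => N.
apply: le_trans ((lux_admissibleP _ _ r'0).1 rad N); apply: ler_sum => k _.
apply: orlicz_le; first by rewrite divr_ge0 ?modulus_ge0// ltW.
by rewrite ler_wpM2l ?modulus_ge0// lef_pV2 ?posrE// ltW.
Qed.

Lemma rnorm_le_admissible x (r : R) : lux_admissible M x r -> rnorm x <= r.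
Proof. by rewrite rnorm_lorlicz; exact: lux_norm_le. Qed.

(** As [idx] is injective, the sum of indicators is the indicator of the chosen blocks. Only moduli
    are prescribed, so one criterion covers all choices of signs. *)
Lemma flat_admissible k (idx : 'I_k -> nat) (L0 : seq R) x (r : R) :
  injective idx -> (forall l, L (idx l) = L0) -> block_subspace x ->
  (forall i, modulus (block_coord x i) = \sum_(l < k) (i == idx l)%:R) -> 0 < r ->
  lux_admissible M x r <-> k%:R * block_fun M L0 r^-1 <= 1.
Proof.
move=> idxI Lidx Xx hx r0; rewrite block_admissibleP//.
have E i : block_fun M (L i) (modulus (block_coord x i) / r) =
    \sum_(l < k) (i == idx l)%:R * block_fun M L0 r^-1.
  rewrite hx; have [[l il]|ni] := pselect (exists l, i = idx l).
    rewrite (bigD1 l)//= il eqxx big1 => [|j jl]; last first.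
      by rewrite (inj_eq idxI) eq_sym (negbTE jl).
    rewrite addr0 mul1r Lidx (bigD1 l)//= eqxx big1 ?mul1r ?addr0// => j jl.
    by rewrite (inj_eq idxI) eq_sym (negbTE jl) mul0r.
  have ni' l : (i == idx l) = false by apply/negP => /eqP ?; apply: ni; exists l.
  rewrite big1; last by move=> l _; rewrite ni'.
  by rewrite mul0r block_fun0 big1// => l _; rewrite ni' mul0r.
have N0 (l : 'I_k) : 0 <= block_fun M L0 r^-1.
  by rewrite -(Lidx l); apply: block_fun_ge0; [exact: block_ge0|rewrite invr_ge0 ltW].
have S I : \sum_(i < I) block_fun M (L i) (modulus (block_coord x i) / r) =
    \sum_(l < k) (idx l < I)%N%:R * block_fun M L0 r^-1.
  under eq_bigr do rewrite E; rewrite exchange_big; apply: eq_bigr => l _ /=.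
  rewrite -mulr_suml; congr (_ * _); case: ltnP => lI.
    rewrite (bigD1 (Ordinal lI))//= eqxx big1 ?addr0// => i il.
    by rewrite (_ : (_ == _) = false)//; apply/negbTE; apply: contraNneq il => h; apply/eqP/val_inj.
  by rewrite big1// => i _; rewrite ltn_eqF// (leq_trans (ltn_ord i)).
split=> [/(_ (\max_(l < k) idx l).+1)|h I]; rewrite S.
  under eq_bigr => l _ do rewrite ltnS leq_bigmax mul1r.
  by rewrite sumr_const card_ord mulr_natl.
apply: le_trans h; rewrite mulr_natl -[X in _ *+ X]card_ord -sumr_const.
by apply: ler_sum => l _; rewrite ler_piMl ?(N0 l)//; case: ltnP.
Qed.

End BlockSubspace.

(** * Parallelogram identity and signed sums *)

Section Parallelogram.
Variables (R : realType) (s : scalars).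
Local Notation K := (scalar_field R s).

Lemma hilbert_parallelogram (H : completeNormedModType K) (x y : H) : is_hilbert H ->
  rnorm (x + y) ^+ 2 + rnorm (x - y) ^+ 2 = 2 * (rnorm x ^+ 2 + rnorm y ^+ 2).
Proof.
move=> [dot hdot]; apply: (@of_real_inj R s).
have E (z : H) : of_real s (rnorm z ^+ 2) = dot z z.
  by rewrite expr2 of_realM of_real_rnorm -expr2 hdot.
have e1 : dot (x + y) (x + y) = dot x x + dot x y + (dot y x + dot y y).
  by rewrite linearDl !linearDr.
have e2 : dot (x - y) (x - y) = dot x x - dot x y - (dot y x - dot y y).
  by rewrite linearBl !linearBr.
have e3 : of_real s 2 = 2 :> K by rewrite [2 in LHS](_ : _ = 1 + 1) ?of_realD ?of_real1//; ring.
rewrite (of_realD s (rnorm (x + y) ^+ 2)) (of_realM s 2) (of_realD s (rnorm x ^+ 2)).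
rewrite !E e1 e2 e3.
by ring.
Qed.

(* Greedy choice: of the two signs, one is at most, the other at least, the
   parallelogram average; [c] is [1] or [-1] according to the side wanted. *)
Lemma greedy_signs (V : normedModType K) (c : R) (h : nat -> V) k :
  (forall x y : V, rnorm (x + y) ^+ 2 + rnorm (x - y) ^+ 2 =
    2 * (rnorm x ^+ 2 + rnorm y ^+ 2)) ->
  exists e : nat -> bool, c * rnorm (\sum_(i < k) (-1) ^+ e i *: h i) ^+ 2 <=
    c * \sum_(i < k) rnorm (h i) ^+ 2.
Proof.
move=> par; elim: k => [|k [e he]].
  by exists xpredT; rewrite !big_ord0 rnorm0 expr0n.
set v := \sum_(i < k) _ in he.
have [b hb] : exists b : bool, c * rnorm (v + (-1) ^+ b *: h k) ^+ 2 <=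
    c * (rnorm v ^+ 2 + rnorm (h k) ^+ 2).
  have p := congr1 ( *%R c) (par v (h k)); rewrite mulrDr mulrCA in p.
  have [h1|h1] := leP (c * rnorm (v + h k) ^+ 2) (c * (rnorm v ^+ 2 + rnorm (h k) ^+ 2)).
    by exists false; rewrite expr0 scale1r.
  by exists true; rewrite expr1 scaleN1r; lra.
exists (fun i => if i == k then b else e i); rewrite !big_ord_recr/= eqxx.
rewrite (eq_bigr (fun i : 'I_k => (-1) ^+ e i *: h i)); last first.
  by move=> i _; rewrite ltn_eqF.
rewrite -/v; apply: (le_trans hb); rewrite mulrDr [leRHS]mulrDr; lra.
Qed.

Lemma linear_on_sum (V W : lmodType K) (E : set V) (T : V -> W) k (c : nat -> K) (v : nat -> V) :
  linear_subspace E -> linear_on E T -> (forall i, E (v i)) ->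
  E (\sum_(i < k) c i *: v i) /\
  T (\sum_(i < k) c i *: v i) = \sum_(i < k) c i *: T (v i).
Proof.
move=> [E0 EL] TL Ev.
have T0 : T 0 = 0.
  have := TL 1 0 0 E0 E0; rewrite !scale1r addr0 => h.
  by apply: (addIr (T 0)); rewrite add0r -h.
elim: k => [|k [IH1 IH2]]; first by rewrite !big_ord0.
rewrite !big_ord_recr/= addrC [RHS]addrC; split; first exact: EL.
by rewrite TL// IH2.
Qed.

End Parallelogram.

Section NotHilbertian.
Variables (R : realType) (s : scalars) (M : orlicz_function R).
Variables (f : nat * nat -> nat) (g : nat -> nat * nat).
Hypotheses (fK : cancel f g) (gK : cancel g f).
Variable L : nat -> seq R.
Hypothesis L01 : forall i c, c \in L i -> 0 <= c <= 1.
Hypothesis L1 : forall i, L i = [::] \/ head 0 (L i) = 1.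
Local Notation K := (scalar_field R s).

(* [k] equal blocks with modular [N] whose signed sums have norm about [r], far
   from the value [sqrt k] (up to the norm of one block) of a Hilbert space. *)
Definition far_from_hilbert (C : R) (N : R -> R) (k : nat) := exists2 r : R, 0 < r &
  (1 < k%:R * N r^-1 /\ C * (k%:R * N 1 ^+ 2) <= r ^+ 2) \/
  (k%:R * N r^-1 <= 1 /\ C * r ^+ 2 <= k%:R).

(** By [flat_admissible] all signed sums of the k blocks have the same norm. In H, suitable signs
    make the squared norm of the image at most, or at least, the sum of the squares. An isomorphism
    with bounds CT and CS for T and S cannot reconcile this with a deviation C > (CT CS)^2. *)
Lemma block_subspace_not_hilbertian :
  (forall C : R, exists k (idx : nat -> nat) (L0 : seq R), [/\ injective idx,
    forall l, (l < k)%N -> L (idx l) = L0, head 0 L0 = 1, 1 <= block_fun M L0 1 &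
    far_from_hilbert C (block_fun M L0) k]) ->
  ~ hilbertian (@block_subspace R s M f L).
Proof.
move=> hbad [H [hH [T [S [TL Tf Sf ST TS Tc Sc]]]]].
set X := @block_subspace R s M f L in TL Tf Sf ST TS Tc Sc.
have [Xsub _] : closed_subspace X by exact: block_subspace_closed.
have par := fun x y => @hilbert_parallelogram R s H x y hH.
have SL : linear_on [set: H] S.
  move=> a x y _ _.
  have Sx z : X (S z) by exact: Sf.
  have [E0 EL] := Xsub.
  have XS : X (a *: S x + S y) by exact: EL.
  have TSz z : T (S z) = z by apply: TS; rewrite inE.
  have STz z : X z -> S (T z) = z by move=> Xz; apply: ST; rewrite inE.
  by rewrite -[RHS]STz// TL// !TSz.
have Hsub : linear_subspace [set: H] by [].
have [CT CT0 hT] := continuous_on_bounded Xsub TL Tc.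
have [CS CS0 hS] := continuous_on_bounded Hsub SL Sc.
have [k [idx [L0 [idxI Lidx hL0 N1 [r r0 hr]]]]] := hbad ((CT * CS) ^+ 2 + 1).
set N := block_fun M L0 in N1 hr.
have k0 : (0 < k)%N.
  case: k hr {Lidx} => // -[[+ _]|[_]]; first by rewrite mul0r ltr10.
  rewrite leNgt => /negP; case; rewrite mulr_gt0 ?exprn_gt0//.
  by rewrite ltr_wpDl// sqr_ge0.
have L00 c : c \in L0 -> 0 <= c by rewrite -(Lidx 0 k0) => /L01/andP[].
have /choice[u hu] : forall l, exists x : lorlicz s M, X x /\
    forall i, block_coord f x i = of_real s (nth 0 (L i) 0) * (i == idx l)%:R.
  move=> l; have [|x Xx hx] := @block_vector R s M f g fK gK L L1
    (fun i => (i == idx l)%:R) (idx l).+1; first by move=> i li; rewrite gtn_eqF.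
  by exists x; split => // i; exact: hx.
have Xu l : X (u l) by case: (hu l).
have cu l i : (l < k)%N -> block_coord f (u l) i = (i == idx l)%:R.
  move=> lk; have [_ ->] := hu l; have [->|] := eqVneq i (idx l); last by rewrite mulr0.
  by rewrite Lidx// nth0 hL0 of_real1 mulr1.
have m01 (b : bool) : modulus (b%:R : K) = b%:R.
  by case: b; rewrite ?modulus1 ?modulus0.
have msgn (b : bool) : modulus ((-1) ^+ b : K) = 1.
  by case: b; rewrite ?expr1 ?expr0 ?modulusN modulus1.
have u_adm l r' : (l < k)%N -> 0 < r' -> lux_admissible M (u l) r' <-> N r'^-1 <= 1.
  move=> lk r'0.
  rewrite (@flat_admissible R s M f g fK gK L L01 1 (fun=> idx l) L0)//.
  - by rewrite mul1r.
  - by move=> i j _; rewrite !ord1.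
  - by move=> _; exact: Lidx.
  - exact: Xu.
  - by move=> i; rewrite cu// big_ord1 m01.
pose v (e : nat -> bool) := \sum_(l < k) (-1) ^+ e l *: u l.
have v_adm e r' : 0 < r' -> lux_admissible M (v e) r' <-> k%:R * N r'^-1 <= 1.
  move=> r'0; apply: (@flat_admissible R s M f g fK gK L L01 k (fun l => idx l)) => //.
  - by move=> i j /idxI/val_inj.
  - by move=> l; exact: Lidx.
  - by case: (linear_on_sum k (fun l => (-1) ^+ e l) Xsub TL Xu).
  move=> i; rewrite block_coord_sum.
  rewrite (eq_bigr (fun l : 'I_k => (-1) ^+ e l * (i == idx l)%:R)) => [|l _]; last by rewrite cu.
  have [[l il]|ni] := pselect (exists l : 'I_k, i = idx l).
    have jF (j : 'I_k) : j != l -> (idx l == idx j) = false.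
      by move=> jl; apply/negbTE; apply: contraNneq jl => /idxI/val_inj ->.
    rewrite (bigD1 l)//= il eqxx mulr1 big1 => [|j /jF ->]; last by rewrite mulr0.
    by rewrite addr0 msgn (bigD1 l)//= eqxx big1 ?addr0// => j /jF ->.
  have ni' (l : 'I_k) : (i == idx l) = false by apply/negP => /eqP ?; apply: ni; exists l.
  by rewrite !big1 ?modulus0// => l _; rewrite ni' ?mulr0.
have Tv e : X (v e) /\ T (v e) = \sum_(l < k) (-1) ^+ e l *: T (u l).
  exact: (linear_on_sum k (fun l => (-1) ^+ e l) Xsub TL Xu).
have hS' x : X x -> rnorm x <= CS * rnorm (T x).
  by move=> Xx; rewrite -{1}(ST x) ?inE//; exact: hS.
case: hr => -[hk hC].
(* First alternative: signs with a small image, against the lower bound [r] for all signed sums. *)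
- have [e he] := greedy_signs 1 (fun l => T (u l)) k par.
  rewrite !mul1r in he; have [Xv Tve] := Tv e; rewrite -Tve in he.
  have rv : r <= rnorm (v e).
    rewrite leNgt; apply/negP => /admissible_of_rnorm_lt/(v_adm _ _ r0).
    by rewrite leNgt hk.
  have N0 : 0 < N 1 by exact: lt_le_trans N1.
  (* As N(1) >= 1, convexity gives N(1 / N(1)) <= 1. *)
  have ub l : (l < k)%N -> rnorm (u l) <= N 1.
    move=> lk; apply: rnorm_le_admissible; apply/(u_adm _ _ lk N0).
    rewrite -[X in N X]mulr1; apply: (le_trans (block_fun_scale _ _ _ _)) => //.
      by rewrite invr_ge0 (ltW N0)/= invf_le1.
    by rewrite mulVf// gt_eqF.
  have h1 : rnorm (T (v e)) ^+ 2 <= k%:R * (CT * N 1) ^+ 2.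
    apply: (le_trans he); rewrite mulr_natl -[X in _ *+ X]card_ord -sumr_const.
    apply: ler_sum => l _; rewrite ler_sqr ?nnegrE ?rnorm_ge0 ?mulr_ge0 ?(ltW CT0) ?(ltW N0)//.
    by apply: (le_trans (hT _ (Xu l))); rewrite ler_pM2l// ub.
  have h2 : r ^+ 2 <= CS ^+ 2 * rnorm (T (v e)) ^+ 2.
    rewrite -exprMn ler_sqr ?nnegrE ?(ltW r0) ?mulr_ge0 ?rnorm_ge0 ?(ltW CS0)//.
    by apply: (le_trans rv); exact: hS'.
  have h3 : r ^+ 2 <= (CT * CS) ^+ 2 * (k%:R * N 1 ^+ 2).
    apply: (le_trans h2); apply: (le_trans (ler_wpM2l (sqr_ge0 _) h1)).
    by rewrite le_eqVlt; apply/orP; left; apply/eqP; ring.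
  have : 0 < k%:R * N 1 ^+ 2 by rewrite mulr_gt0 ?exprn_gt0// ltr0n.
  by move: hC; rewrite mulrDl mul1r; lra.
(* Second alternative: signs with a large image, against the upper bound [r] for all signed sums. *)
- have [e he] := greedy_signs (-1) (fun l => T (u l)) k par.
  rewrite !mulN1r lerN2 in he; have [Xv Tve] := Tv e; rewrite -Tve in he.
  have vr : rnorm (v e) <= r by apply: rnorm_le_admissible; apply/(v_adm _ _ r0).
  (* For r' < 1 convexity gives N(1 / r') >= N(1) / r' > 1, so no such r' is admissible. *)
  have ub l : (l < k)%N -> 1 <= rnorm (u l).
    move=> lk; rewrite leNgt; apply/negP => u1.
    have [r' r'u r'1] : exists2 r', rnorm (u l) < r' & r' < 1.
      by exists ((rnorm (u l) + 1) / 2); lra.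
    have r'0 : 0 < r' by rewrite (le_lt_trans _ r'u)// rnorm_ge0.
    have /(u_adm _ _ lk r'0) : lux_admissible M (u l) r' by exact: admissible_of_rnorm_lt.
    rewrite leNgt => /negP; apply.
    have h := @block_fun_scale R M L0 r' r'^-1 L00.
    rewrite divff ?gt_eqF// (ltW r'0) (ltW r'1) -/N in h.
    have {}h : N 1 <= r' * N r'^-1 by apply: h => //; rewrite invr_ge0 ltW.
    have : 1 <= r' * N r'^-1 by exact: le_trans h.
    rewrite -ler_pdivrMl// mulr1; apply: lt_le_trans.
    by rewrite invf_gt1.
  have h1 : k%:R <= CS ^+ 2 * rnorm (T (v e)) ^+ 2.
    apply: (@le_trans _ _ (CS ^+ 2 * \sum_(i < k) rnorm (T (u i)) ^+ 2)); last first.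
      by rewrite ler_wpM2l// sqr_ge0.
    rewrite mulr_sumr -[X in X%:R]card_ord -sumr_const; apply: ler_sum => l _.
    rewrite -exprMn -[leLHS](expr1n _ 2) ler_sqr ?nnegrE ?mulr_ge0 ?rnorm_ge0 ?(ltW CS0)//.
    by apply: (le_trans (ub l _)) => //; exact: hS'.
  have h2 : k%:R <= (CT * CS) ^+ 2 * r ^+ 2.
    have h3 : rnorm (T (v e)) ^+ 2 <= (CT * r) ^+ 2.
      rewrite ler_sqr ?nnegrE ?mulr_ge0 ?rnorm_ge0 ?(ltW CT0) ?(ltW r0)//.
      by apply: (le_trans (hT _ Xv)); rewrite ler_pM2l.
    apply: (le_trans h1); apply: (le_trans (ler_wpM2l (sqr_ge0 CS) h3)).
    by rewrite le_eqVlt; apply/orP; left; apply/eqP; ring.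
  have : 0 < r ^+ 2 by rewrite exprn_gt0.
  by move: hC; rewrite mulrDl mul1r; lra.
Qed.

End NotHilbertian.

(** * Nearly Euclidean tails *)

Section FiniteDimensional.
Variables (R : realType) (s : scalars) (M : orlicz_function R).
Local Notation K := (scalar_field R s).

(** The ranks of the matrices of the first m coordinates are at most n. From an m of maximal rank
    on, the kernel no longer shrinks, so coefficients in that kernel give the zero vector. *)
Lemma coordinates_determine n (b : 'I_n -> lorlicz s M) :
  (forall a, comb b a = 0 -> a = 0) ->
  exists m, forall a : 'rV[K]_n, a *m (\matrix_(l < n, p < m) (b l p : K)) = 0 -> a = 0.
Proof.
move=> b0; pose A m : 'M[K]_(n, m) := \matrix_(l < n, p < m) (b l p : K).
pose P r := `[< exists m, \rank (A m) = r >].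
have Pn r : P r -> (r <= n)%N by move=> /asboolP[m <-]; exact: rank_leq_row.
have P0 : exists r, P r by exists (\rank (A 0)); apply/asboolP; exists 0.
have [r /asboolP[m mr] maxr] := ex_maxnP P0 Pn.
exists m => a; rewrite -/(A m) => aA; apply: b0; apply: val_inj; apply/funext => p.
have AE m' (q : 'I_m') : (a *m A m') 0 q = comb b a q.
  by rewrite /comb lorlicz_sumE mxE; apply: eq_bigr => l _; rewrite mxE.
pose m' := (maxn m p.+1).
have sub : (kermx (A m') <= kermx (A m))%MS.
  apply/rV_subP => v /sub_kermxP vA; apply/sub_kermxP/rowP => q.
  have qm : (q < m')%N by apply: leq_trans (ltn_ord q) (leq_maxl _ _).
  have := congr1 (fun w : 'rV_m' => w 0 (Ordinal qm)) vA; rewrite !mxE => vA0.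
  by rewrite -[RHS]vA0; apply: eq_bigr => l _; rewrite !mxE.
have rk : (\rank (A m') <= \rank (A m))%N by rewrite mr; apply: maxr; apply/asboolP; exists m'.
have eqk : (kermx (A m) <= kermx (A m'))%MS.
  have [_ <-] := mxrank_leqif_sup sub; rewrite eqn_leq mxrankS//= !mxrank_ker.
  by rewrite leq_sub2l.
have /sub_kermxP aA' : (a <= kermx (A m'))%MS.
  by apply: submx_trans eqk; apply/sub_kermxP.
have pm : (p < m')%N by exact: leq_maxr.
transitivity ((a *m A m') 0 (Ordinal pm)); first by rewrite AE.
by rewrite aA' mxE.
Qed.

Lemma comb_mulmx (V : lmodType K) n m (b : 'I_n -> V) (A : 'M[K]_(m, n)) (d : 'rV[K]_m) :
  comb b (d *m A) = \sum_l d 0 l *: comb b (row l A).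
Proof.
rewrite /comb; under [RHS]eq_bigr do rewrite scaler_sumr.
rewrite exchange_big; apply: eq_bigr => i _; rewrite mxE scaler_suml.
by apply: eq_bigr => l _; rewrite scalerA mxE.
Qed.

Lemma admissibleZ (x : lorlicz s M) (t r : R) : 0 < t ->
  lux_admissible M x r -> lux_admissible M (of_real s t *: x) (t * r).
Proof.
move=> t0 xr; have := @lux_admissibleZ R s M (of_real s t) x r _ xr.
rewrite modulus_of_real gtr0_norm//; apply.
by rewrite -modulus_gt0 modulus_of_real gtr0_norm.
Qed.

(** [near_auerbach] is applied to the coefficient vectors of the modular unit ball. They are
    bounded, because the right inverse [B'] reads the coefficients off finitely many coordinates,
    and they include small multiples of the unit vectors. *)
Lemma unit_ball_basis n (b : 'I_n -> lorlicz s M) : (forall a, comb b a = 0 -> a = 0) ->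
  exists A : 'M[K]_n, [/\ A \in unitmx, forall l, lux_admissible M (comb b (row l A)) 1 &
    forall a l, lux_admissible M (comb b a) 1 -> modulus ((a *m invmx A) 0 l) <= 2].
Proof.
move=> b0; have [m hm] := coordinates_determine b0.
set B := (\matrix_(l < n, p < m) _) in hm.
have /row_freeP[B' BB'] : row_free B.
  rewrite -kermx_eq0; apply/eqP/row_matrixP => i; rewrite row0; apply: hm.
  by apply/sub_kermxP; exact: row_sub.
have [D D0 hD] := orlicz_coord_bound s M.
pose C := \sum_(l < n) \sum_(q < m) D * modulus (B' q l).
pose beta := 1 + \sum_l rnorm (b l).
have beta0 : 0 < beta by rewrite ltr_pwDl// sumr_ge0// => *; exact: rnorm_ge0.
have h2b : 0 < (2 * beta)^-1 by rewrite invr_gt0 mulr_gt0.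
apply: (@near_auerbach R s n (fun a => lux_admissible M (comb b a) 1) C (2 * beta)^-1) => //.
- move=> a l /rnorm_le_admissible xa.
  have -> : a 0 l = \sum_(q < m) comb b a q * B' q l.
    rewrite -[a in LHS]mulmx1 -BB' mulmxA mxE; apply: eq_bigr => q _; congr (_ * _).
    by rewrite /comb lorlicz_sumE mxE; apply: eq_bigr => i _; rewrite mxE.
  apply: (le_trans (modulus_sum _ _ _)).
  apply: (@le_trans _ _ (\sum_(q < m) D * modulus (B' q l))).
    apply: ler_sum => q _; rewrite modulusM ler_wpM2r ?modulus_ge0//.
    by apply: (le_trans (hD _ _)); rewrite ler_piMr// ltW.
  rewrite /C (bigD1 l)//= lerDl sumr_ge0// => i _; rewrite sumr_ge0// => q _.
  by rewrite mulr_ge0 ?modulus_ge0// ltW.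
- move=> l; apply: admissible_of_rnorm_lt.
  have -> : comb b (of_real s (2 * beta)^-1 *: delta_mx 0 l) = of_real s (2 * beta)^-1 *: b l.
    rewrite -[_ *: delta_mx 0 l]addr0 combP comb_delta (_ : comb b 0 = 0) ?addr0//.
    by rewrite /comb big1// => i _; rewrite mxE scale0r.
  rewrite rnormZ modulus_of_real gtr0_norm// mulrC ltr_pdivrMr ?mulr_gt0// mul1r.
  have : rnorm (b l) <= beta.
    rewrite /beta (bigD1 l)//= addrCA lerDl addr_ge0// sumr_ge0// => *; exact: rnorm_ge0.
  lra.
Qed.

End FiniteDimensional.

Section NearQuadratic.
Variables (R : realType) (M : orlicz_function R) (L0 : seq R) (e : R).
Hypothesis L00 : forall c, c \in L0 -> 0 <= c.
Hypothesis Nq : near_quadratic e (block_fun M L0).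
Local Notation N := (block_fun M L0).

(** A doubling estimate: at t / l near-quadraticity gives N(t) >= (l^2 - e) N(t / l), and e is at
    most half of l^2. *)
Lemma near_quadratic_dilate (l t : R) : 0 < l <= 1 -> 2 * e <= l ^+ 2 ->
  0 <= t <= l -> N (t / l) <= 2 / l ^+ 2 * N t.
Proof.
move=> /andP[l0 l1] el /andP[t0 tl].
have tl01 : 0 <= t / l <= 1 by rewrite divr_ge0 ?(ltW l0)//= ler_pdivrMr// mul1r.
have l01 : 0 <= l <= 1 by rewrite ltW.
have := Nq l01 tl01; rewrite mulrC divfK ?gt_eqF// ler_norml => /andP[h _].
have N0 : 0 <= N (t / l) by apply: block_fun_ge0 => //; case/andP: tl01.
have l2 : 0 < l ^+ 2 by rewrite exprn_gt0.
rewrite mulrAC ler_pdivlMr//; nra.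
Qed.

(** Some term u_l is at least the mean of all n, so the argument is at most 4n u_l, and dilating u_l
    by 4n costs 2 (4n)^2 = 32 n^2. *)
Lemma near_quadratic_sum n (u : 'I_n -> R) (d : R) : (forall l, 0 <= u l <= d) ->
  4 * n%:R * d <= 1 -> 32 * n%:R ^+ 2 * e <= 1 ->
  N (4 * \sum_l u l) <= 32 * n%:R ^+ 2 * \sum_l N (u l).
Proof.
move=> ud nd ne.
have [n0|n0] := posnP n.
  by subst n; rewrite !big_ord0 !mulr0 block_fun0.
have n0' : 0 < n%:R :> R by rewrite ltr0n.
have u0 l : 0 <= u l by case/andP: (ud l).
have Nu0 l : 0 <= N (u l) by exact: block_fun_ge0.
have [l hl] : exists l, \sum_i u i <= n%:R * u l.
  apply/not_existsP => h; have : \sum_(l < n) n%:R * u l < \sum_(l < n) \sum_i u i.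
    apply: ltr_sum => [|l _]; first by apply/hasP; exists (Ordinal n0); rewrite ?mem_index_enum.
    by rewrite ltNge; apply/negP/h.
  by rewrite -mulr_sumr sumr_const card_ord mulr_natl ltxx.
have l1 : 1 <= 4 * n%:R :> R by have : 1 <= n%:R :> R; [rewrite ler1n|lra].
have i0 : 0 < (4 * n%:R : R)^-1 <= 1.
  by rewrite invr_gt0 mulr_gt0//= invf_le1// mulr_gt0.
apply: (@le_trans _ _ (N (u l / (4 * n%:R)^-1))).
  apply: block_fun_le => //; first by rewrite mulr_ge0// sumr_ge0.
  by rewrite invrK; nra.
apply: (le_trans (near_quadratic_dilate i0 _ _)).
- rewrite exprVn -[leRHS]mul1r ler_pdivlMr ?exprn_gt0 ?mulr_gt0//; nra.
- rewrite u0/= -[leRHS]mul1r ler_pdivlMr ?mulr_gt0//.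
  case/andP: (ud l) => _ h; apply: le_trans nd; rewrite mulrC ler_pM2l// mulr_gt0//.
rewrite exprVn invrK [X in X <= _](_ : _ = 32 * n%:R ^+ 2 * N (u l)); last by ring.
rewrite ler_wpM2l ?mulr_ge0 ?exprn_ge0 ?ler0n//.
by rewrite (bigD1 l)//= lerDl sumr_ge0.
Qed.

Lemma near_quadratic_weight (S y : R) : 0 <= y <= S -> S <= 1 ->
  `|N y - N S / S ^+ 2 * y ^+ 2| <= e * N S.
Proof.
move=> /andP[y0 yS] S1; have [S0|S0] := eqVneq S 0.
  have -> : y = 0 by apply/eqP; rewrite eq_le y0 -S0 yS.
  by rewrite S0 block_fun0 mul0r mul0r subrr normr0 mulr0.
have Sp : 0 < S by rewrite lt_def S0 (le_trans y0).
have l01 : 0 <= y / S <= 1 by rewrite divr_ge0 ?(ltW Sp)//= ler_pdivrMr// mul1r.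
have S01 : 0 <= S <= 1 by rewrite ltW.
have := Nq l01 S01; rewrite divfK//; congr (`|_ - _| <= _).
by rewrite exprMn exprVn; ring.
Qed.

End NearQuadratic.

Section Asymptotic.
Variables (R : realType) (s : scalars) (M : orlicz_function R).
Variables (f : nat * nat -> nat) (g : nat -> nat * nat).
Hypotheses (fK : cancel f g) (gK : cancel g f).
Variable L : nat -> seq R.
Hypothesis L01 : forall i c, c \in L i -> 0 <= c <= 1.
Hypothesis L1 : forall i, L i = [::] \/ head 0 (L i) = 1.
Local Notation K := (scalar_field R s).
Local Notation X := (@block_subspace R s M f L).
Local Notation bc := (block_coord f).

(** The last clause, with convexity, keeps the block coordinates of vectors of modular at most 1
    below 1 / (m + 1). On a block with empty list the subspace vanishes. *)
Definition good_block (m : nat) (L0 : seq R) := L0 = [::] \/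
  near_quadratic m.+1%:R^-1 (block_fun M L0) /\ 1 <= block_fun M L0 m.+1%:R^-1.

(* On the tail, [|y i| <= S i] holds on the ball, where the modular is close to the
   quadratic form with weights [N i (S i) / S i ^+ 2]; finitely many of them suffice. *)
Lemma block_tail_near_hilbert n (k : R) (m I : nat) (b : 'I_n -> lorlicz s M) :
  0 < k < 1 -> 32 * n%:R ^+ 2 * m.+1%:R^-1 <= 1 :> R -> 4 * n%:R * m.+1%:R^-1 <= 1 :> R ->
  32 * n%:R ^+ 3 * m.+1%:R^-1 <= k / 2 -> (forall i, (I <= i)%N -> good_block m (L i)) ->
  (forall a, comb b a = 0 -> a = 0) -> (forall a, X (comb b a)) ->
  (forall a i, (i < I)%N -> bc (comb b a) i = 0) ->
  exists p (A0 : 'M[K]_(n, p)), forall a,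
    (1 - k) * rnorm (comb b a) ^+ 2 <= row_sqr (a *m A0) <= (1 + k) * rnorm (comb b a) ^+ 2.
Proof.
move=> /andP[k0 k1]; set e : R := m.+1%:R^-1 => n2e n1e n3e good b0 Xb bI.
have e0 : 0 < e by rewrite invr_gt0.
pose N i := block_fun M (L i).
have L00 i c : c \in L i -> 0 <= c by move=> /L01/andP[].
have N0 i t : 0 <= t -> 0 <= N i t by move=> t0; exact: block_fun_ge0 (@L00 i) t0.
have Nq i : (I <= i)%N -> near_quadratic e (N i).
  move=> /good[Ln|[]//] l t _ _; rewrite /N /block_fun Ln !big_nil.
  by rewrite !mulr0 subrr normr0.
have [A [Au Aadm Acoef]] := unit_ball_basis b0.
pose t l i := modulus (bc (comb b (row l A)) i).
have tI l i : (i < I)%N -> t l i = 0 by move=> iI; rewrite /t bI// modulus0.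
have t0 l i : 0 <= t l i by exact: modulus_ge0.
have tadm l J : \sum_(i < J) N i (t l i) <= 1.
  have := (block_admissibleP fK gK L01 (Xb _) ltr01).1 (Aadm l) J.
  by under eq_bigr do rewrite divr1.
(* If a coordinate t exceeded e, convexity would give N(e) <= (e / t) N(t) < 1. *)
have te l i : t l i <= e.
  have [Ii|/tI ->] := leqP I i; last exact: ltW.
  have [Ln|[_ Ne]] := good i Ii; first by rewrite /t (block_coord_nil (Xb _))// modulus0 ltW.
  rewrite leNgt; apply/negP => et; have tp : 0 < t l i by exact: lt_trans et.
  have h1 : N i (t l i) <= 1.
    apply: le_trans (tadm l i.+1); rewrite big_ord_recr/= lerDr sumr_ge0// => j _.
    exact: N0.
  have := @block_fun_scale R M (L i) (e / t l i) (t l i) (@L00 i).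
  rewrite divfK ?gt_eqF// -/(N i) => /(_ _ (t0 l i)) h2.
  have et1 : e / t l i < 1 by rewrite ltr_pdivrMr// mul1r.
  have : N i e < 1.
    apply: le_lt_trans (h2 _) _; first by rewrite divr_ge0 ?(ltW e0)//= ltW.
    by apply: le_lt_trans et1; rewrite ler_piMr// divr_ge0// ltW.
  by rewrite ltNge Ne.
(* The factor 4 occurs because vectors for which the radius 2 is admissible have coefficients at
   most 4 in the basis of the rows of A. *)
pose S i := 4 * \sum_l t l i.
have S0 i : 0 <= S i by rewrite mulr_ge0// sumr_ge0.
have SI i : (i < I)%N -> S i = 0 by move=> iI; rewrite /S big1 ?mulr0// => l _; exact: tI.
have S1 i : S i <= 1.
  apply: le_trans n1e; rewrite /S -mulrA ler_pM2l// mulr_natl -[X in _ *+ X]card_ord -sumr_const.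
  by apply: ler_sum => l _; exact: te.
have NS i : N i (S i) <= 32 * n%:R ^+ 2 * \sum_l N i (t l i).
  have [Ii|iI] := leqP I i.
    by apply: (near_quadratic_sum (@L00 i) (Nq i Ii) (d := e)) => // l; rewrite t0 te.
  rewrite SI// /N block_fun0 mulr_ge0 ?mulr_ge0 ?sqr_ge0// sumr_ge0// => l _.
  exact: N0.
pose P J := \sum_(i < J) N i (S i).
(* [NS] is summed over the blocks; each of the n basis vectors has modular at most 1. *)
have Pub J : P J <= 32 * n%:R ^+ 3.
  apply: (@le_trans _ _ (32 * n%:R ^+ 2 * \sum_l \sum_(i < J) N i (t l i))).
    rewrite exchange_big/= mulr_sumr; apply: ler_sum => i _; exact: NS.
  rewrite (exprSr _ 2) mulrA ler_wpM2l ?mulr_ge0 ?sqr_ge0//.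
  rewrite -[X in _ <= X%:R]card_ord -sumr_const; apply: ler_sum => l _; exact: tadm.
(* Beyond [J0] the majorants contribute at most k / 2 to any modular, so [J0] columns suffice in the
   matrix. *)
have [J0 hJ0] : exists J0, forall J, P (J0 + J)%N - P J0 <= k / 2.
  have /cvgrPdist_le h : cvgn P.
    apply: nondecreasing_is_cvgn; last by exists (32 * n%:R ^+ 3) => _ [J _ <-].
    by apply/nondecreasing_seqP => J; rewrite /P big_ord_recr/= lerDl N0.
  have [J0 _ hJ0] := h (k / 4) (divr_gt0 k0 (ltr0n _ 4)).
  exists J0 => J; have := hJ0 _ (leqnn J0); have := hJ0 _ (leq_addr J J0).
  by rewrite /= !ler_norml; set l := limn _; lra.
pose w i := N i (S i) / S i ^+ 2.
have w0 i : 0 <= w i by rewrite divr_ge0 ?sqr_ge0// N0.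
have W i (y : R) : 0 <= y <= S i -> `|N i y - w i * y ^+ 2| <= e * N i (S i).
  have [Ii|iI] := leqP I i => yS; first exact: (near_quadratic_weight (Nq i Ii) yS (S1 i)).
  have -> : y = 0 by apply/eqP; rewrite eq_le andbC; move: yS; rewrite SI.
  by rewrite SI// /N block_fun0 expr0n/= !mulr0 subrr normr0.
exists J0, (\matrix_(l, i) (of_real s (Num.sqrt (w i)) * bc (b l) i)).
set A0 := \matrix_(_, _) _.
pose y a i := modulus (bc (comb b a) i).
have QE a : row_sqr (a *m A0) = \sum_(i < J0) w i * y a i ^+ 2.
  apply: eq_bigr => i _; have -> : (a *m A0) 0 i = of_real s (Num.sqrt (w i)) * bc (comb b a) i.
    rewrite mxE block_coord_sum mulr_sumr; apply: eq_bigr => l _.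
    by rewrite mxE mulrCA.
  by rewrite modulusM modulus_of_real ger0_norm ?sqrtr_ge0// exprMn sqr_sqrtr.
have combZ r a : comb b (of_real s r *: a) = of_real s r *: comb b a.
  rewrite -[_ *: a]addr0 combP (_ : comb b 0 = 0) ?addr0//.
  by rewrite /comb big1// => i _; rewrite mxE scale0r.
have yZ r a i : 0 < r -> y (of_real s r *: a) i = r * y a i.
  move=> r0; rewrite /y combZ -[_ *: comb b a]addr0 block_coordP.
  have -> : bc (0 : lorlicz s M) i = 0 by [].
  by rewrite addr0 modulusM modulus_of_real gtr0_norm.
have QZ r a : 0 < r -> row_sqr (of_real s r *: a *m A0) = r ^+ 2 * row_sqr (a *m A0).
  move=> r0; rewrite !QE mulr_sumr; apply: eq_bigr => i _.
  by rewrite yZ// exprMn mulrCA.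
have yS a i : lux_admissible M (comb b a) 2 -> 0 <= y a i <= S i.
  move=> a2; rewrite modulus_ge0/=.
  have h2 : 0 < 2^-1 :> R by rewrite invr_gt0.
  have := admissibleZ h2 a2; rewrite mulVf// -combZ => a1.
  have dl l : modulus ((a *m invmx A) 0 l) <= 4.
    have := Acoef _ l a1; rewrite -scalemxAl mxE modulusM modulus_of_real gtr0_norm//.
    by rewrite ler_pdivrMl//; lra.
  rewrite /y -[a in comb b a](mulmxKV Au) comb_mulmx block_coord_sum.
  apply: (le_trans (modulus_sum _ _ _)); rewrite /S mulr_sumr; apply: ler_sum => l _.
  by rewrite modulusM ler_wpM2r ?modulus_ge0.
have ePJ : e * P J0 <= k / 2.
  by apply: le_trans n3e; rewrite mulrC ler_pM2r.
have Ksum a : lux_admissible M (comb b a) 2 ->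
    `|\sum_(i < J0) N i (y a i) - row_sqr (a *m A0)| <= k / 2.
  move=> a2; rewrite QE -sumrB; apply: (le_trans (ler_norm_sum _ _ _)); apply: le_trans ePJ.
  by rewrite /P mulr_sumr; apply: ler_sum => i _; apply: W; exact: yS.
have Klo a J : lux_admissible M (comb b a) 2 ->
    \sum_(i < J) N i (y a i) <= row_sqr (a *m A0) + k.
  move=> a2; apply: (@le_trans _ _ (\sum_(i < J0 + J) N i (y a i))).
    by rewrite addnC big_split_ord/= lerDl sumr_ge0// => i _; apply: N0; exact: modulus_ge0.
  rewrite big_split_ord/=; have := Ksum a a2; have := hJ0 J.
  rewrite /P big_split_ord/= ler_norml.
  have : \sum_(i < J) N (J0 + i)%N (y a (J0 + i)%N) <= \sum_(i < J) N (J0 + i)%N (S (J0 + i)%N).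
    apply: ler_sum => i _; have /andP[y0 yS'] := yS a (J0 + i)%N a2.
    exact: block_fun_le (@L00 _) y0 yS'.
  by move: (\sum_(i < J0) _) (\sum_(i < J) _) (\sum_(i < J) _) => ? ? ?; lra.
have adm2 a : lux_admissible M (comb b a) 1 -> lux_admissible M (comb b a) 2.
  by move=> /rnorm_le_admissible h; apply: admissible_of_rnorm_lt; lra.
have Q0 a : 0 <= row_sqr (a *m A0) by exact: row_sqr_ge0.
have Zinv r a : 0 < r -> lux_admissible M (comb b (of_real s r^-1 *: a)) 1 <->
    lux_admissible M (comb b a) r.
  move=> r0; rewrite combZ; split=> h.
    have := admissibleZ r0 h; rewrite scalerA -of_realM divff ?gt_eqF// of_real1 scale1r.
    by rewrite mulr1.
  have := admissibleZ (_ : 0 < r^-1) h; rewrite invr_gt0 mulVf ?gt_eqF//; exact.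
move=> a; set q := row_sqr _ in Q0 *; set rho := rnorm _.
have rho0 : 0 <= rho by exact: rnorm_ge0.
apply/andP; split; rewrite leNgt; apply/negP => h.
- have k1' : 0 < 1 - k by rewrite subr_gt0.
  have rhop : 0 < rho.
    rewrite lt_def rho0 andbT; apply/eqP => rz; move: h; rewrite rz expr0n/= mulr0.
    by rewrite ltNge Q0.
  (* A radius r < rho with q <= (1 - k) r^2 would be admissible by [Klo], against the definition of
     the norm. The lower bound 2/3 rho keeps a / r within the ball of radius 2, where [Klo]
     holds. *)
  pose r := Num.max (Num.sqrt (q / (1 - k))) (2 / 3 * rho).
  have qk0 : 0 <= q / (1 - k) by rewrite divr_ge0 ?Q0// ltW.
  have rlt : r < rho.
    rewrite /r gt_max; apply/andP; split; last by lra.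
    by rewrite -ltr_sqr ?nnegrE ?sqrtr_ge0// sqr_sqrtr// ltr_pdivrMr// mulrC.
  have r23 : 2 / 3 * rho <= r by rewrite le_max lexx orbT.
  have r0 : 0 < r by apply: lt_le_trans r23; rewrite mulr_gt0.
  have qr : q <= (1 - k) * r ^+ 2.
    rewrite mulrC -ler_pdivrMr// -[leLHS]sqr_sqrtr// ler_sqr ?nnegrE ?sqrtr_ge0 ?(ltW r0)//.
    by rewrite le_max lexx.
  have ri0 : 0 < r^-1 by rewrite invr_gt0.
  suff : lux_admissible M (comb b a) r.
    by move=> /rnorm_le_admissible; rewrite -/rho leNgt rlt.
  apply/(Zinv _ _ r0); set a' := _ *: a.
  have a2 : lux_admissible M (comb b a') 2.
    apply: admissible_of_rnorm_lt; rewrite /a' combZ rnormZ modulus_of_real gtr0_norm//.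
    by rewrite mulrC ltr_pdivrMr// -/rho; lra.
  apply/(block_admissibleP fK gK L01 (Xb _) ltr01) => J.
  under eq_bigr do rewrite divr1.
  apply: (le_trans (Klo a' J a2)); rewrite QZ// -/q exprVn -lerBrDr mulrC.
  by rewrite ler_pdivrMr// exprn_gt0.
- have kp : 0 < 1 + k by rewrite addr_gt0.
  have qp : 0 < q by apply: le_lt_trans h; rewrite mulr_ge0 ?sqr_ge0// ltW.
  (* At this radius the rescaled form equals 1 + k, while the modular is at most 1 and the two
     differ by at most k / 2. *)
  pose r := Num.sqrt (q / (1 + k)).
  have r0 : 0 < r by rewrite sqrtr_gt0 divr_gt0.
  have r2 : r ^+ 2 = q / (1 + k) by rewrite sqr_sqrtr// divr_ge0 ?(ltW qp) ?(ltW kp).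
  have ri0 : 0 < r^-1 by rewrite invr_gt0.
  have rlt : rho < r.
    by rewrite -ltr_sqr ?nnegrE ?(ltW r0)// r2 ltr_pdivlMr// mulrC.
  have /(Zinv _ _ r0) a1 := admissible_of_rnorm_lt rlt.
  have := Ksum _ (adm2 _ a1); rewrite QZ// -/q exprVn r2 invf_div divfK ?gt_eqF//.
  have := (block_admissibleP fK gK L01 (Xb _) ltr01).1 a1 J0.
  under eq_bigr do rewrite divr1.
  by rewrite ler_norml -/(y _ _); move: (\sum_(i < J0) _) => ?; lra.
Qed.

Lemma block_subspace_asymptotically_hilbertian :
  (forall m, exists I, forall i, (I <= i)%N -> good_block m (L i)) ->
  asymptotically_hilbertian_plus 1 X.
Proof.
move=> good e e0 n.
(* This choice gives (1 + k) / (1 - k) = 1 + e. *)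
pose k : R := e / (2 + e).
have e2 : 0 < 2 + e by rewrite addr_gt0.
have k01 : 0 < k < 1 by rewrite divr_gt0//= ltr_pdivrMr// mul1r ltrDr.
have [k0 k1] := andP k01.
have kD : (1 + k) / (1 - k) <= (1 + e) ^+ 2.
  rewrite ler_pdivrMr ?subr_gt0// -(ler_pM2r e2).
  rewrite [leLHS](_ : _ = 2 + 2 * e); last by rewrite /k; field; rewrite gt_eqF.
  rewrite [leRHS](_ : _ = 2 * (1 + e) ^+ 2); last by rewrite /k; field; rewrite gt_eqF.
  nra.
(* One m meets all three smallness conditions on 1 / (m + 1), since n and n^2 are at most n^3 and k
   < 1. *)
pose m := Num.truncn (64 * (n%:R ^+ 3 + 1) / k).
have hm : 64 * (n%:R ^+ 3 + 1) <= k * m.+1%:R.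
  by have := truncnS_gt (64 * (n%:R ^+ 3 + 1) / k); rewrite -/m ltr_pdivrMr// => /ltW; rewrite (mulrC k).
have m0 : 0 < m.+1%:R :> R by [].
have n30 : 0 <= n%:R ^+ 3 :> R by rewrite exprn_ge0.
have n23 : n%:R ^+ 2 <= n%:R ^+ 3 :> R.
  by rewrite -!natrX ler_nat; case: (n) => // p; exact: leq_pexp2l.
have n13 : n%:R <= n%:R ^+ 3 :> R.
  by rewrite -[leLHS]expr1 -!natrX ler_nat; case: (n) => // p; exact: leq_pexp2l.
have km : k * m.+1%:R <= m.+1%:R by rewrite ler_piMl// ltW.
have [I hI] := good m.
have [[X0 XL] Xc] : closed_subspace X by exact: block_subspace_closed.
(* The tail drops the blocks before [I]; all later blocks are good for m. *)
exists [set x | X x /\ forall i, (i < I)%N -> bc x i = 0]; split.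
- split.
    split; first by split.
    move=> a x y [Xx hx] [Xy hy]; split; first exact: XL.
    by move=> i iI; rewrite block_coordP hx// hy// mulr0 addr0.
  move=> x /closure_rnormP cx; split.
    by apply: Xc; apply/closure_rnormP => d /cx[y [Xy _] xy]; exists y.
  move=> i iI; have [B B0 hB] := orlicz_coord_bound s M.
  apply: modulus_eq0; apply/eqP; rewrite eq_le modulus_ge0 andbT.
  apply/ler_addgt0Pr => d d0; rewrite add0r.
  have [y [Xy hy] xy] := cx (d / B) (divr_gt0 d0 B0).
  have -> : bc x i = bc (x - y) i.
    have -> : bc (x - y) i = bc x i - bc y i by [].
    by rewrite hy// subr0.
  by apply: (le_trans (hB _ _)); rewrite mulrC -ler_pdivlMr// ltW.
- by move=> x [].
- have /choice[v hv] : forall j : nat, exists x : lorlicz s M, X x /\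
      forall i, bc x i = of_real s (nth 0 (L i) 0) * (i == j)%:R.
    move=> j; have [|x Xx hx] := @block_vector R s M f g fK gK L L1
      (fun i => (i == j)%:R) j.+1; first by move=> i ji; rewrite gtn_eqF.
    by exists x; split => // i; exact: hx.
  exists I, (fun i : 'I_I => v i); split; first by move=> i; case: (hv i).
  (* Subtracting this combination cancels the first I block coordinates; where the list is empty,
     the coordinate is already 0. *)
  move=> x Xx; exists (fun i : 'I_I => bc x i).
  have Xv : X (\sum_(i < I) bc x i *: v i).
    by case: (@linear_on_sum R s _ _ X id I (fun i => bc x i) v) => // i; case: (hv i).
  split; first by rewrite addrC -scaleN1r; exact: XL.
  move=> i iI.
  have -> : bc (x - \sum_(j < I) bc x j *: v j) i = bc x i - bc (\sum_(j < I) bc x j *: v j) i by [].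
  rewrite block_coord_sum (bigD1 (Ordinal iI))//= big1 ?addr0 => [|j ji]; last first.
    have [_ ->] := hv j; rewrite (_ : (i == j) = false) ?mulr0//.
    by apply/negbTE; apply: contraNneq ji => ij; apply/eqP/val_inj.
  have [_ ->] := hv i; rewrite eqxx mulr1.
  have [Ln|hd] := L1 i; first by rewrite (block_coord_nil Xx Ln) mul0r subrr.
  by rewrite nth0 hd of_real1 mulr1 subrr.
- move=> E Esub EY [b [EE bindep]].
  have b0 a : comb b a = 0 -> a = 0.
    by move=> h; apply/rowP => i; rewrite mxE; exact: (bindep (fun i => a 0 i)).
  have Eb a : E (comb b a) by rewrite EE; apply/comb_span; exists a.
  have [|||||p [A0 hA0]] := @block_tail_near_hilbert n k m I b k01 _ _ _ hI b0.
  + by rewrite ler_pdivrMr// mul1r; lra.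
  + by rewrite ler_pdivrMr// mul1r; lra.
  + by rewrite ler_pdivrMr//; lra.
  + by move=> a; case: (EY _ (Eb a)).
  + by move=> a i; case: (EY _ (Eb a)) => _; exact.
  rewrite EE; apply: (bm_distance_le b0 k01 _ kD hA0).
  by rewrite addr_ge0// ltW.
Qed.

End Asymptotic.

(** * Choice of the blocks *)

Section FarBlocks.
Variables (R : realType) (M : orlicz_function R).
Hypothesis M_gt0 : forall t : R, 0 < t -> 0 < M t.

Lemma near_quadraticW (L0 : seq R) (e e' : R) : (forall c, c \in L0 -> 0 <= c) -> e <= e' ->
  near_quadratic e (block_fun M L0) -> near_quadratic e' (block_fun M L0).
Proof.
move=> L00 ee' h l t l01 t01; apply: (le_trans (h l t l01 t01)).
by rewrite ler_wpM2r// block_fun_ge0//; case/andP: t01.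
Qed.

Lemma far_from_hilbertW (C C' : R) (N : R -> R) k : C <= C' ->
  far_from_hilbert C' N k -> far_from_hilbert C N k.
Proof.
move=> CC' [r r0 [[h1 h2]|[h1 h2]]]; exists r => //; [left|right]; split => //.
  by apply: le_trans h2; rewrite ler_wpM2r// mulr_ge0// sqr_ge0.
by apply: le_trans h2; rewrite ler_wpM2r// sqr_ge0.
Qed.

(** The head is 1 and all coefficients are at most 1, so M <= N <= z M with z the length of the
    list, and N deviates from t^2 as M does. At a point t of large deviation, about 1 / N(t) copies
    have signed sums of norm about 1 / t, far from the square root of their number. *)
Lemma exists_far_from_hilbert (L0 : seq R) (C : R) :
  (forall D : R, 0 < D -> exists2 t, 0 < t <= 1 & D * t ^+ 2 < M t \/ D * M t < t ^+ 2) ->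
  head 0 L0 = 1 -> (forall c, c \in L0 -> 0 <= c <= 1) -> 1 <= block_fun M L0 1 ->
  1 <= C -> exists k, far_from_hilbert C (block_fun M L0) k.
Proof.
move=> hD hL L01 N1 C1; set N := block_fun M L0 in N1 *.
have L00 c : c \in L0 -> 0 <= c by move=> /L01/andP[].
have C0 : 0 < C by exact: lt_le_trans C1.
have B0 : 0 < N 1 by exact: lt_le_trans N1.
set B := N 1 in N1 B0 *; pose z : R := (size L0)%:R.
have z1 : 1 <= z.
  by rewrite ler1n lt0n size_eq0; apply/eqP => L0n; move: hL; rewrite L0n => /eqP; rewrite eq_sym oner_eq0.
have z0 : 0 < z by exact: lt_le_trans z1.
(* [D1] pays for k <= (1 + B) / N(t) and the factor B^2 in the first alternative, [D2] for N <= z M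
   and for rounding down in the second. *)
pose D1 := C * (B ^+ 2 * (1 + B)); pose D2 := 2 * C * z.
have D10 : 0 < D1 by rewrite !mulr_gt0 ?exprn_gt0 ?addr_gt0.
have D20 : 0 < D2 by rewrite !mulr_gt0.
have [t /andP[t0 t1] hM] := hD (D1 + D2) (addr_gt0 D10 D20).
have Mt := M_gt0 t0.
have MN : M t <= N t.
  rewrite /N /block_fun; move: hL L00; case: (L0) => [/eqP|c L' /= ->]; first by rewrite eq_sym oner_eq0.
  move=> L00; rewrite big_cons mul1r lerDl big_seq sumr_ge0// => c' c'L.
  by rewrite orlicz_ge0// mulr_ge0 ?(ltW t0)// L00// inE c'L orbT.
have NM : N t <= z * M t.
  rewrite /N /block_fun /z -sum1_size natr_sum mulr_suml !big_seq ler_sum// => c cL.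
  rewrite mul1r; have /andP[c0 c1] := L01 c cL.
  by apply: orlicz_le; rewrite ?mulr_ge0 ?(ltW t0)// ler_piMl// ltW.
have Nt : 0 < N t by exact: lt_le_trans MN.
have NB : N t <= B by apply: block_fun_le => //; exact: ltW.
have t20 : 0 < t ^+ 2 by rewrite exprn_gt0.
have ti0 : 0 < t^-1 by rewrite invr_gt0.
case: hM => hM.
- exists (Num.truncn (N t)^-1).+1; exists t^-1 => //; left; rewrite invrK; split.
    by rewrite -ltr_pdivrMr// mul1r truncnS_gt.
  have kle : (Num.truncn (N t)^-1).+1%:R <= (1 + B) / N t.
    rewrite -natr1 mulrDl mul1r lerD//; first by rewrite truncn_le// invr_ge0 ltW.
    by rewrite ler_pdivlMr// mul1r.
  apply: (@le_trans _ _ (D1 / N t)).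
    rewrite /D1 -mulrA ler_pM2l// mulrC -mulrA ler_pM2l ?exprn_gt0//.
  rewrite exprVn ler_pdivrMr// mulrC ler_pdivlMr//.
  apply: (le_trans _ MN); apply: (le_trans _ (ltW hM)).
  by rewrite ler_pM2r// lerDl ltW.
- exists (Num.truncn (N t)^-1); exists t^-1 => //; right; rewrite invrK; split.
    by rewrite -ler_pdivlMr// mul1r truncn_le// invr_ge0 ltW.
  have h2N : 2 * C * N t <= t ^+ 2.
    apply: (le_trans _ (ltW hM)); apply: (@le_trans _ _ (D2 * M t)).
      by rewrite /D2 -[leRHS]mulrA ler_pM2l// mulr_gt0.
    by rewrite ler_pM2r// lerDr ltW.
  have N2 : 2 * N t <= 1.
    have : t ^+ 2 <= 1 by rewrite exprn_ile1// ltW.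
    nra.
  have kge : (N t)^-1 < (Num.truncn (N t)^-1).+1%:R by exact: truncnS_gt.
  rewrite -natr1 in kge.
  have i2 : 2 <= (N t)^-1 by rewrite -[leRHS]mul1r ler_pdivlMr.
  apply: (@le_trans _ _ ((N t)^-1 / 2)); last by lra.
  rewrite exprVn ler_pdivrMr// [leRHS](_ : _ = t ^+ 2 / (2 * N t)).
    by rewrite ler_pdivlMr ?mulr_gt0// mulrA (mulrC C).
  by field; rewrite gt_eqF.
Qed.

End FarBlocks.

Theorem theorem2p4 (R : realType) (s : scalars) (M : orlicz_function R)
    (M_gt0 : forall t : R, 0 < t -> 0 < M t)
    (alphaM : alpha_index M = 2%:E) (betaM : beta_index M = 2%:E)
    (hM_not_hilbertian : ~ hilbertian (horlicz s M)) :
  exists X : set (lorlicz s M),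
    [/\ closed_subspace X, X `<=` horlicz s M, ~ hilbertian X &
        asymptotically_hilbertian_plus 1 X].
Proof.
(* If both reverse inequalities held on (0,1] for one D, M would be equivalent to t^2 and h_M
   Hilbertian. *)
have hD (D : R) : 0 < D -> exists2 t, 0 < t <= 1 & D * t ^+ 2 < M t \/ D * M t < t ^+ 2.
  move=> D0; apply: contrapT => h; apply: hM_not_hilbertian.
  have h' t : 0 <= t <= 1 -> M t <= D * t ^+ 2 /\ t ^+ 2 <= D * M t.
    move=> /andP[t0 t1]; have [->|tn0] := eqVneq t 0.
      by rewrite orlicz0 expr0n/= !mulr0.
    have tp : 0 < t by rewrite lt_def tn0.
    split; rewrite leNgt; apply/negP => ht; apply: h; exists t; rewrite ?tp//; first by left.
    by right.
  apply: (@hilbertian_of_equivalent_to_square R s M D^-1 D); first by rewrite invr_gt0.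
    by move=> t /h'[_]; rewrite ler_pdivrMl.
  by move=> t /h'[].
have inv01 m : 0 < (m.+1%:R : R)^-1 <= 1 by rewrite invr_gt0 ltr0Sn/= invf_le1// ler1n.
(* The m-th group consists of a block and a number of copies, with accuracy 1 / (m + 1) and
   deviation m + 1. *)
have /choice[F hF] : forall m, exists Lk : seq R * nat, [/\ head 0 Lk.1 = 1,
    forall c, c \in Lk.1 -> 0 <= c <= 1, near_quadratic m.+1%:R^-1 (block_fun M Lk.1),
    1 <= block_fun M Lk.1 m.+1%:R^-1 & far_from_hilbert m.+1%:R (block_fun M Lk.1) Lk.2].
  move=> m; have [L0 [h1 h2 h3 h4]] := exists_near_quadratic_block alphaM betaM M_gt0 (inv01 m).
  have N1 : 1 <= block_fun M L0 1.
    have /andP[i0 i1] := inv01 m.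
    by apply: (le_trans h4); apply: block_fun_le => // c /h2/andP[].
  have m1 : 1 <= m.+1%:R :> R by rewrite ler1n.
  have [k hk] := exists_far_from_hilbert M_gt0 hD h1 h2 N1 m1.
  by exists (L0, k).
have [f [g [fK gK]]] := nat_pairing.
(* The pairing serves a second time: block i is copy (g i).2 of group (g i).1, and indices beyond
   the number of copies receive the empty list. *)
pose L i := if ((g i).2 < (F (g i).1).2)%N then (F (g i).1).1 else [::].
have L01 i c : c \in L i -> 0 <= c <= 1.
  by rewrite /L; case: ifP => // _; have [_ + _ _ _] := hF (g i).1; apply.
have L1 i : L i = [::] \/ head 0 (L i) = 1.
  by rewrite /L; case: ifP => _; [right; case: (hF (g i).1)|left].
exists (@block_subspace R s M f L); split.
- exact: block_subspace_closed.
- by move=> x [].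
- apply: (block_subspace_not_hilbertian fK gK L01 L1) => C.
  (* Truncation gives C < m + 1, the deviation of group m. *)
  pose m := Num.truncn C; have [h1 h2 h3 h4 h5] := hF m.
  exists (F m).2, (fun l => f (m, l)), (F m).1; split => //.
  + by move=> l l' /(congr1 g); rewrite !fK => -[].
  + by move=> l lk; rewrite /L fK /= lk.
  + have /andP[i0 i1] := inv01 m.
    by apply: (le_trans h4); apply: block_fun_le => // c /h2/andP[].
  + by apply: far_from_hilbertW h5; rewrite ltW// truncnS_gt.
- apply: (block_subspace_asymptotically_hilbertian s fK gK L01 L1) => m.
  (* Nonempty blocks from this index on belong to groups j >= m, whose accuracy 1 / (j + 1) is at
     most 1 / (m + 1). *)
  exists (\max_(j < m) \max_(l < (F j).2) f (j : nat, l : nat)).+1 => i.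
  case E : (g i) => [j l] Ii; rewrite /L E /=.
  case: ltnP => [lk|_]; last by left.
  have mj : (m <= j)%N.
    rewrite leqNgt; apply/negP => jm; move: Ii; rewrite ltnNge => /negP; apply.
    rewrite -(gK i) E; apply: leq_trans (leq_bigmax (Ordinal jm)) => /=.
    exact: (leq_bigmax (Ordinal lk)).
  right; have [h1 h2 h3 h4 h5] := hF j.
  have L00 c : c \in (F j).1 -> 0 <= c by move=> /h2/andP[].
  have jm : (j.+1%:R : R)^-1 <= m.+1%:R^-1 by rewrite lef_pV2 ?posrE ?ltr0Sn// ler_nat.
  split; first exact: near_quadraticW h3.
  by apply: (le_trans h4); apply: block_fun_le.
Qed.
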